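(* Let $a,b\in\mathbb{R}$ satisfy $\tfrac12\le a<\tfrac58$ and $0<b<\tfrac12$, and let $c_{W,1},c_{W,2},c_w>0$. Let $\mu=(\mu_k)_{k\in\mathbb{N}^*}$ be an increasing sequence of distinct real numbers with $\mu_1\ge 1$ such that $$c_{W,1}\Gamma^{a}-c_{W,2}\Gamma^{b}\le \mathcal N_\mu(\Gamma)\le c_{W,1}\Gamma^{a}+c_{W,2}\Gamma^{b}\qquad\text{for all }\Gamma\ge\mu_1,$$ $$\mu_{k+1}-\mu_k\ge \exp\left(-c_w\mu_k^{1/2}\right)\qquad\text{for all }k\in\mathbb{N}^*.$$ Let $\mathcal H$ be a real separable Hilbert space with Hilbert basis $(\phi_k)_{k\in\mathbb{N}^*}$, and let $\mathcal A$ be the diagonal operator $\mathcal A\psi=\sum_{k}\mu_k\langle\psi,\phi_k\rangle_{\mathcal H}\phi_k$ with domain $D(\mathcal A)=\{\psi\in\mathcal H:\sum_k|\mu_k\langle\psi,\phi_k\rangle_{\mathcal H}|^2<+\infty\}$. Let $\mathfrak B$ be a bounded linear operator on $\mathcal H$ such that for every $j\in\mathbb{N}^*$ there exist $C_{\mathfrak B,j}>0$ and $\delta\in(0,1)$ with $$|\langle\mathfrak B\phi_j,\phi_k\rangle_{\mathcal H}|\ge\exp\left(-C_{\mathfrak B,j}\,\mu_k^{1-\delta}\right)\qquad\text{for all }k\in\mathbb{N}^*.$$ Then the bilinear control system $$\psi'(t)+\mathcal A\psi(t)+v(t)\mathfrak B\psi(t)=0\ \ (t\in(0,T)),\qquad\psi(0)=\psi_0\in\mathcal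 H,$$ with control $v\in L^2(0,T)$, is small-time locally exactly controllable to eigensolutions.
   Context: $\mathbb{N}^*=\{1,2,3,\dots\}$. For a non-decreasing sequence $\lambda=(\lambda_k)_{k\in\mathbb{N}^*}$ of positive reals, $\mathcal N_\lambda(\Gamma)=\#\{k\in\mathbb{N}^*:\lambda_k\le\Gamma\}$. A Hilbert basis is a complete orthonormal system; controls are real-valued. For each $\psi_0\in\mathcal H$ and $v\in L^2(0,T)$ the system has a unique mild solution $\psi\in C^0([0,T],\mathcal H)$, i.e. $\psi(t)=e^{-t\mathcal A}\psi_0-\int_0^te^{-(t-s)\mathcal A}v(s)\mathfrak B\psi(s)\,ds$. The $j$-th eigensolution is $\Phi_j(t)=e^{-\mu_jt}\phi_j$. The system is small-time locally exactly controllable to eigensolutions if for every $T>0$ and every $j\in\mathbb{N}^*$ there exists $r>0$ such that for every $\psi_0\in\mathcal H$ with $\|\psi_0-\phi_j\|_{\mathcal H}<r$ there exists $v\in L^2(0,T)$ such that the mild solution satisfies $\psi(T)=\Phi_j(T)$. *)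

(* Defs.v *)
From HB Require Import structures.
From mathcomp Require Import all_boot all_order all_algebra.
From mathcomp Require Import all_classical all_reals all_analysis.

Set Implicit Arguments.
Unset Strict Implicit.
Unset Printing Implicit Defensive.
Import Order.TTheory GRing.Theory Num.Theory.
Import numFieldNormedType.Exports.

Local Open Scope classical_set_scope.
Local Open Scope ring_scope.

(* Convention: sequences indexed by the positive integers are functions on
   [nat], the value at [k] being the term of index [k + 1]. *)

(* Number of indices (possibly +oo) of terms of [lam] not exceeding [G]. *)
Definition counting_function (R : realType) (lam : nat -> R) (G : R) : \bar R :=
  counting [set k | lam k <= G].

Definition separable (E : topologicalType) : Prop :=
  exists2 D : set E, countable D & dense D.

(* The norm of [H] is the one induced by the inner product [ip]; together with
   the completeness of [H] this makes [H] a real Hilbert space. *)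
Definition norm_of_dot (R : realType) (H : normedModType R)
    (ip : {dot H for (idfun : R -> R)}) : Prop :=
  forall x : H, `|x| ^+ 2 = ip x x.

Definition hilbert_basis (R : realType) (H : normedModType R)
    (ip : {dot H for (idfun : R -> R)}) (phi : nat -> H) : Prop :=
  (forall i j, ip (phi i) (phi j) = (i == j)%:R) /\
  (forall x, (forall k, ip x (phi k) = 0) -> x = 0).

Definition bounded_operator (R : realType) (H : normedModType R)
    (B : H -> H) : Prop :=
  exists M : R, forall x, `|B x| <= M * `|x|.

(* Unbounded operators: the values of [op] outside [dom] are irrelevant. *)
Record operator (H : Type) := Operator { dom : set H ; op : H -> H }.

Definition diagonal_operator (R : realType) (H : normedModType R)
    (ip : {dot H for (idfun : R -> R)}) (phi : nat -> H) (mu : nat -> R) :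
    operator H :=
  Operator
    [set x | (\sum_(0 <= k <oo) (`|mu k * ip x (phi k)| ^+ 2)%:E < +oo)%E]
    (fun x => limn (series (fun k => (mu k * ip x (phi k)) *: phi k))).

Definition C0_semigroup (R : realType) (H : normedModType R)
    (S : R -> H -> H) : Prop :=
  [/\ forall t, 0 <= t -> linear (S t) /\ bounded_operator (S t),
      forall x, S 0 x = x,
      forall s t x, 0 <= s -> 0 <= t -> S (s + t) x = S s (S t x)
    & forall x, S t x @[t --> 0^'+] --> x].

Definition generator (R : realType) (H : normedModType R)
    (S : R -> H -> H) : operator H :=
  Operator
    [set x | cvg (h^-1 *: (S h x - x) @[h --> 0^'+])]
    (fun x => lim (h^-1 *: (S h x - x) @[h --> 0^'+])).

(* [S t] is e^{-tA}: [S] is the C0-semigroup whose generator is [- A], with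
   the same domain. *)
Definition exp_opp_semigroup (R : realType) (H : normedModType R)
    (A : operator H) (S : R -> H -> H) : Prop :=
  [/\ C0_semigroup S,
      dom (generator S) = dom A
    & forall x, dom A x -> op (generator S) x = - op A x].

Definition simple_function (R : realType) (H : normedModType R) (X : Type)
    (n : nat) (E : 'I_n -> set X) (c : 'I_n -> H) (t : X) : H :=
  \sum_(i < n) \1_(E i) t *: c i.

(* [f] is Bochner integrable on [D], with integral [I]: simple functions
   converge to [f] a.e. and in L^1-norm on [D], and their integrals to [I]. *)
Definition is_bochner_integral d (X : measurableType d) (R : realType)
    (H : normedModType R) (m : {measure set X -> \bar R}) (D : set X)
    (f : X -> H) (I : H) : Prop :=
  exists (n : nat -> nat) (E : forall p, 'I_(n p) -> set X)
         (c : forall p, 'I_(n p) -> H),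
  [/\ forall p i, measurable (E p i) /\ (m (D `&` E p i) < +oo)%E,
      {ae m, forall t, D t -> simple_function (E p) (c p) t @[p --> \oo] --> f t},
      (\int[m]_(t in D) (`|f t - simple_function (E p) (c p) t|)%:E)%E
        @[p --> \oo] --> 0%E
    & \sum_(i < n p) fine (m (D `&` E p i)) *: c p i @[p --> \oo] --> I].

Definition square_integrable (R : realType) (T : R) (v : R -> R) : Prop :=
  measurable_fun `]0, T[ v /\
  (\int[lebesgue_measure]_(t in `]0%R, T[) ((v t) ^+ 2)%:E < +oo)%E.

(* [psi], of which only the restriction to [0, T] matters, is the mild
   solution of  psi' + A psi + v B psi = 0,  psi(0) = psi0. *)
Definition mild_solution (R : realType) (H : normedModType R)
    (A : operator H) (B : H -> H) (T : R) (v : R -> R) (psi0 : H)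
    (psi : R -> H) : Prop :=
  exists2 S : R -> H -> H, exp_opp_semigroup A S &
    {within `[0, T], continuous psi} /\
    forall t, 0 <= t <= T -> exists2 I : H,
      is_bochner_integral lebesgue_measure `]0, t[
        (fun s => S (t - s) (v s *: B (psi s))) I
      & psi t = S t psi0 - I.

Definition eigensolution (R : realType) (H : normedModType R)
    (mu : nat -> R) (phi : nat -> H) (j : nat) (t : R) : H :=
  expR (- mu j * t) *: phi j.

Definition small_time_locally_controllable_to_eigensolutions (R : realType)
    (H : normedModType R) (mu : nat -> R) (phi : nat -> H)
    (A : operator H) (B : H -> H) : Prop :=
  forall (T : R) (j : nat), 0 < T ->
  exists2 r : R, 0 < r & forall psi0 : H, `|psi0 - phi j| < r ->
  exists2 v : R -> R, square_integrable T v &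
  exists2 psi : R -> H, mild_solution A B T v psi0 psi &
    psi T = eigensolution mu phi j T.

(* Main.v *)
Require Import Defs.
From HB Require Import structures.
From mathcomp Require Import all_boot all_order all_algebra.
From mathcomp Require Import all_classical all_reals all_analysis.
From mathcomp Require Import measurable_realfun ring lra zify.
Set Implicit Arguments.
Unset Strict Implicit.
Unset Printing Implicit Defensive.
Import Order.TTheory GRing.Theory Num.Theory.
Import numFieldNormedType.Exports.
Local Open Scope classical_set_scope.
Local Open Scope ring_scope.

(** Linearize around the eigensolution: the deviation [z] is driven by
    [v B phi_j exp (- mu_j t)], and steering the first [N] modes of [z] to rest
    is a moment problem against the exponentials [exp (- mu_k t)], [k < N].  It
    is solved in time [tau] at a cost [exp (K0 / tau ^ G)] that does not depend
    on [N]: for a step [h] that tends to 0, a control constant on cells of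
    length [h] (up to the factor [exp (mu_j t)]) turns the moments into values
    at [z_k = exp (- mu_k h)] of a polynomial, and the Lagrange polynomials
    [prod_{l != k} (1 - ((1 - X) / h) / zeta_l)], [zeta_l = (1 - z_l) / h],
    are made small by multiplying them with box averages of lengths
    [~ tau (i + 1) ^ (- 5/4)].  This works because [sum mu_k ^ (- 2/3)]
    converges, and because the Weyl law and the gap condition bound
    [prod_{l != k} |1 - mu_k / mu_l|] from below by [exp (- C mu_k ^ kap)] with
    [kap < 1], a loss which, like that of the coefficients of [B phi_j], is
    absorbed by the dissipation [exp (- mu_k tau)].

    Applying such a control to the nonlinear system leaves a deviation that is
    quadratic in the initial one, the modes beyond [N] being negligible for
    [N] large.  On intervals whose lengths decrease geometrically towards [T],
    with a ratio close to 1, the quadratic gain beats the growth of the cost,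
    the controls tend to 0, and the deviation vanishes at time [T]. *)

(** * Spectral estimates *)

(** The obstacle is that consecutive eigenvalues may be exponentially close, so that a single moment
    costs the exponential of a power of [mu_k], and dissipation can pay only if that power is below
    1. The power is the larger of [3/4], due to the factors away from [mu_k], and [b + 1/2], due to
    about [mu_k ^ b] close eigenvalues that lose [mu_k ^ (1/2)] each: this is where [b < 1/2]
    enters. A cost independent of [N] allows [N] to be chosen last, from the state to be steered, so
    that infinitely many moments are never solved at once. With a polynomial in place of an entire
    function, the sup norm of the control is a bound on coefficients, obtained without complex
    analysis. The decay [5/4] of the box lengths lies between 1, which makes their sum finite, and
    [3/2]: the coefficients of a product of order [2/3] decrease like [n ^ (- 3n/2)], while [n]
    difference quotients cost about [n ^ (5n/4)]. A quadratic gain doubles the exponent of smallness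
    at each step, so the exponent of the cost has to grow by a factor less than 2; the factor [3/2]
    is the one used. *)

Lemma powR_telescope (R : realType) (q x : R) : 0 < q -> 1 <= x ->
  (x + 1) `^ (- (1 + q)) <= q^-1 * (x `^ (- q) - (x + 1) `^ (- q)).
Proof.
move=> q0 x1.
have x0 : 0 < x by lra.
have y0 : 0 < x + 1 by lra.
(* Concavity of [ln] replaces the comparison with an integral: multiplied by [q] and exponentiated,
   this bound makes the zeta sum telescope. *)
have lnle : ln x - ln (x + 1) <= - (x + 1)^-1.
  rewrite -ln_div ?posrE//.
  have -> : x / (x + 1) = 1 + (- (x + 1)^-1) by field; lra.
  apply: le_ln1Dx; rewrite ltrN2 invf_lt1//; lra.
have h : (x + 1) `^ (- q) * (1 + q * (x + 1)^-1) <= x `^ (- q).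
  rewrite /powR !gt_eqF//.
  have -> : - q * ln x = - q * ln (x + 1) + q * (ln (x + 1) - ln x) by ring.
  rewrite expRD ler_pM2l ?expR_gt0//.
  apply: le_trans (expR_ge1Dx _); rewrite lerD2l ler_pM2l//; lra.
have -> : (x + 1) `^ (- (1 + q)) = (x + 1) `^ (- q) * (x + 1)^-1.
  have -> : - (1 + q) = - q + - 1 by ring.
  by rewrite powRD ?powR_inv1 ?(ltW y0)// (gt_eqF y0) implybT.
rewrite ler_pdivlMl// lerBrDr.
by apply: le_trans h; rewrite mulrDr mulr1 addrC mulrCA.
Qed.

Lemma zeta_sum_le (R : realType) (q : R) (n : nat) : 0 < q ->
  \sum_(i < n) i.+1%:R `^ (- (1 + q)) <= 1 + q^-1.
Proof.
move=> q0; case: n => [|n].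
  by rewrite big_ord0 addr_ge0// invr_ge0 ltW.
suff h : \sum_(i < n.+1) i.+1%:R `^ (- (1 + q)) <=
    1 + q^-1 * (1 - n.+1%:R `^ (- q)).
  apply: (le_trans h); rewrite lerD2l.
  have := powR_ge0 n.+1%:R (- q) : 0 <= _; have : 0 < q^-1 by rewrite invr_gt0.
  nra.
elim: n => [|n IH].
  by rewrite big_ord1 !powR1 subrr mulr0 addr0.
rewrite big_ord_recr/=.
have := @powR_telescope R q n.+1%:R q0; rewrite ler1n => /(_ isT) h.
have -> : n.+2%:R = n.+1%:R + 1 :> R by rewrite -natr1.
rewrite !mulrBr in IH h *; lra.
Qed.

Lemma le_powR_base (R : realType) (r x y : R) :
  0 <= r -> 0 <= x -> x <= y -> x `^ r <= y `^ r.
Proof.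
move=> r0 x0 xy; have y0 := le_trans x0 xy.
by apply: (ge0_ler_powR r0); rewrite ?nnegrE.
Qed.

(** The upper bound makes the sublevel set finite, and monotonicity makes it an initial segment of
    indices; the Weyl law then reads as two inequalities on an integer. *)
Lemma counting_sublevel (R : realType) (mu : nat -> R) (G x : R) :
  increasing_seq mu -> (counting_function mu G <= x%:E)%E ->
  exists2 n : nat, (forall k, (mu k <= G) = (k < n)%N) &
    counting_function mu G = n%:R%:E.
Proof.
move=> mu_incr; rewrite /counting_function /counting.
case: ifPn => [/asboolP fA _|_]; last by rewrite leye_eq.
have ex : exists k, ~~ (mu k <= G).
  apply/not_existsP => h; apply: infinite_nat.
  rewrite (_ : setT = [set k | mu k <= G])//.
  by apply/seteqP; split => // k _ /=; have /negP := h k; rewrite negbK.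
case: (ex_minnP ex) => n n1 n2.
have AE k : (mu k <= G) = (k < n)%N.
  case: (ltnP k n) => h.
    by apply/negPn/negP => /n2; rewrite leqNgt h.
  apply: contraNF n1 => hk; apply: le_trans hk.
  by rewrite mu_incr.
exists n => //; congr (_%:R%:E); apply: card_fset_set.
rewrite (_ : [set _ | _] = `I_n) ?card_eqxx//.
by apply/seteqP; split => k /=; rewrite AE.
Qed.

(** On a window of length 2 the main terms of the Weyl law thus cancel up to a constant, and only
    the remainder of order [b] survives. *)
Lemma powR_add2 (R : realType) (a x : R) : 0 <= a <= 1 -> 1 <= x ->
  (x + 2) `^ a <= x `^ a + 2.
Proof.
move=> /andP[a0 a1] x1; have x0 : 0 < x by lra.
have -> : x + 2 = x * (1 + 2 / x) by field; lra.
have t0 : 0 < 2 / x by rewrite divr_gt0.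
rewrite powRM; [|lra|lra].
have h1 : (1 + 2 / x) `^ a <= 1 + 2 / x by apply: ler1_powR => //; lra.
have h2 : x `^ a <= x by apply: ler1_powR.
have h3 : x `^ a * (2 / x) <= 2 by rewrite mulrCA ler_piMr// ler_pdivrMr// mul1r.
have h4 := ler_wpM2l (powR_ge0 x a) h1.
by apply: (le_trans h4); rewrite mulrDr mulr1 lerD2l.
Qed.

Lemma sum_indicator_le (R : realType) (n1 n2 N : nat) :
  \sum_(l < N) ((n1 <= l < n2)%N%:R : R) <= (n2 - n1)%:R.
Proof.
have h : (\sum_(l < N) (n1 <= l < n2)%N <= n2 - n1)%N.
  suff : (\sum_(l < N) (n1 <= l < n2)%N <= minn N n2 - n1)%N.
    by move/leq_trans; apply; rewrite leq_sub2r// geq_minr.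
  elim: N => [|N IH]; first by rewrite big_ord0.
  rewrite big_ord_recr/=; apply: (leq_trans (leq_add IH (leqnn _))).
  by case: (leqP n1 N) => h1; case: (ltnP N n2) => h2 /=; rewrite /minn; do ! case: ifP; lia.
by rewrite -natr_sum ler_nat.
Qed.

Section weyl.
Context (R : realType) (a b cW1 cW2 : R) (mu : nat -> R).
Hypotheses (ha0 : 1 / 2 <= a) (ha1 : a < 5 / 8) (hb0 : 0 < b) (hb1 : b < 1 / 2)
  (hcW1 : 0 < cW1) (hcW2 : 0 < cW2)
  (mu_incr : increasing_seq mu) (mu0_ge1 : 1 <= mu 0%N)
  (weyl : forall G : R, mu 0%N <= G ->
      ((cW1 * G `^ a - cW2 * G `^ b)%:E <= counting_function mu G)%E /\
      (counting_function mu G <= (cW1 * G `^ a + cW2 * G `^ b)%:E)%E).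

Lemma weyl_ge1 k : 1 <= mu k.
Proof. by apply: le_trans mu0_ge1 _; rewrite mu_incr. Qed.

Lemma weyl_sublevel G : mu 0%N <= G -> exists n : nat,
  [/\ forall k, (mu k <= G) = (k < n)%N,
    cW1 * G `^ a - cW2 * G `^ b <= n%:R & n%:R <= cW1 * G `^ a + cW2 * G `^ b].
Proof.
move=> /weyl[h1 h2]; have [n n1 n2] := counting_sublevel mu_incr h2.
by exists n; move: h1 h2; rewrite n2 !lee_fin.
Qed.

Lemma weyl_growth k : k.+1%:R <= (cW1 + cW2) * mu k `^ a.
Proof.
move: (ha0) (ha1) (hb0) (hb1) (hcW1) (hcW2) (mu0_ge1) => ha0' ha1' hb0' hb1' hcW1' hcW2' mu0'.
have m1 := weyl_ge1 k.
have [n [n1 _ n2]] := @weyl_sublevel (mu k) ltac:(by rewrite mu_incr).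
have : (k < n)%N by rewrite -n1.
rewrite -(ler_nat R) => /le_trans; apply; apply: (le_trans n2).
rewrite mulrDl lerD2l ler_pM2l//; apply: ler_powR => //; lra.
Qed.

Lemma weyl_sum : exists S : R, forall N, \sum_(k < N) mu k `^ (- (2 / 3)) <= S.
Proof.
move: (ha0) (ha1) (hb0) (hb1) (hcW1) (hcW2) (mu0_ge1) => ha0' ha1' hb0' hb1' hcW1' hcW2' mu0'.
set C := cW1 + cW2.
have C0 : 0 < C by rewrite /C; lra.
exists (C `^ (2 / 3 / a) * (1 + (1 / 15)^-1)) => N.
(* Here [a < 5/8] is used: [(2/3) / a > 16/15], so the terms are dominated by a convergent zeta
   series with exponent [1 + 1/15]. *)
have h16 : 1 + 1 / 15 <= 2 / 3 / a by rewrite ler_pdivlMr; lra.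
apply: (@le_trans _ _ (\sum_(k < N) C `^ (2 / 3 / a) * k.+1%:R `^ (- (1 + 1 / 15)))); last first.
  rewrite -mulr_sumr ler_wpM2l ?powR_ge0// zeta_sum_le//; lra.
apply: ler_sum => k _.
have m1 := weyl_ge1 k.
have g := weyl_growth k.
have k1 : 1 <= k.+1%:R :> R by rewrite ler1n.
rewrite !powRN ler_pdivlMr ?powR_gt0 ?(lt_le_trans ltr01)//.
rewrite mulrC ler_pdivrMr ?powR_gt0 ?(lt_le_trans ltr01)//.
apply: (@le_trans _ _ (k.+1%:R `^ (2 / 3 / a))); first exact: ler_powR.
have -> : mu k `^ (2 / 3) = (mu k `^ a) `^ (2 / 3 / a).
  by rewrite -powRrM; congr (_ `^ _); field; lra.
rewrite -powRM; [|exact: ltW|exact: powR_ge0].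
by apply: le_powR_base => //; lra.
Qed.

(** Difference of the Weyl law at [mu k + 1] and [mu k - 1]. Each eigenvalue counted here will cost
    a factor as small as the gap. *)
Lemma weyl_near : exists2 C : R, 0 < C & forall N k,
  \sum_(l < N) ((mu k - 1 < mu l <= mu k + 1)%R%:R : R) <= C * mu k `^ b.
Proof.
move: (ha0) (ha1) (hb0) (hb1) (hcW1) (hcW2) (mu0_ge1) => ha0' ha1' hb0' hb1' hcW1' hcW2' mu0'.
pose C1 := (cW1 + cW2) * (mu 0%N + 2); pose C2 := 2 * cW1 + 4 * cW2.
have C10 : 0 <= C1 by rewrite mulr_ge0; lra.
have C20 : 0 < C2 by rewrite /C2; lra.
exists (C1 + C2); first by lra.
move=> N k; have m1 := weyl_ge1 k.
have mb1 : 1 <= mu k `^ b.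
  by rewrite -[leLHS](powRr0 (mu k)); apply: ler_powR => //; lra.
have m0k : mu 0%N <= mu k by rewrite mu_incr.
have [n2 [n21 _ n23]] := @weyl_sublevel (mu k + 1) ltac:(lra).
(* The Weyl law says nothing below [mu 0]. In that case [mu k < mu 0 + 1], and the constant [C1]
   bounds the whole count. *)
case: (ltP (mu k - 1) (mu 0%N)) => h.
  apply: (@le_trans _ _ (\sum_(l < N) ((0 <= l < n2)%N%:R : R))).
    apply: ler_sum => l _; rewrite n21 leq0n/=.
    by case: (_ < _); rewrite // ler_nat.
  apply: (le_trans (sum_indicator_le _ _ _ _)); rewrite subn0.
  apply: (le_trans n23).
  apply: (@le_trans _ _ C1); last by nra.
  rewrite /C1 mulrDl; apply: lerD; rewrite ler_pM2l//.
    apply: (@le_trans _ _ (mu k + 1)); last by lra.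
    by apply: ler1_powR; lra.
  apply: (@le_trans _ _ (mu k + 1)); last by lra.
  by apply: ler1_powR; lra.
have [n1 [n11 n12 _]] := weyl_sublevel h.
apply: (@le_trans _ _ (\sum_(l < N) ((n1 <= l < n2)%N%:R : R))).
  apply: ler_sum => l _; rewrite n21 ltNge n11 -leqNgt.
  by [].
apply: (le_trans (sum_indicator_le _ _ _ _)).
have n1n2 : (n1 <= n2)%N.
  rewrite leqNgt; apply/negP => h'.
  have := n11 n2; rewrite h' => e; have := n21 n2; rewrite ltnn; lra.
rewrite natrB//.
have e1 : (mu k + 1) `^ a <= (mu k - 1) `^ a + 2.
  have := @powR_add2 R a (mu k - 1); have -> : mu k - 1 + 2 = mu k + 1 by ring.
  by apply; lra.
have e2 : (mu k + 1) `^ b <= 2 * mu k `^ b.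
  apply: (@le_trans _ _ ((2 * mu k) `^ b)).
    by apply: le_powR_base; lra.
  rewrite powRM; [|lra..].
  by rewrite ler_wpM2r ?powR_ge0//; apply: ler1_powR; lra.
have e3 : (mu k - 1) `^ b <= mu k `^ b.
  by apply: le_powR_base; lra.
rewrite /C2; nra.
Qed.

End weyl.

(** Dissipation absorbs a sublinear loss: if the loss exceeds [x t / 8], then [x ^ (1 - kap)] is
    below [8 C / t], so [x], hence the loss, is bounded by a power of [1 / t]. An integer [g] above
    [1 / (1 - kap)] suffices. *)
Lemma young_powR (R : realType) (kap C : R) : 0 < kap < 1 -> 0 < C ->
  exists (C' : R) (g : nat), 0 < C' /\ forall t x : R, 0 < t <= 1 -> 1 <= x ->
    C * x `^ kap <= x * t / 8 + C' / t ^+ g.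
Proof.
move=> /andP[k0 k1] C0.
have [g hg] : exists g : nat, 1 <= (1 - kap) * g%:R.
  exists (Num.bound (1 - kap)^-1).
  rewrite -ler_pdivrMl ?subr_gt0// mulr1 ltW//.
  by apply: archi_boundP; rewrite invr_ge0 subr_ge0 ltW.
exists (C * (8 * C) ^+ g), g; split.
  by rewrite mulr_gt0// exprn_gt0// mulr_gt0.
move=> t x /andP[t0 t1] x1; have x0 : 0 < x by lra.
have C'0 : 0 < C * (8 * C) ^+ g / t ^+ g.
  by rewrite divr_gt0 ?mulr_gt0 ?exprn_gt0 ?mulr_gt0.
case: (leP (C * x `^ kap) (x * t / 8)) => h; first lra.
have hx : x `^ (1 - kap) <= 8 * C / t.
  rewrite ler_pdivlMr//.
  have e : x `^ kap * x `^ (1 - kap) = x.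
    have -> : x `^ kap * x `^ (1 - kap) = x `^ (kap + (1 - kap)).
      by rewrite powRD// (gt_eqF x0) implybT.
    by rewrite addrC subrK powRr1// ltW.
  rewrite -(ler_pM2l (powR_gt0 kap x0)) mulrA e; lra.
have : C * x `^ kap <= C * (8 * C) ^+ g / t ^+ g.
  rewrite -mulrA ler_pM2l//.
  apply: (@le_trans _ _ x); first by apply: ler1_powR; lra.
  apply: (@le_trans _ _ (x `^ ((1 - kap) * g%:R))).
    by rewrite -[leLHS]powRr1 ?(ltW x0)//; apply: ler_powR.
  rewrite powRrM powR_mulrn ?powR_ge0// -expr_div_n.
  by rewrite lerXn2r// nnegrE ?powR_ge0// ?divr_ge0 ?mulr_ge0 ?ltW.
have := divr_ge0 (mulr_ge0 (ltW x0) (ltW t0)) (ler0n R 8); lra.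
Qed.

Lemma one_sub_ge_expR (R : realType) (x : R) : 0 <= x <= 1 / 2 ->
  expR (- (2 * x)) <= 1 - x.
Proof.
move=> /andP[x0 x1].
rewrite expRN -div1r ler_pdivrMr ?expR_gt0//.
have h : (1 - x) * (1 + 2 * x) <= (1 - x) * expR (2 * x).
  by apply: ler_wpM2l; [lra|exact: expR_ge1Dx].
apply: le_trans h; nra.
Qed.

(** The exponent is chosen for [2/3 + 1/12 = 3/4], which leaves the logarithmic loss below power
    1. *)
Lemma ln_le_powR12 (R : realType) (y : R) : 1 <= y ->
  ln y <= 12 * y `^ (1 / 12).
Proof.
move=> y1; have y0 : 0 < y by lra.
have -> : ln y = 12 * ln (y `^ (1 / 12)) by rewrite ln_powR; field.
by rewrite ler_pM2l ?ltr0n// ltW// ln_sublinear// powR_gt0.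
Qed.

(** Three kinds of factors: for [mu_l > 2 mu_k], [1 - x >= exp (- 2 x)] applies; the other ones
    outside the window of half-width 1 around [mu_k] are at least [1 / (2 mu_k)]; in the window the
    gap enters. The sum of [mu_l ^ (- 2/3)] handles the first two kinds, a count of the window the
    third. *)
Lemma product_ge_expR (R : realType) (mu : nat -> R) (b S Cn cw : R) :
  0 < b -> b < 1 / 2 -> 0 < cw -> 0 < Cn ->
  increasing_seq mu -> 1 <= mu 0%N ->
  (forall k, expR (- cw * mu k `^ (1 / 2)) <= mu k.+1 - mu k) ->
  (forall N, \sum_(l < N) mu l `^ (- (2 / 3)) <= S) ->
  (forall N k, \sum_(l < N) ((mu k - 1 < mu l <= mu k + 1)%R%:R : R)
     <= Cn * mu k `^ b) ->
  exists C kap : R, [/\ 0 < C, 0 < kap < 1 & forall N k,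
    expR (- (C * mu k `^ kap)) <=
    \prod_(l < N | l != k :> nat) `|1 - mu k / mu l|].
Proof.
move=> b0 b1 cw0 Cn0 mu_incr mu0 gap hS hn.
have mu1 k : 1 <= mu k by apply: le_trans mu0 _; rewrite mu_incr.
have S0 : 0 <= S by have := hS 0%N; rewrite big_ord0.
(* [3/4] is the exponent of [ln y * y ^ (2/3)]; [b + 1/2] comes from at most [Cn mu_k ^ b] close
   indices, each losing [cw mu_k ^ (1/2)] in the exponent. *)
pose kap := Num.max (3 / 4) (b + 1 / 2).
have kap1 : 3 / 4 <= kap by rewrite /kap le_max lexx.
have kap2 : b + 1 / 2 <= kap by rewrite /kap le_max lexx orbT.
have kap3 : kap < 1 by rewrite /kap gt_max; apply/andP; split; lra.
exists (28 * (S + 1) + cw * Cn), kap; split.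
- by have := mulr_gt0 cw0 Cn0; lra.
- by apply/andP; split; lra.
move=> N k; have m1 := mu1 k; have m0 : 0 < mu k by lra.
pose y := 2 * mu k; have y1 : 1 <= y by rewrite /y; lra.
have y0 : 0 < y by lra.
have ln0 : 0 <= ln y by apply: ln_ge0.
(* [w l] bounds [- ln |1 - mu_k / mu_l|]: its first term suffices unless
   [|mu_l - mu_k| <= 1]; the few remaining factors are bounded by the gap. *)
pose near l : R := (mu k - 1 < mu l <= mu k + 1)%R%:R.
pose w l := (2 + ln y) * y `^ (2 / 3) * mu l `^ (- (2 / 3)) +
  near l * (cw * mu k `^ (1 / 2)).
have near0 l : 0 <= near l by [].
have w0 l : 0 <= w l.
  rewrite addr_ge0// ?mulr_ge0 ?powR_ge0 ?near0 ?(ltW cw0)//; lra.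
have wk l : l != k -> expR (- w l) <= `|1 - mu k / mu l|.
  move=> lk; have ml := mu1 l; have ml0 : 0 < mu l by lra.
  have gapl : expR (- (cw * mu k `^ (1 / 2))) <= `|mu l - mu k|.
    case: (ltngtP l k) => [h|h|h]; last by rewrite h eqxx in lk.
    - rewrite distrC; apply: le_trans (ler_norm _).
      apply: (@le_trans _ _ (mu l.+1 - mu l)); last first.
        by rewrite lerB// mu_incr.
      apply: le_trans (gap l); rewrite ler_expR mulNr lerN2 ler_pM2l//.
      by apply: le_powR_base; [lra|lra|rewrite mu_incr ltnW].
    - apply: le_trans (ler_norm _).
      apply: (@le_trans _ _ (mu k.+1 - mu k)); last first.
        by rewrite lerB// mu_incr.
      by apply: le_trans (gap k); rewrite ler_expR mulNr.
  have A0 : 0 <= y `^ (2 / 3) * mu l `^ (- (2 / 3)) by rewrite mulr_ge0 ?powR_ge0.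
  have AE : y `^ (2 / 3) * mu l `^ (- (2 / 3)) = (y / mu l) `^ (2 / 3).
    rewrite powRM ?invr_ge0 ?ltW//; congr (_ * _).
    by rewrite -(powR_inv1 (ltW ml0)) -powRrM mulN1r.
  set A := y `^ (2 / 3) * mu l `^ (- (2 / 3)) in A0 AE.
  have wE : w l = (2 + ln y) * A + near l * (cw * mu k `^ (1 / 2)).
    by rewrite /w /A; ring.
  have c0 : 0 <= cw * mu k `^ (1 / 2) by rewrite mulr_ge0 ?powR_ge0// ltW.
  case: (ltP y (mu l)) => h.
    have x0 : 0 <= mu k / mu l by rewrite divr_ge0 ?ltW.
    have x1 : mu k / mu l <= 1 / 2.
      by rewrite ler_pdivrMr//; rewrite /y in h; lra.
    rewrite ger0_norm; last lra.
    have q := @one_sub_ge_expR R (mu k / mu l); rewrite x0 x1 in q.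
    apply: (le_trans _ (q isT)).
    rewrite ler_expR lerN2 wE.
    have : y / mu l <= A.
      rewrite AE; apply: ger1_powR; last lra.
      by rewrite divr_gt0//= ler_pdivrMr// mul1r ltW.
    have -> : y / mu l = 2 * (mu k / mu l) by rewrite /y mulrA.
    have := mulr_ge0 ln0 A0; have := mulr_ge0 (near0 l) c0; lra.
  (* [A] majorizes the indicator of [mu l <= y], so [ln y * A] pays for the denominator [mu l] while
     remaining summable over [l]. *)
  have A1 : 1 <= A.
    rewrite AE -[leLHS](powRr0 (y / mu l)); apply: ler_powR; last lra.
    by rewrite ler_pdivlMr// mul1r.
  have -> : `|1 - mu k / mu l| = `|mu l - mu k| / mu l.
    have -> : 1 - mu k / mu l = (mu l - mu k) / mu l by field; lra.
    by rewrite normrM normfV (gtr0_norm ml0).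
  have lnA : ln y <= ln y * A by rewrite ler_peMr.
  have yV : expR (- ln y) = y^-1 by rewrite expRN lnK ?posrE.
  have mly : y^-1 <= (mu l)^-1 by rewrite lef_pV2 ?posrE.
  case: (boolP (mu k - 1 < mu l <= mu k + 1)) => hn'.
    apply: (@le_trans _ _ (expR (- (ln y + cw * mu k `^ (1 / 2))))).
      have nE : near l = 1 by rewrite /near hn'.
      rewrite ler_expR lerN2 wE nE; lra.
    rewrite opprD expRD yV mulrC ler_pM ?expR_ge0// invr_ge0; lra.
  apply: (@le_trans _ _ (expR (- ln y))).
    rewrite ler_expR lerN2 wE; have := mulr_ge0 (near0 l) c0; nra.
  rewrite yV -[leLHS]mul1r ler_pM ?invr_ge0//; first lra.
  rewrite ler_normr; apply/orP.
  move: hn'; rewrite negb_and -leNgt -ltNge => /orP[|] h'; [right|left]; lra.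
have sw : \sum_(l < N) w l <= (28 * (S + 1) + cw * Cn) * mu k `^ kap.
  rewrite big_split/= -mulr_sumr -mulr_suml.
  have l12 := ln_le_powR12 y1.
  have y12 : 1 <= y `^ (1 / 12).
    by rewrite -[leLHS](powRr0 y); apply: ler_powR => //; lra.
  have e1 : (2 + ln y) * y `^ (2 / 3) <= 28 * mu k `^ kap.
    apply: (@le_trans _ _ (14 * y `^ (1 / 12) * y `^ (2 / 3))).
      by rewrite ler_wpM2r ?powR_ge0//; lra.
    rewrite -mulrA -powRD; last by rewrite (gt_eqF y0) implybT.
    have -> : 1 / 12 + 2 / 3 = 3 / 4 :> R by field.
    rewrite /y powRM; [|lra..].
    have : 2 `^ (3 / 4) <= 2 :> R by apply: ler1_powR; lra.
    have : mu k `^ (3 / 4) <= mu k `^ kap by apply: ler_powR.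
    have := powR_ge0 (mu k) (3 / 4); have := powR_ge0 2 (3 / 4) : 0 <= _ :> R; nra.
  have e2 : (2 + ln y) * y `^ (2 / 3) * (\sum_(i < N) mu i `^ (- (2 / 3))) <=
      28 * mu k `^ kap * (S + 1).
    apply: ler_pM => //.
    - by rewrite mulr_ge0 ?powR_ge0//; lra.
    - by apply: sumr_ge0 => i _; exact: powR_ge0.
    - by apply: le_trans (hS N) _; lra.
  have e3 : (\sum_(i < N) near i) * (cw * mu k `^ (1 / 2)) <=
      cw * Cn * mu k `^ kap.
    apply: (@le_trans _ _ (Cn * mu k `^ b * (cw * mu k `^ (1 / 2)))).
      by apply: ler_wpM2r; [rewrite mulr_ge0 ?powR_ge0// ltW|exact: hn].
    have -> : Cn * mu k `^ b * (cw * mu k `^ (1 / 2)) =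
        cw * Cn * mu k `^ (b + 1 / 2).
      by rewrite powRD ?(gt_eqF m0) ?implybT//; ring.
    by rewrite ler_pM2l ?mulr_gt0//; apply: ler_powR.
  lra.
apply: (@le_trans _ _ (expR (- \sum_(l < N) w l))).
  by rewrite ler_expR lerN2.
rewrite -sumrN expR_sum.
rewrite (bigID (fun l : 'I_N => l != k :> nat))/= -[leRHS]mulr1.
apply: ler_pM.
- by apply: prodr_ge0 => i _; exact: expR_ge0.
- by apply: prodr_ge0 => i _; exact: expR_ge0.
- by apply: ler_prod => i ik; rewrite expR_ge0/= wk.
- rewrite -expR_sum expR_le1; apply: sumr_le0 => i _.
  by rewrite oppr_le0; exact: w0.
Qed.

(** Both losses, of the product and of the coefficients [bt k], are exponentials of powers of [mu k]
    below 1. Young's inequality trades them for an eighth of the dissipation and a constant that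
    depends on [t] only, neither on [k] nor on [N]. *)
Lemma moment_weight (R : realType) (mu : nat -> R) (bt : nat -> R)
    (C kap C2 delta : R) :
  (forall k, 1 <= mu k) -> 0 < C -> 0 < kap < 1 -> 0 < C2 -> 0 < delta < 1 ->
  (forall N k, expR (- (C * mu k `^ kap)) <=
    \prod_(l < N | l != k :> nat) `|1 - mu k / mu l|) ->
  (forall k, expR (- C2 * mu k `^ (1 - delta)) <= `|bt k|) ->
  exists (C' : R) (g : nat), 0 < C' /\ forall (t : R) N k, 0 < t <= 1 ->
    1 <= `|bt k| * (\prod_(l < N | l != k :> nat) `|1 - mu k / mu l|) *
      expR (mu k * t / 8 + C' / t ^+ g).
Proof.
move=> mu1 C0 /andP[k0 k1] C20 /andP[d0 d1] hprod hb.
pose kp := Num.max kap (1 - delta).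
have kp1 : kap <= kp by rewrite /kp le_max lexx.
have kp2 : 1 - delta <= kp by rewrite /kp le_max lexx orbT.
have kp3 : kp < 1 by rewrite /kp gt_max; apply/andP; split; lra.
have [|C' [g [C'0 hy]]] := @young_powR R kp (C + C2) _ (addr_gt0 C0 C20).
  by apply/andP; split; lra.
exists C', g; split => // t N k ht.
have m1 := mu1 k; have hy' := hy t (mu k) ht m1.
apply: (@le_trans _ _ (expR (- ((C + C2) * mu k `^ kp)) *
    expR (mu k * t / 8 + C' / t ^+ g))).
  rewrite -expRD -[leLHS]expR0 ler_expR; lra.
rewrite ler_pM2r ?expR_gt0//.
apply: (@le_trans _ _ (expR (- C2 * mu k `^ (1 - delta)) *
   expR (- (C * mu k `^ kap)))); last first.
  by rewrite ler_pM ?expR_ge0.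
rewrite -expRD ler_expR.
have e1 : mu k `^ kap <= mu k `^ kp by apply: ler_powR.
have e2 : mu k `^ (1 - delta) <= mu k `^ kp by apply: ler_powR.
nra.
Qed.

(** * The discrete moment problem *)

(** Turns convergence of the sum of [mu_l ^ (- 2/3)] into growth of order [2/3] of the product. With
    [s = y ^ (1/3)] it reduces to [1 + s ^ 3 <= (1 + s ^ 2) ^ 2]. *)
Lemma one_add_le_expR (R : realType) (y : R) : 0 <= y ->
  1 + y <= expR (2 * y `^ (2 / 3)).
Proof.
move=> y0; pose s := y `^ (1 / 3).
have s0 : 0 <= s by apply: powR_ge0.
have -> : y `^ (2 / 3) = s ^+ 2.
  by rewrite -powR_mulrn// -powRrM; congr (_ `^ _); field.
have -> : y = s ^+ 3.
  by rewrite -powR_mulrn// -powRrM (_ : 1 / 3 * 3 = 1) ?powRr1//; field.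
have -> : expR (2 * s ^+ 2) = expR (s ^+ 2) ^+ 2 by rewrite -expRM_natl.
have h := expR_ge1Dx (s ^+ 2).
apply: (@le_trans _ _ ((1 + s ^+ 2) ^+ 2)); first by nra.
by rewrite lerXn2r// nnegrE ?expR_ge0// addr_ge0 ?exprn_ge0.
Qed.

Lemma cvg_one_sub_expR (R : realType) (m : R) : 0 < m ->
  (1 - expR (- (m * h))) / h @[h --> 0^'+] --> m.
Proof.
move=> m0.
apply: (@squeeze_cvgr _ _ _ _ (fun h => m - m ^+ 2 * h) (fun=> m)); last exact: cvg_cst.
- near=> h.
  have h0 : 0 < h by near: h; exact: nbhs_right_gt.
  have x0 : 0 < m * h by rewrite mulr_gt0.
  have e1 : 1 + m * h <= expR (m * h) by exact: expR_ge1Dx.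
  have e2 := expR_ge1Dx (- (m * h)).
  have e3 : expR (- (m * h)) <= 1 - m * h + (m * h) ^+ 2.
    rewrite expRN -div1r ler_pdivrMr ?expR_gt0//.
    have : 0 < 1 - m * h + (m * h) ^+ 2 by nra.
    by move=> h1; have := ler_wpM2l (ltW h1) e1; nra.
  by rewrite ler_pdivlMr// ler_pdivrMr//; apply/andP; split; nra.
- rewrite -[X in _ --> X]subr0; apply: cvgB; first exact: cvg_cst.
  rewrite -[X in _ --> X](mulr0 (m ^+ 2)); apply: cvgM; first exact: cvg_cst.
  by apply: cvg_at_right_filter; exact: cvg_id.
Unshelve. all: by end_near. Qed.

Lemma cvg_prod_seq (R : realType) (T : Type) (F : set_system T) {FF : Filter F}
    (I : Type) (s : seq I) (P : pred I) (f : I -> T -> R) (l : I -> R) :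
  (forall i, P i -> f i x @[x --> F] --> l i) ->
  (\prod_(i <- s | P i) f i x) @[x --> F] --> \prod_(i <- s | P i) l i.
Proof.
move=> h; elim: s => [|i s IH].
  under eq_cvg do rewrite big_nil.
  by rewrite big_nil; exact: cvg_cst.
under eq_cvg do rewrite big_cons.
by rewrite big_cons; case: ifPn => // Pi; apply: cvgM => //; exact: h.
Qed.

(* [(1 - z_l) / h], with [z_l = exp (- mu_l h)], is the discrete counterpart of
   [mu_l]: the products over [l < N] converge as the step [h] tends to 0. *)
Lemma small_step (R : realType) (mu : nat -> R) (N : nat) (h0 : R) :
  (forall k, 1 <= mu k) -> increasing_seq mu -> 0 < h0 ->
  exists h : R, let zeta l := (1 - expR (- (mu l * h))) / h in
  [/\ 0 < h, h <= h0, forall l, (l < N)%N -> mu l / 2 <= zeta l &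
    forall k, (k < N)%N ->
      (\prod_(l < N | l != k :> nat) `|1 - mu k / mu l|) / 2 <=
      \prod_(l < N | l != k :> nat) `|1 - zeta k / zeta l|].
Proof.
move=> mu1 mu_incr h00.
have mu0 k : 0 < mu k by apply: lt_le_trans (mu1 k).
pose zeta h l := (1 - expR (- (mu l * h))) / h.
have cz l : zeta h l @[h --> 0^'+] --> mu l by exact: cvg_one_sub_expR.
have H1 : \forall h \near 0^'+, forall l : 'I_N, mu l / 2 <= zeta h l.
  apply: filter_forall => l.
  by apply: (cvgr_ge (mu l) (cz l)); have := mu0 l; lra.
have H2 : \forall h \near 0^'+, forall k : 'I_N,
    (\prod_(l < N | l != k :> nat) `|1 - mu k / mu l|) / 2 <=
      \prod_(l < N | l != k :> nat) `|1 - zeta h k / zeta h l|.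
  apply: filter_forall => k.
  have c : \prod_(l < N | l != k :> nat) `|1 - zeta h k / zeta h l| @[h --> 0^'+] -->
      \prod_(l < N | l != k :> nat) `|1 - mu k / mu l|.
    apply: cvg_prod_seq => l _; apply: cvg_norm; apply: cvgB; first exact: cvg_cst.
    apply: cvgM => //; apply: cvgV => //; exact: lt0r_neq0.
  apply: (cvgr_ge _ c).
  have : 0 < \prod_(l < N | l != k :> nat) `|1 - mu k / mu l|.
    apply: prodr_gt0 => l lk; rewrite normr_gt0 subr_eq0.
    apply: contraNneq lk => e.
    have : mu k = mu l by rewrite -[RHS]mul1r e mulfVK ?gt_eqF.
    move=> /eqP; rewrite eq_le !mu_incr -eqn_leq eq_sym //.
  lra.
near (0 : R)^'+ => h.
exists h => /=; split.
- by near: h; exact: nbhs_right_gt.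
- by near: h; exact: nbhs_right_le.
- move=> l lN; have : forall l : 'I_N, mu l / 2 <= zeta h l by near: h.
  by move=> /(_ (Ordinal lN)).
- move=> k kN; have : forall k : 'I_N,
    (\prod_(l < N | l != k :> nat) `|1 - mu k / mu l|) / 2 <=
      \prod_(l < N | l != k :> nat) `|1 - zeta h k / zeta h l| by near: h.
  by move=> /(_ (Ordinal kN)).
Unshelve. all: by end_near. Qed.

(* A box average of length [h m]: multiplying it by the difference quotient
   [(1 - X) / h] costs only a factor [2 / (h m)]. *)
Definition box (R : realType) (m : nat) : {poly R} :=
  m%:R^-1 *: \sum_(j < m) 'X^j.

(** The coefficients become the amplitudes of the control on the cells, so this measures its sup
    norm up to the factor [exp (mu_j t)]. *)
Definition coef_le (R : realType) (p : {poly R}) (A : R) :=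
  forall i, `|p`_i| <= A.

Section coef_bounds.
Context (R : realType).
Implicit Types (p q : {poly R}) (A h x : R).

Lemma coef_le_ge0 p A : coef_le p A -> 0 <= A.
Proof. by move=> /(_ 0%N); apply: le_trans. Qed.

Lemma coef_leMXn p A j : coef_le p A -> coef_le (p * 'X^j) A.
Proof.
move=> pA i; rewrite coefMXn; case: ifP => // _.
by rewrite normr0 (coef_le_ge0 pA).
Qed.

Lemma coef_leD p q A B : coef_le p A -> coef_le q B -> coef_le (p + q) (A + B).
Proof.
by move=> pA qB i; rewrite coefD (le_trans (ler_normD _ _))// lerD.
Qed.

Lemma coef_leZ p A x : coef_le p A -> coef_le (x *: p) (`|x| * A).
Proof. by move=> pA i; rewrite coefZ normrM ler_wpM2l. Qed.

Lemma coef_leB p q A B : coef_le p A -> coef_le q B -> coef_le (p - q) (A + B).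
Proof.
by move=> pA qB i; rewrite coefB (le_trans (ler_normB _ _))// lerD.
Qed.

Lemma coef_le_sum (I : Type) (s : seq I) (P : pred I) (f : I -> {poly R})
    (A : I -> R) :
  (forall i, P i -> coef_le (f i) (A i)) ->
  coef_le (\sum_(i <- s | P i) f i) (\sum_(i <- s | P i) A i).
Proof.
move=> h; elim: s => [|i s IH].
  by rewrite !big_nil => j; rewrite coef0 normr0.
by rewrite !big_cons; case: ifPn => // Pi; apply: coef_leD => //; exact: h.
Qed.

Lemma coef_le_mulbox p A m : (0 < m)%N -> coef_le p A -> coef_le (p * box R m) A.
Proof.
move=> m0 pA; rewrite /box -scalerAr mulr_sumr.
have mR : 0 < m%:R :> R by rewrite ltr0n.
have -> : A = `|m%:R^-1| * \sum_(j < m) A.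
  by rewrite sumr_const card_ord ger0_norm ?invr_ge0 ?ltW// -[A *+ m]mulr_natl mulKf ?gt_eqF.
by apply: coef_leZ; apply: coef_le_sum => j _; exact: coef_leMXn.
Qed.

Lemma coef_le_muldiffbox p A h m : 0 < h -> (0 < m)%N -> coef_le p A ->
  coef_le (p * (h^-1 *: (1 - 'X) * box R m)) (A * (2 / (h * m%:R))).
Proof.
move=> h0 m0 pA; have mR : 0 < m%:R :> R by rewrite ltr0n.
have -> : h^-1 *: (1 - 'X) * box R m = (h * m%:R)^-1 *: (1 - 'X^m).
  rewrite /box -scalerAl -scalerAr scalerA invfM; congr (_ *: _).
  by rewrite -opprB mulNr -subrX1 opprB.
rewrite -scalerAr mulrBr mulr1.
have -> : A * (2 / (h * m%:R)) = `|(h * m%:R)^-1| * (A + A).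
  rewrite ger0_norm ?invr_ge0 ?mulr_ge0 ?ltW//; field.
  by rewrite !gt_eqF.
by apply: coef_leZ; apply: coef_leB => //; exact: coef_leMXn.
Qed.

Lemma coef_le_prodbox p A (s : seq nat) (m : nat -> nat) :
  (forall i, 0 < m i)%N -> coef_le p A ->
  coef_le (p * \prod_(i <- s) box R (m i)) A.
Proof.
move=> m0; elim: s p => [|i s IH] p pA; first by rewrite big_nil mulr1.
by rewrite big_cons mulrA; apply: IH; exact: coef_le_mulbox.
Qed.

Lemma coef_le_proddiffbox p A h (s : seq nat) (m : nat -> nat) :
  0 < h -> (forall i, 0 < m i)%N -> coef_le p A ->
  coef_le (p * \prod_(i <- s) (h^-1 *: (1 - 'X) * box R (m i)))
    (A * \prod_(i <- s) (2 / (h * (m i)%:R))).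
Proof.
move=> h0 m0; elim: s p A => [|i s IH] p A pA; first by rewrite !big_nil !mulr1.
by rewrite 2!big_cons mulrA [X in coef_le _ X]mulrA; apply: IH; exact: coef_le_muldiffbox.
Qed.

(** The first box is the starting point: its coefficients, at most [1 / m 0], are of the order of
    the step. The next [n] boxes pay for one difference quotient each, and averaging with the
    remaining ones costs nothing. *)
Lemma coef_le_diff_prodbox h (N n : nat) (m : nat -> nat) :
  0 < h -> (forall i, 0 < m i)%N -> (n <= N)%N ->
  coef_le ((h^-1 *: (1 - 'X)) ^+ n * \prod_(0 <= i < N.+1) box R (m i))
    ((m 0%N)%:R^-1 * \prod_(1 <= i < n.+1) (2 / (h * (m i)%:R))).
Proof.
move=> h0 m0 nN.
rewrite big_nat_recl//= -(big_add1 _ _ 0 N.+1 predT (fun i => box R (m i))).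
rewrite (big_cat_nat (n := n.+1))//=.
have -> : (h^-1 *: (1 - 'X)) ^+ n * (box R (m 0%N) *
      (\prod_(1 <= i < n.+1) box R (m i) * \prod_(n.+1 <= i < N.+1) box R (m i))) =
    box R (m 0%N) * \prod_(1 <= i < n.+1) (h^-1 *: (1 - 'X) * box R (m i)) *
      \prod_(n.+1 <= i < N.+1) box R (m i).
  rewrite big_split/= prodr_const_nat subn1/=; ring.
apply: coef_le_prodbox => //; apply: coef_le_proddiffbox => //.
move=> i; rewrite /box coefZ coef_sum normrM.
have mR : 0 < (m 0%N)%:R :> R by rewrite ltr0n.
rewrite ger0_norm ?invr_ge0 ?(ltW mR)// ler_piMr ?invr_ge0 ?(ltW mR)//.
under eq_bigr do rewrite coefXn eq_sym.
rewrite ger0_norm ?sumr_ge0//.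
have [im|im] := ltnP i (m 0%N).
  rewrite (bigD1 (Ordinal im))//= eqxx big1 ?addr0// => j ji.
  by rewrite (_ : _ == _ = false)//; apply: contraNF ji.
rewrite big1// => j _; rewrite ltn_eqF//; exact: leq_trans (ltn_ord j) im.
Qed.

(** Cauchy's estimate in elementary form: as [c >= 0], the coefficients have the absolute values of
    those of the product of the [1 + c i X], each term of which is at most the whole value. *)
Lemma coef_prod_linear (I : Type) (s : seq I) (P : pred I) (c : I -> R) X n :
  (forall i, P i -> 0 <= c i) -> 0 <= X ->
  `|(\prod_(i <- s | P i) (1 - c i *: 'X : {poly R}))`_n| * X ^+ n <=
  \prod_(i <- s | P i) (1 + X * c i).
Proof.
move=> c0 X0; elim: s n => [|i s IH] n.
  rewrite !big_nil coef1; case: n => [|n]; first by rewrite normr1 mulr1.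
  by rewrite normr0 mul0r.
rewrite !big_cons; case: ifPn => // Pi.
set p := \prod_(j <- s | P j) _ in IH *; set Q := \prod_(j <- s | P j) _ in IH *.
rewrite mulrBl mul1r -scalerAl coefB coefZ coefXM.
apply: (@le_trans _ _ ((`|p`_n| + `|c i| * `|if n == 0%N then 0 else p`_n.-1|) * X ^+ n)).
  by rewrite ler_wpM2r ?exprn_ge0// (le_trans (ler_normB _ _))// normrM.
rewrite mulrDl [leRHS]mulrDl mul1r lerD//.
have Q0 : 0 <= Q by apply: le_trans _ (IH 0%N); rewrite mulr_ge0.
rewrite (ger0_norm (c0 _ Pi)).
case: n => [|n] /=; first by rewrite normr0 mulr0 mul0r !mulr_ge0// c0.
have k := ler_wpM2l (mulr_ge0 X0 (c0 _ Pi)) (IH n).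
by apply: le_trans k; rewrite exprS le_eqVlt; apply/orP; left; apply/eqP; ring.
Qed.

Lemma size_prod_le (I : Type) (s : seq I) (P : pred I) (f : I -> {poly R})
    (d : I -> nat) :
  (forall i, P i -> (size (f i) <= (d i).+1)%N) ->
  (size (\prod_(i <- s | P i) f i)%R <= (\sum_(i <- s | P i) d i).+1)%N.
Proof.
move=> h; elim: s => [|i s IH]; first by rewrite !big_nil size_poly1.
rewrite !big_cons; case: ifPn => // Pi.
apply: (leq_trans (size_polyMleq _ _)).
move: (leq_add (h _ Pi) IH); rewrite addSn addnS.
by set n := (size (f i) + _)%N; case: n.
Qed.

Lemma size_box_le m : (size (box R m) <= m.+1)%N.
Proof.
apply: (leq_trans (size_scale_leq _ _)); apply: (leq_trans (size_sum _ _ _)).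
apply/bigmax_leqP => j _; rewrite size_polyXn; exact: ltnW (ltn_ord j).
Qed.

Lemma horner_box_ge m x : (0 < m)%N -> 0 < x <= 1 -> x ^+ m <= (box R m).[x].
Proof.
move=> m0 /andP[x0 x1]; rewrite /box hornerZ horner_sum.
have mR : 0 < m%:R :> R by rewrite ltr0n.
rewrite ler_pdivlMl// mulr_natl -[m in _ *+ m]card_ord -sumr_const.
apply: ler_sum => j _; rewrite hornerXn ler_wiXn2l ?(ltW x0)//.
exact: ltnW (ltn_ord j).
Qed.

End coef_bounds.

Lemma sum_half_pow_le (R : realType) (n : nat) :
  \sum_(i < n) (1 / 2 : R) ^+ i <= 2.
Proof.
suff -> : \sum_(i < n) (1 / 2 : R) ^+ i = 2 - 2 * (1 / 2) ^+ n.
  by rewrite gerBl mulr_ge0 ?exprn_ge0 ?divr_ge0.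
elim: n => [|n IH]; first by rewrite big_ord0 expr0 mulr1 subrr.
by rewrite big_ord_recr/= IH exprS; field.
Qed.

(** As a function of [n] the left side peaks for [n] of order [Y ^ 4]; the factor [(1/2) ^ n] is
    kept for summation. Proof: [u <= exp (u ^ 4 / 4)] at [u = 2 Y / r]. Since [Y] will be of order
    [1 / t], the [4] added to the exponent of the cost originates here. *)
Lemma expn_ratio_le (R : realType) (Y r : R) (n : nat) :
  0 <= Y -> 1 <= r -> r ^+ 4 = n.+1%:R ->
  (Y / r) ^+ n <= expR (4 * Y ^+ 4) * (1 / 2) ^+ n.
Proof.
move=> Y0 r1 r4; have r0 : 0 < r by lra.
pose x := 2 * Y / r.
have x0 : 0 <= x by rewrite !mulr_ge0// invr_ge0 ltW.
have -> : Y / r = x * (1 / 2) by rewrite /x; field; lra.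
rewrite exprMn ler_wpM2r ?exprn_ge0 ?divr_ge0//.
have h : x <= expR (x ^+ 4 / 4).
  apply: le_trans (expR_ge1Dx _).
  have : 0 <= (x ^+ 2 - 1) ^+ 2 by exact: sqr_ge0.
  have : 0 <= (x - 1) ^+ 2 by exact: sqr_ge0.
  have : 0 <= (x + 1) ^+ 2 by exact: sqr_ge0.
  nra.
apply: (@le_trans _ _ (expR (x ^+ 4 / 4) ^+ n)).
  by rewrite lerXn2r// nnegrE expR_ge0.
rewrite -expRM_natl ler_expR.
have n1 : 0 < n.+1%:R :> R by rewrite ltr0n.
have -> : x ^+ 4 = 16 * Y ^+ 4 / n.+1%:R by rewrite /x -r4; field; lra.
have -> : n%:R * (16 * Y ^+ 4 / n.+1%:R / 4) = 4 * Y ^+ 4 * (n%:R / n.+1%:R).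
  by field; rewrite gt_eqF.
rewrite ler_piMr ?mulr_ge0 ?exprn_ge0// ler_pdivrMr// mul1r ler_nat//.
Qed.

Section moments.
Context (R : realType) (mu : nat -> R) (S : R).
Hypotheses (mu1 : forall k, 1 <= mu k) (mu_incr : increasing_seq mu)
  (muS : forall N, \sum_(l < N) mu l `^ (- (2 / 3)) <= S).

Let mu0 k : 0 < mu k. Proof. by apply: lt_le_trans (mu1 k). Qed.

Let S0 : 0 <= S. Proof. by have := muS 0%N; rewrite big_ord0. Qed.

(* Every coefficient of the product is controlled by its value at
   [- (n + 1) ^ (3 / 2)], the optimal point for the growth of order 2/3. *)
Lemma coef_moment_product (zeta : nat -> R) (N k n : nat) (r : R) :
  (forall l, (l < N)%N -> mu l / 2 <= zeta l) ->
  r = n.+1%:R `^ (1 / 4) ->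
  `|(\prod_(l < N | l != k :> nat) (1 - (zeta l)^-1 *: 'X : {poly R}))`_n| <=
    expR (4 * S) ^+ n.+1 / r ^+ (6 * n).
Proof.
move=> hz rE.
have n1 : 1 <= n.+1%:R :> R by rewrite ler1n.
have r1 : 1 <= r.
  by rewrite rE -[leLHS](powRr0 n.+1%:R); apply: ler_powR => //; lra.
have r0 : 0 < r by lra.
have X23 : (r ^+ 6) `^ (2 / 3) = n.+1%:R.
  rewrite rE -powR_mulrn ?powR_ge0// -!powRrM.
  by rewrite (_ : 1 / 4 * (6 * (2 / 3)) = 1) ?powRr1//; field.
have X0 : 0 < r ^+ 6 by rewrite exprn_gt0.
have z0 (l : 'I_N) : 0 < zeta l.
  by apply: lt_le_trans (hz l (ltn_ord l)); rewrite divr_gt0.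
rewrite ler_pdivlMr ?exprn_gt0// exprM.
apply: le_trans (@coef_prod_linear R _ _ _ (fun l : 'I_N => (zeta l)^-1) _ n _ (ltW X0)) _.
  by move=> l _; rewrite invr_ge0 ltW.
apply: (@le_trans _ _ (\prod_(l < N | l != k :> nat)
    expR (4 * n.+1%:R * mu l `^ (- (2 / 3))))).
  apply: ler_prod => l _; apply/andP; split.
    by rewrite addr_ge0// mulr_ge0 ?invr_ge0 ?ltW.
  have h : r ^+ 6 * (zeta l)^-1 <= 2 * r ^+ 6 * (mu l)^-1.
    have -> : 2 * r ^+ 6 * (mu l)^-1 = r ^+ 6 * (mu l / 2)^-1.
      by field; rewrite gt_eqF.
    by rewrite ler_pM2l// lef_pV2 ?posrE ?divr_gt0//; exact: hz.
  apply: (@le_trans _ _ (1 + 2 * r ^+ 6 * (mu l)^-1)); first by rewrite lerD2l.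
  apply: (le_trans (one_add_le_expR _)).
    by rewrite !mulr_ge0 ?invr_ge0 ?ltW.
  rewrite ler_expR.
  have -> : (2 * r ^+ 6 * (mu l)^-1) `^ (2 / 3) =
      2 `^ (2 / 3) * n.+1%:R * mu l `^ (- (2 / 3)).
    have q0 : 0 <= 2 * r ^+ 6 by rewrite mulr_ge0 ?(ltW X0).
    have q1 : 0 <= (mu l)^-1 by rewrite invr_ge0 ltW.
    rewrite (powRM _ q0 q1) (powRM _ (ler0n R 2) (ltW X0)).
    by rewrite X23 -(powR_inv1 (ltW (mu0 l))) -powRrM mulN1r.
  have h2 : 2 `^ (2 / 3) <= 2 :> R by apply: ler1_powR; lra.
  rewrite !mulrA ler_wpM2r ?powR_ge0// ler_wpM2r//; lra.
rewrite -expR_sum -expRM_natl ler_expR.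
rewrite -mulr_sumr mulrA [n.+1%:R * 4]mulrC ler_wpM2l ?mulr_ge0//.
apply: le_trans (muS N).
by rewrite big_mkcond/=; apply: ler_sum => l _; case: ifP; rewrite ?powR_ge0.
Qed.

(** Expand in powers of [(1 - X) / h]. With [r = (n + 1) ^ (1/4)], the coefficient of the [n]-th
    power decays like [r ^ (- 6n)] and the boxes let the power itself cost only [r ^ (5n)], up to
    geometric factors. The sum over [n] of the resulting [(Y / r) ^ n] is bounded independently of
    [N] and [k], and a factor [h] remains in front. *)
Lemma moment_polynomial (N k : nat) (al h : R) (m : nat -> nat) (zeta : nat -> R) :
  0 < al -> 0 < h -> (forall i, 0 < m i)%N ->
  (forall i, (i <= N)%N ->
     al / 2 * i.+1%:R `^ (- (5 / 4)) <= h * (m i)%:R) ->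
  (forall l, (l < N)%N -> mu l / 2 <= zeta l) ->
  coef_le (((\prod_(l < N | l != k :> nat) (1 - (zeta l)^-1 *: 'X)) \Po
      (h^-1 *: (1 - 'X))) * \prod_(0 <= i < N.+1) box R (m i))
    (h * (4 / al * expR (4 * S) * expR (4 * (4 * expR (4 * S) / al) ^+ 4))).
Proof.
move=> al0 h0 m0 hm hz.
set F := \prod_(l < N | _) _.
have sF : (size F <= N.+1)%N.
  apply: (leq_trans (@size_prod_le _ _ _ _ _ (fun=> 1%N) _)).
    move=> l _; apply: (leq_trans (size_polyD _ _)).
    rewrite size_poly1 size_polyN geq_max/=.
    by apply: (leq_trans (size_scale_leq _ _)); rewrite size_polyX.
  rewrite ltnS big_mkcond/= -[leqRHS]card_ord -sum1_card.
  by apply: leq_sum => l _; case: ifP.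
rewrite comp_polyE mulr_suml.
set E := expR (4 * S); pose Y := 4 * E / al.
have E0 : 0 < E by exact: expR_gt0.
have Y0 : 0 <= Y by rewrite divr_ge0 ?mulr_ge0 ?ltW.
pose A := h * (2 / al * E * expR (4 * Y ^+ 4)).
have A0 : 0 <= A.
  by rewrite /A !mulr_ge0 ?expR_ge0 ?invr_ge0 ?(ltW h0) ?(ltW al0) ?(ltW E0).
suff hn (n : 'I_(size F)) : coef_le
    (F`_n *: (h^-1 *: (1 - 'X)) ^+ n * \prod_(0 <= i < N.+1) box R (m i))
    (A * (1 / 2) ^+ n).
  have hs := @coef_le_sum R _ (index_enum _) predT _ _ (fun n _ => hn n).
  move=> i; apply: (le_trans (hs i)).
  rewrite -mulr_sumr.
  apply: (le_trans (ler_wpM2l A0 (sum_half_pow_le R (size F)))).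
  by rewrite le_eqVlt; apply/orP; left; apply/eqP; rewrite /A /Y; ring.
have nN : (n <= N)%N by rewrite -ltnS; apply: leq_trans sF.
rewrite -scalerAl.
have c1 := coef_leZ F`_n (coef_le_diff_prodbox h0 m0 nN).
move=> i; apply: (le_trans (c1 i)) => {c1 i}.
pose r := n.+1%:R `^ (1 / 4) : R.
have n1 : 1 <= n.+1%:R :> R by rewrite ler1n.
have r1 : 1 <= r.
  by rewrite /r -[leLHS](powRr0 n.+1%:R); apply: ler_powR => //; lra.
have r0 : 0 < r by lra.
have r4 : r ^+ 4 = n.+1%:R.
  rewrite /r -powR_mulrn ?powR_ge0// -!powRrM.
  by rewrite (_ : 1 / 4 * 4 = 1) ?powRr1//; field.
have c2 := @coef_moment_product zeta N k n r hz erefl.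
rewrite -/E -/F in c2.
have c3 : (m 0%N)%:R^-1 <= 2 * h / al.
  have m00 : 0 < (m 0%N)%:R :> R by rewrite ltr0n.
  have := hm 0%N isT; rewrite powR1 mulr1 => h1.
  rewrite -[2 * h / al]invrK lef_pV2 ?posrE ?invr_gt0 ?divr_gt0 ?mulr_gt0//.
  rewrite invf_div ler_pdivrMr ?mulr_gt0//.
  lra.
(* Each of the boxes [1] to [n] is at least as long as the lower bound for the [n]-th one, and
   [r ^ 5 = (n + 1) ^ (5/4)]. *)
have c4 : \prod_(1 <= i < n.+1) (2 / (h * (m i)%:R)) <= (4 / al * r ^+ 5) ^+ n.
  rewrite -[X in _ ^+ X](subn1 n.+1) -prodr_const_nat.
  rewrite !big_nat; apply: ler_prod => i /andP[i1 i2].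
  have mi0 : 0 < (m i)%:R :> R by rewrite ltr0n.
  have i0 : 0 < i.+1%:R :> R by rewrite ltr0n.
  apply/andP; split; first by rewrite divr_ge0 ?mulr_ge0 ?ltW.
  have hi := hm i (leq_trans (ltnSE i2) nN).
  have p0 : 0 < i.+1%:R `^ (5 / 4) :> R by rewrite powR_gt0.
  have ri : i.+1%:R `^ (5 / 4) <= r ^+ 5.
    rewrite /r -powR_mulrn ?powR_ge0// -!powRrM (_ : 1 / 4 * 5 = 5 / 4); last by field.
    by apply: le_powR_base; [lra|lra|rewrite ler_nat ltnS ltnSE].
  rewrite ler_pdivrMr ?mulr_gt0//.
  apply: (@le_trans _ _ (4 / al * r ^+ 5 * (al / 2 * i.+1%:R `^ (- (5 / 4))))); last first.
    by rewrite ler_wpM2l// mulr_ge0 ?exprn_ge0 ?divr_ge0 ?ltW.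
  rewrite powRN.
  have -> : 4 / al * r ^+ 5 * (al / 2 * (i.+1%:R `^ (5 / 4))^-1) =
     2 * (r ^+ 5 / i.+1%:R `^ (5 / 4)) by field; rewrite !gt_eqF.
  by rewrite ler_peMr// ler_pdivlMr// mul1r.
have P0 : 0 <= \prod_(1 <= i < n.+1) (2 / (h * (m i)%:R)).
  by apply: prodr_ge0 => i _; rewrite divr_ge0 ?mulr_ge0 ?ler0n ?(ltW h0).
apply: (@le_trans _ _ ((E ^+ n.+1 / r ^+ (6 * n)) *
    ((2 * h / al) * (4 / al * r ^+ 5) ^+ n))).
  by rewrite ler_pM ?mulr_ge0 ?invr_ge0// ler_pM ?invr_ge0.
have -> : (E ^+ n.+1 / r ^+ (6 * n)) * ((2 * h / al) * (4 / al * r ^+ 5) ^+ n) =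
    h * (2 / al * E) * (Y / r) ^+ n.
  have -> : Y / r = 4 / al * E * r^-1 by rewrite /Y; field; rewrite !gt_eqF.
  have -> : (4 / al * r ^+ 5) ^+ n = (4 / al) ^+ n * (r ^+ n) ^+ 5.
    by rewrite exprMn; congr (_ * _); rewrite -!exprM mulnC.
  have -> : r ^+ (6 * n) = (r ^+ n) ^+ 6 by rewrite mulnC exprM.
  have -> : (4 / al * E * r^-1) ^+ n = (4 / al) ^+ n * E ^+ n / r ^+ n.
    by rewrite exprMn exprVn; congr (_ / _); exact: exprMn.
  rewrite exprS; set u := r ^+ n; have u0 : u != 0 by rewrite /u expf_neq0 ?gt_eqF.
  by field; rewrite u0 gt_eqF.
rewrite /A -mulrA -[leRHS]mulrA ler_pM2l// -[leRHS]mulrA ler_wpM2l//.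
  by rewrite mulr_ge0 ?divr_ge0 ?ltW.
exact: expn_ratio_le.
Qed.

End moments.

Lemma inv_expn_le (R : realType) (t : R) (p q : nat) :
  0 < t <= 1 -> (p <= q)%N -> (t ^+ p)^-1 <= (t ^+ q)^-1.
Proof.
move=> /andP[t0 t1] pq; rewrite lef_pV2 ?posrE ?exprn_gt0//.
by rewrite ler_wiXn2l// ltW.
Qed.

Lemma le_expR (R : realType) (x : R) : x <= expR x.
Proof. by apply: le_trans (expR_ge1Dx _); rewrite lerDr. Qed.

Section discrete_moments.
Context (R : realType) (mu bt : nat -> R) (S C : R) (g : nat).
Hypotheses (mu1 : forall k, 1 <= mu k) (mu_incr : increasing_seq mu)
  (muS : forall N, \sum_(l < N) mu l `^ (- (2 / 3)) <= S) (C0 : 0 < C)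
  (weight : forall (t : R) N k, 0 < t <= 1 ->
    1 <= `|bt k| * (\prod_(l < N | l != k :> nat) `|1 - mu k / mu l|) *
      expR (mu k * t / 8 + C / t ^+ g)).

Let mu0 k : 0 < mu k. Proof. by apply: lt_le_trans (mu1 k). Qed.

(** The sum of the [(i + 1) ^ (- 5/4)] is at most 5, so lengths with [al = t / 20] fill at most a
    quarter of the time. The step is small enough that rounding to whole cells loses at most half of
    a length, and that the [N + 1] cells needed for the degree of the Lagrange product fit in
    [t / 2]. *)
Lemma box_sizes (t : R) (N : nat) : 0 < t <= 1 -> exists2 h0 : R, 0 < h0 &
  forall h, 0 < h -> h <= h0 -> exists m : nat -> nat,
  [/\ forall i, (0 < m i)%N,
    forall i, (i <= N)%N ->
       (t / 20) / 2 * i.+1%:R `^ (- (5 / 4)) <= h * (m i)%:R,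
    h * \sum_(i < N.+1) (m i)%:R <= t / 4 & h * N.+1%:R <= t / 2].
Proof.
move=> /andP[t0 t1]; pose al := t / 20; have al0 : 0 < al by rewrite /al; lra.
pose a i : R := al * i.+1%:R `^ (- (5 / 4)).
have a0 i : 0 < a i by rewrite mulr_gt0// powR_gt0.
have N0 : 0 < N.+1%:R :> R by rewrite ltr0n.
exists (Num.min (t / 2 / N.+1%:R) (a N / 2)).
  by rewrite lt_min !divr_gt0.
move=> h h0; rewrite le_min => /andP[h1 h2].
(* The maximum only secures positivity for [i > N]; for [i <= N] the truncation is already at least
   2. *)
exists (fun i => maxn 1 (Num.truncn (a i / h))).
have aN i : (i <= N)%N -> a N <= a i.
  move=> iN; rewrite ler_pM2l// !powRN lef_pV2 ?posrE ?powR_gt0//.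
  by apply: le_powR_base; [lra|rewrite ler0n|rewrite ler_nat ltnS].
have ge2 i : (i <= N)%N -> 2 <= a i / h.
  by move=> /aN ai; rewrite ler_pdivlMr//; lra.
have mE i : (i <= N)%N -> maxn 1 (Num.truncn (a i / h)) = Num.truncn (a i / h).
  by move=> iN; apply/maxn_idPr; rewrite truncn_gt_nat (le_trans _ (ge2 i iN))// ler1n.
split.
- by move=> i; rewrite leq_maxl.
- move=> i iN; rewrite mE//.
  have /andP[_] := truncn_itv (ltW (divr_gt0 (a0 i) h0)).
  rewrite ltr_pdivrMr// -natr1; have := ge2 _ iN; rewrite ler_pdivlMr//.
  have -> : t / 20 / 2 * i.+1%:R `^ (- (5 / 4)) = a i / 2 by rewrite /a /al; ring.
  lra.
- rewrite mulr_sumr; apply: (@le_trans _ _ (\sum_(i < N.+1) a i)).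
    apply: ler_sum => i _; rewrite mE ?(ltnSE (ltn_ord i))//.
    have /andP[+ _] := truncn_itv (ltW (divr_gt0 (a0 i) h0)).
    by rewrite ler_pdivlMr// mulrC.
  rewrite -mulr_sumr.
  have := @zeta_sum_le R (1 / 4) N.+1 ltac:(lra).
  have -> : 1 + 1 / 4 = 5 / 4 :> R by field.
  have -> : 1 + (1 / 4)^-1 = 5 :> R by field.
  by move=> /(ler_wpM2l (ltW al0)); rewrite /al; lra.
- by move: h1; rewrite ler_pdivlMr.
Qed.

(** The factor [(1 - expR (- (mu k * h))) / mu k] is the moment of one cell, and the powers account
    for its position: a control on [L] cells is a polynomial with prescribed values at the nodes
    [expR (- (mu k * h))]. [K0] and [G] are fixed before [t], [N] and the data. *)
Lemma discrete_moments : exists (K0 : R) (G : nat), 0 < K0 /\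
  forall (t : R) (N : nat) (x : nat -> R) (e : R), 0 < t <= 1 -> 0 <= e ->
    (forall k, `|x k| <= e) ->
  exists (h : R) (L : nat) (c : nat -> R),
  [/\ 0 < h, h * L%:R <= t, forall i, `|c i| <= expR (K0 / t ^+ G) * e &
    forall k, (k < N)%N ->
    (\sum_(i < L) c i * expR (- (mu k * h)) ^+ i) *
      ((1 - expR (- (mu k * h))) / mu k) * bt k = expR (- (mu k * t)) * x k].
Proof.
have S0 : 0 <= S by have := muS 0%N; rewrite big_ord0.
pose E := expR (4 * S); have E0 : 0 < E by exact: expR_gt0.
(* The four terms dominate, in this order, four factors of the final bound: the weight
   [expR (C / t ^+ g)], the constant [640 * S * E], the factor [t ^ (- 2)], and the exponential left
   by the balance of boxes and coefficients. *)
exists (C + 640 * S * E + 1 + 4 * (80 * E) ^+ 4), (g + 4)%N; split.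
  have := mulr_ge0 S0 (ltW E0); have := exprn_ge0 4 (ltW (mulr_gt0 (ltr0n R 80) E0)).
  move: (C0) => C0'; lra.
move=> t N x e ht e0 xe; have /andP[t0 t1] := ht.
have [h0 h00 hb] := box_sizes N ht.
have [h /= [hp hh0 hz hprod]] := small_step N mu1 mu_incr h00.
have [m [m0 hm hms hN]] := hb h hp hh0.
pose z k := expR (- (mu k * h)); pose zeta k := (1 - z k) / h.
have z0 k : 0 < z k by exact: expR_gt0.
have z1 k : z k < 1 by rewrite expR_lt1 oppr_lt0 mulr_gt0.
have zeta0 k : 0 < zeta k by rewrite divr_gt0// subr_gt0.
pose Fp k : {poly R} := \prod_(l < N | l != k :> nat) (1 - (zeta l)^-1 *: 'X).
pose Bp : {poly R} := \prod_(0 <= i < N.+1) box R (m i).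
pose Q k := (Fp k \Po (h^-1 *: (1 - 'X))) * Bp.
have al0 : 0 < t / 20 by lra.
have QK k := moment_polynomial mu1 muS k al0 hp m0 hm hz.
set Kq := (_ * _ * expR _) in QK.
have FE k l : (Fp k).[zeta l] = \prod_(i < N | i != k :> nat) (1 - zeta l / zeta i).
  rewrite horner_prod; apply: eq_bigr => i _.
  by rewrite -polyC1 hornerD hornerC hornerN hornerZ hornerX mulrC.
have QE k l : (Q k).[z l] = (Fp k).[zeta l] * Bp.[z l].
  by rewrite hornerM horner_comp hornerZ hornerD hornerN hornerX -polyC1 hornerC [h^-1 * _]mulrC.
have Q0 k l : (l < N)%N -> l != k -> (Q k).[z l] = 0.
  move=> lN lk; rewrite QE FE (bigD1 (Ordinal lN))//= divff ?gt_eqF//.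
  by rewrite subrr !mul0r.
have BE k : expR (- (mu k * t / 4)) <= Bp.[z k].
  apply: (@le_trans _ _ (\prod_(0 <= i < N.+1) z k ^+ m i)).
    rewrite big_mkord prodrXr -expRM_natl ler_expR natr_sum.
    rewrite mulrN lerN2 mulrCA -mulrA ler_pM2l// mulrC//.
  rewrite horner_prod; apply: ler_prod => i _.
  rewrite exprn_ge0 ?(ltW (z0 k))// andTb.
  by apply: horner_box_ge => //; rewrite z0 ltW.
have B0 k : 0 < Bp.[z k] by apply: lt_le_trans (BE k); exact: expR_gt0.
have b0 k : 0 < `|bt k|.
  rewrite normr_gt0; apply/eqP => bk.
  by have := weight N k ht; rewrite bk normr0 !mul0r ler10.
have Fge k : (k < N)%N ->
    (\prod_(l < N | l != k :> nat) `|1 - mu k / mu l|) / 2 <= `|(Fp k).[zeta k]|.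
  by move=> kN; rewrite FE normr_prod; exact: hprod.
have F0 k : (k < N)%N -> 0 < `|(Fp k).[zeta k]|.
  move=> kN; apply: lt_le_trans (Fge k kN); rewrite divr_gt0//.
  rewrite lt_neqAle prodr_ge0 // andbT eq_sym; apply/eqP => p0.
  by have := weight N k ht; rewrite p0 mulr0 mul0r ler10.
(* Lagrange interpolation: [Q k] vanishes at the other nodes, and dividing by its own value at [z k]
   produces the prescribed moment. *)
pose cf k := expR (- (mu k * t)) * x k * (mu k / (1 - z k)) / bt k /
   ((Fp k).[zeta k] * Bp.[z k]).
pose D := e * (4 / h) * expR (C / t ^+ g).
have D0 : 0 <= D by rewrite !mulr_ge0 ?expR_ge0 ?invr_ge0 ?(ltW hp).
(* Budget of the decay [exp (- mu_k t)]: a quarter is lost to the boxes, an eighth to the weight,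
   one half is kept for summing over [k], and an eighth is left over. *)
have cfle k : (k < N)%N -> `|cf k| <= D * expR (- (mu k * t / 2)).
  move=> kN; rewrite /cf !normrM !normfV normrM (ger0_norm (expR_ge0 _)).
  have z1' : 0 < 1 - z k by rewrite subr_gt0.
  rewrite (gtr0_norm (mu0 k)) (gtr0_norm z1') (gtr0_norm (B0 k)).
  rewrite ler_pdivrMr ?mulr_gt0 ?F0// ler_pdivrMr//.
  have mz : mu k / (1 - z k) <= 2 / h.
    have := hz k kN; rewrite -/(zeta k) /zeta ler_pdivlMr// => q.
    by rewrite ler_pdivrMr// mulrAC ler_pdivlMr//; lra.
  apply: (@le_trans _ _ (expR (- (mu k * t)) * e * (2 / h))).
    apply: ler_pM; last exact: mz.
    - by rewrite mulr_ge0 ?expR_ge0.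
    - by rewrite divr_ge0 ?ltW.
    - by rewrite ler_wpM2l ?expR_ge0.
  have w := weight N k ht; set P := \prod_(l < N | _) _ in w.
  have P0 : 0 <= P by apply: prodr_ge0.
  apply: (@le_trans _ _ (D * expR (- (mu k * t / 2)) *
      (P / 2 * expR (- (mu k * t / 4))) * `|bt k|)); last first.
    apply: ler_wpM2r => //; apply: ler_wpM2l; first by rewrite mulr_ge0 ?expR_ge0.
    by apply: ler_pM; rewrite ?expR_ge0 ?divr_ge0//; exact: Fge.
  have -> : D * expR (- (mu k * t / 2)) * (P / 2 * expR (- (mu k * t / 4))) * `|bt k|
    = e * (2 / h) * (`|bt k| * P * (expR (C / t ^+ g) * expR (- (mu k * t / 2)) *
        expR (- (mu k * t / 4)))).
    by rewrite /D; field; rewrite gt_eqF.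
  have -> : expR (C / t ^+ g) * expR (- (mu k * t / 2)) * expR (- (mu k * t / 4)) =
      expR (mu k * t / 8 + C / t ^+ g) * expR (- (mu k * t)) * expR (mu k * t / 8).
    by rewrite -!expRD; congr expR; field; rewrite gt_eqF// exprn_gt0.
  rewrite [leLHS](_ : _ = e * (2 / h) * expR (- (mu k * t))); last by ring.
  apply: ler_wpM2l; first by rewrite mulr_ge0 ?divr_ge0 ?(ltW hp).
  rewrite !mulrA -[leLHS]mulr1 ler_pM ?expR_ge0//.
    by rewrite ler_peMl ?expR_ge0.
  by rewrite -[leLHS]expR0 ler_expR divr_ge0 ?mulr_ge0 ?(ltW t0) ?(ltW (mu0 _)).
pose P := \sum_(k < N) cf k *: Q k.
pose L := (N + \sum_(i < N.+1) m i).+1.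
have sQ k : (size (Q k) <= L)%N.
  apply: (leq_trans (size_polyMleq _ _)).
  have sB : (size Bp <= (\sum_(i < N.+1) m i).+1)%N.
    by rewrite -(big_mkord predT); apply: size_prod_le => i _; exact: size_box_le.
  have sF : (size (Fp k) <= N.+1)%N.
    apply: (leq_trans (@size_prod_le _ _ _ _ _ (fun=> 1%N) _)).
      move=> l _; apply: (leq_trans (size_polyD _ _)).
      rewrite size_poly1 size_polyN geq_max/=.
      by apply: (leq_trans (size_scale_leq _ _)); rewrite size_polyX.
    rewrite ltnS big_mkcond/= -[leqRHS]card_ord -sum1_card.
    by apply: leq_sum => l _; case: ifP.
  have sC : (size (Fp k \Po (h^-1 *: (1 - 'X))) <= N.+1)%N.
    apply: (leq_trans (size_comp_poly_leq _ _)); rewrite ltnS.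
    have sX : (size (h^-1 *: (1 - 'X) : {poly R}) <= 2)%N.
      apply: (leq_trans (size_scale_leq _ _)); apply: (leq_trans (size_polyD _ _)).
      by rewrite size_poly1 size_polyN size_polyX.
    apply: (@leq_trans (N * 1)); last by rewrite muln1.
    by apply: leq_mul; [case: (size _) sF|case: (size _) sX].
  apply: (@leq_trans (N.+1 + (\sum_(i < N.+1) m i).+1).-1).
    by rewrite -!subn1 leq_sub2r// leq_add.
  by rewrite addSn addnS.
have sP : (size P <= L)%N.
  apply: (leq_trans (size_sum _ _ _)); apply/bigmax_leqP => k _.
  by apply: (leq_trans (size_scale_leq _ _)).
exists h, L, (fun i => P`_i); split => //.
- rewrite /L -addnS -addSnnS natrD natr_sum mulrDr; lra.
- move=> i.
  have /(_ i) := @coef_le_sum R _ (index_enum 'I_N) predT (fun k => cf k *: Q k)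
    (fun k : 'I_N => `|cf k| * (h * Kq)) (fun k _ => coef_leZ (cf k) (QK k)).
  rewrite -/P => /le_trans; apply; rewrite -mulr_suml.
  have Kq0 : 0 <= Kq.
    by rewrite /Kq !mulr_ge0 ?expR_ge0 ?invr_ge0 ?divr_ge0 ?(ltW t0).
  (* From [exp (- x) <= 1 / x] and [1 / mu_k <= mu_k ^ (- 2/3)], so the same constant [S] bounds the
     sum for every [N]. *)
  have s1 : \sum_(k < N) `|cf k| <= D * (2 / t * S).
    apply: (@le_trans _ _ (\sum_(k < N) D * (2 / t * mu k `^ (- (2 / 3))))).
      apply: ler_sum => k _; apply: (le_trans (cfle k (ltn_ord k))).
      rewrite ler_wpM2l// expRN.
      apply: (@le_trans _ _ (mu k * t / 2)^-1).
        rewrite lef_pV2 ?posrE ?expR_gt0 ?divr_gt0 ?mulr_gt0//.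
        exact: le_expR.
      rewrite invf_div invfM mulrA mulrAC ler_wpM2l ?divr_ge0 ?(ltW t0)//.
      rewrite powRN lef_pV2 ?posrE ?powR_gt0//.
      by apply: ler1_powR => //; lra.
    by rewrite -mulr_sumr -mulr_sumr !ler_wpM2l ?divr_ge0 ?(ltW t0).
  apply: (le_trans (ler_wpM2r (mulr_ge0 (ltW hp) Kq0) s1)).
  (* The [h] of the coefficient bound cancels the [1 / h] in [D]: refining the step, which [N]
     forces, does not raise the cost. *)
  have -> : D * (2 / t * S) * (h * Kq) = (expR (C / t ^+ g) * (640 * S * E) * (t ^+ 2)^-1 *
      expR (4 * (80 * E) ^+ 4 / t ^+ 4)) * e.
    rewrite /D /Kq -/E.
    have -> : 4 * (4 * E / (t / 20)) ^+ 4 = 4 * (80 * E) ^+ 4 / t ^+ 4.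
      by field; rewrite gt_eqF.
    by field; rewrite !gt_eqF.
  rewrite ler_wpM2r//.
  have split4 (p q r s w : R) : (p + q + r + s) / w = p / w + q / w + r / w + s / w.
    by rewrite !mulrDl.
  rewrite split4 !expRD.
  have tG0 : 0 < t ^+ (g + 4) by rewrite exprn_gt0.
  have SE0 : 0 <= 640 * S * E := mulr_ge0 (mulr_ge0 (ler0n R 640) S0) (ltW E0).
  have E4 : 0 <= 4 * (80 * E) ^+ 4.
    exact: mulr_ge0 (ler0n R 4) (exprn_ge0 4 (mulr_ge0 (ler0n R 80) (ltW E0))).
  set X := 640 * S * E in SE0 *; set Y := 4 * (80 * E) ^+ 4 in E4 *.
  have t2 : 0 <= (t ^+ 2)^-1 by rewrite invr_ge0 exprn_ge0// ltW.
  have f1 : expR (C / t ^+ g) <= expR (C / t ^+ (g + 4)).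
    by rewrite ler_expR; apply: (ler_wpM2l (ltW C0)); rewrite inv_expn_le// leq_addr.
  have f2 : X <= expR (X / t ^+ (g + 4)).
    apply: (le_trans (le_expR _)); rewrite ler_expR ler_peMr//.
    by rewrite invf_ge1// exprn_ile1// ltW.
  have f3 : (t ^+ 2)^-1 <= expR (1 / t ^+ (g + 4)).
    apply: (le_trans (le_expR _)); rewrite ler_expR mul1r inv_expn_le//.
    by rewrite (leq_trans _ (leq_addl _ _)).
  have f4 : expR (Y / t ^+ 4) <= expR (Y / t ^+ (g + 4)).
    by rewrite ler_expR; apply: ler_wpM2l => //; rewrite inv_expn_le// leq_addl.
  have g1 := ler_pM (expR_ge0 _) SE0 f1 f2.
  have g2 := ler_pM (mulr_ge0 (expR_ge0 _) SE0) t2 g1 f3.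
  exact: ler_pM (mulr_ge0 (mulr_ge0 (expR_ge0 _) SE0) t2) (expR_ge0 _) g2 f4.
- move=> k kN; rewrite -/(z k) -(horner_coef_wide _ sP).
  have -> : P.[z k] = cf k * ((Fp k).[zeta k] * Bp.[z k]).
    rewrite horner_sum (bigD1 (Ordinal kN))//= hornerZ QE big1 ?addr0// => l lk.
    by rewrite hornerZ Q0 ?mulr0//; apply: contraNneq lk => kl; apply/eqP/val_inj.
  rewrite /cf divfK ?mulf_neq0 ?(gt_eqF (B0 _)) -?normr_gt0 ?F0//.
  have bk : bt k != 0 by rewrite -normr_gt0.
  have zk : 1 - z k != 0 by rewrite subr_eq0 gt_eqF.
  by field; rewrite bk zk gt_eqF.
Qed.

End discrete_moments.

(** * Orthonormal bases and diagonal semigroups *)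

Section inner_product.
Context (R : realType) (H : normedModType R) (ip : {dot H for (idfun : R -> R)}).
Hypothesis H_hilbert : norm_of_dot ip.
Implicit Types (x y z : H) (a : R).

Lemma ipC x y : ip x y = ip y x.
Proof. by rewrite hermC expr0 mul1r. Qed.
Lemma ipDl x y z : ip (x + y) z = ip x z + ip y z.
Proof. by rewrite linearDl. Qed.
Lemma ipBl x y z : ip (x - y) z = ip x z - ip y z.
Proof. by rewrite linearBl. Qed.
Lemma ipNl x z : ip (- x) z = - ip x z.
Proof. by rewrite linearNl. Qed.
Lemma ipZl a x z : ip (a *: x) z = a * ip x z.
Proof. by rewrite linearZl_LR. Qed.
Lemma ip0l z : ip 0 z = 0.
Proof. by rewrite linear0l. Qed.
Lemma ip0r z : ip z 0 = 0.
Proof. by rewrite ipC ip0l. Qed.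
Lemma ipBr x y z : ip z (x - y) = ip z x - ip z y.
Proof. by rewrite !(ipC z) ipBl. Qed.
Lemma ipZr a x z : ip z (a *: x) = a * ip z x.
Proof. by rewrite !(ipC z) ipZl. Qed.
Lemma ip_suml (I : Type) (s : seq I) (P : pred I) (f : I -> H) z :
  ip (\sum_(i <- s | P i) f i) z = \sum_(i <- s | P i) ip (f i) z.
Proof.
by elim/big_rec2: _ => [|i y1 y2 Pi <-]; rewrite ?ip0l// ipDl.
Qed.

Lemma ip_norm x : ip x x = `|x| ^+ 2.
Proof. by rewrite H_hilbert. Qed.

Lemma ip_le_norm x y : ip x y <= `|x| * `|y|.
Proof.
have [->|x0] := eqVneq x 0; first by rewrite ip0l normr0 mul0r.
have [->|y0] := eqVneq y 0; first by rewrite ip0r normr0 mulr0.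
have : 0 <= ip (`|y| *: x - `|x| *: y) (`|y| *: x - `|x| *: y).
  by rewrite ip_norm sqr_ge0.
rewrite ipBl !ipBr !ipZl !ipZr !ip_norm (ipC y x) => h.
have xy : 0 < `|x| * `|y| by rewrite mulr_gt0 ?normr_gt0.
by rewrite -(ler_pM2l xy); move: h; nra.
Qed.

Lemma cauchy_schwarz x y : `|ip x y| <= `|x| * `|y|.
Proof.
rewrite ler_norml ip_le_norm andbT lerNl -ipNl.
by apply: le_trans (ip_le_norm _ _) _; rewrite normrN.
Qed.

Lemma cvg_ipl (T : Type) (F : set_system T) {FF : Filter F} (f : T -> H) x y :
  f t @[t --> F] --> x -> ip (f t) y @[t --> F] --> ip x y.
Proof.
move=> /cvgrPdist_lt fx; apply/cvgrPdist_lt => e e0.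
have y0 : 0 < `|y| + 1 by rewrite ltr_wpDl.
have := fx (e / (`|y| + 1)) (divr_gt0 e0 y0); apply: filterS => t ft.
rewrite -ipBl; apply: le_lt_trans (cauchy_schwarz _ _) _.
apply: (@le_lt_trans _ _ (`|x - f t| * (`|y| + 1))).
  by rewrite ler_wpM2l// lerDl.
by rewrite -ltr_pdivlMr.
Qed.

End inner_product.

Section hilbert.
Context (R : realType) (H : completeNormedModType R)
  (ip : {dot H for (idfun : R -> R)}) (phi : nat -> H).
Hypotheses (H_hilbert : norm_of_dot ip) (phi_basis : hilbert_basis ip phi).
Implicit Types (x y : H) (c m : nat -> R).

Definition synth c (n : nat) : H := \sum_(k < n) c k *: phi k.

Lemma ip_synth c n k : ip (synth c n) (phi k) = (k < n)%N%:R * c k.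
Proof.
rewrite ip_suml.
under eq_bigr do rewrite ipZl phi_basis.1.
case: ltnP => kn.
  rewrite (bigD1 (Ordinal kn))//= eqxx mulr1 mul1r big1 ?addr0// => i ik.
  by rewrite (_ : _ == _ = false) ?mulr0//; apply: contraNF ik.
rewrite big1 ?mul0r// => i _.
by rewrite ltn_eqF ?mulr0// (leq_trans (ltn_ord i)).
Qed.

Lemma norm_synth_diff c (p n : nat) : (p <= n)%N ->
  `|synth c n - synth c p| ^+ 2 = \sum_(p <= k < n) c k ^+ 2.
Proof.
move=> pn.
have -> : synth c n - synth c p = \sum_(p <= k < n) c k *: phi k.
  rewrite /synth -!(big_mkord predT (fun k => c k *: phi k)).
  by rewrite (big_cat_nat (n := p))//= addrAC subrr add0r.
rewrite H_hilbert ip_suml big_nat [RHS]big_nat.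
apply: eq_bigr => k /andP[pk kn]; rewrite ipZl ipC ip_suml.
rewrite expr2; congr (_ * _).
rewrite (bigD1_seq k)/= ?mem_index_iota ?pk ?iota_uniq// ipZl phi_basis.1 eqxx mulr1.
by rewrite big1 ?addr0// => i ik; rewrite ipZl phi_basis.1 (negbTE ik) mulr0.
Qed.

Lemma norm_synth c n : `|synth c n| ^+ 2 = \sum_(k < n) c k ^+ 2.
Proof.
have := norm_synth_diff c (leq0n n).
by rewrite /synth big_ord0 subr0 big_mkord.
Qed.

Lemma ip_phi_phi k : `|phi k| = 1.
Proof.
have := H_hilbert (phi k); rewrite phi_basis.1 eqxx => /eqP.
by rewrite sqrf_eq1 => /orP[/eqP//|/eqP h]; have := normr_ge0 (phi k); rewrite h; lra.
Qed.

Lemma coord_inj x y : (forall k, ip x (phi k) = ip y (phi k)) -> x = y.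
Proof.
move=> h; apply/eqP; rewrite -subr_eq0; apply/eqP.
by apply: phi_basis.2 => k; rewrite ipBl h subrr.
Qed.

Lemma riesz_fischer c (C : R) : (forall n, \sum_(k < n) c k ^+ 2 <= C) ->
  exists x, synth c n @[n --> \oo] --> x /\ forall k, ip x (phi k) = c k.
Proof.
move=> hC.
have sc : cvgn (fun n => \sum_(k < n) c k ^+ 2).
  apply: nondecreasing_is_cvgn; last by exists C => _ [n _ <-].
  move=> p q pq; rewrite -!(big_mkord predT (fun k => c k ^+ 2)).
  by rewrite (big_cat_nat (n := p) (p := q))//= lerDl sumr_ge0// => i _; exact: sqr_ge0.
have cv : cvgn (synth c).
  apply/cauchy_cvgP/cauchyP => e e0.
  have e2 : 0 < e ^+ 2 / 2 by rewrite divr_gt0// exprn_gt0.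
  have [n _ hl] := (cvgrPdist_lt _ _).1 sc _ e2.
  have hn p q : (n <= p)%N -> (n <= q)%N -> `|synth c p - synth c q| < e.
    move=> np nq; wlog pq : p q np nq / (p <= q)%N.
      move=> W; case: (leqP p q) => pq; first exact: W.
      by rewrite distrC; apply: W => //; exact: ltnW.
    rewrite distrC -ltr_sqr ?nnegrE// ?ltW// norm_synth_diff//.
    have := hl p np; have := hl q nq; rewrite /=.
    rewrite -!(big_mkord predT (fun k => c k ^+ 2)).
    rewrite [X in `|_ - X| < _ -> _](big_cat_nat (n := p) (p := q))//=.
    rewrite !ltr_norml => /andP[+ _] /andP[_].
    set l := limn _; lra.
  exists (synth c n) => //; exists n => // p /= np.
  by rewrite -ball_normE /ball_/=; apply: hn.
exists (limn (synth c)); split => // k.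
have h1 : ip (synth c n) (phi k) @[n --> \oo] --> ip (limn (synth c)) (phi k).
  exact: cvg_ipl.
apply: (cvg_unique _ h1) => //.
apply: cvg_near_cst; exists k.+1 => // n /= kn.
by rewrite ip_synth kn mul1r.
Qed.

Lemma bessel x n : \sum_(k < n) ip x (phi k) ^+ 2 <= `|x| ^+ 2.
Proof.
set c := fun k => ip x (phi k).
have : 0 <= ip (x - synth c n) (x - synth c n) by rewrite -H_hilbert sqr_ge0.
rewrite ipBl !ipBr -[ip x x]H_hilbert -[ip (synth _ _) (synth _ _)]H_hilbert norm_synth.
rewrite (ipC ip x (synth c n)).
have -> : ip (synth c n) x = \sum_(k < n) c k ^+ 2.
  rewrite ip_suml; apply: eq_bigr => k _; by rewrite ipZl ipC expr2.
lra.
Qed.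

(** Completeness of the system is given as: only [0] is orthogonal to it. Riesz-Fischer provides a
    sum of the series, and it has the coordinates of [x]. *)
Lemma expansion x : synth (fun k => ip x (phi k)) n @[n --> \oo] --> x.
Proof.
have [y [cy hy]] := @riesz_fischer (fun k => ip x (phi k)) _ (bessel x).
by rewrite [X in _ --> X](_ : x = y)//; apply: coord_inj => k; rewrite hy.
Qed.

(** Parseval as a comparison principle; it yields the operator norms of multipliers, the smoothing
    estimate, and bounds on tails where no operator is at hand. *)
Lemma norm_le_coord (C : R) x y : 0 <= C ->
  (forall k, `|ip x (phi k)| <= C * `|ip y (phi k)|) -> `|x| <= C * `|y|.
Proof.
move=> C0 h.
have cx : `|synth (fun k => ip x (phi k)) n| @[n --> \oo] --> `|x|.
  by apply: cvg_norm; exact: expansion.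
rewrite -(cvg_lim _ cx)//; apply: limr_le; first by apply/cvg_ex; exists `|x|.
near=> n.
rewrite -ler_sqr ?nnegrE ?mulr_ge0// norm_synth exprMn.
apply: (@le_trans _ _ (C ^+ 2 * \sum_(k < n) ip y (phi k) ^+ 2)).
  rewrite mulr_sumr; apply: ler_sum => k _.
  rewrite -exprMn -real_normK ?num_real// -[leRHS]real_normK ?num_real//.
  by rewrite lerXn2r ?nnegrE// normrM (ger0_norm C0).
by rewrite ler_wpM2l ?sqr_ge0// bessel.
Unshelve. all: by end_near. Qed.

Definition tailproj (n : nat) x := x - synth (fun k => ip x (phi k)) n.

Lemma cvg_tailproj x : tailproj n x @[n --> \oo] --> 0.
Proof.
rewrite -[X in _ --> X](subrr x); apply: cvgB; first exact: cvg_cst.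
exact: expansion.
Qed.

Lemma ip_tailproj n x k : ip (tailproj n x) (phi k) = (n <= k)%N%:R * ip x (phi k).
Proof.
rewrite ipBl ip_synth; case: ltnP; rewrite ?mul1r ?mul0r ?subr0 ?subrr//.
Qed.

Lemma series_synth c : series (fun k => c k *: phi k) = synth c.
Proof. by apply/funext => n; rewrite /series/= big_mkord. Qed.

Lemma multiplier_sum c (C : R) x : (forall k, `|c k| <= C) ->
  forall n, \sum_(k < n) (c k * ip x (phi k)) ^+ 2 <= C ^+ 2 * `|x| ^+ 2.
Proof.
move=> hC n.
apply: (@le_trans _ _ (C ^+ 2 * \sum_(k < n) ip x (phi k) ^+ 2)); last first.
  by rewrite ler_wpM2l ?sqr_ge0// bessel.
rewrite mulr_sumr; apply: ler_sum => k _.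
rewrite exprMn ler_wpM2r ?sqr_ge0// -[leLHS]real_normK ?num_real//.
by rewrite lerXn2r ?nnegrE// (le_trans _ (hC k)).
Qed.

Lemma bounded_multiplier m (C : R) x : (forall k, `|m k| <= C) ->
  exists y, forall k, ip y (phi k) = m k * ip x (phi k).
Proof.
move=> hC; have [y [_ hy]] := @riesz_fischer (fun k => m k * ip x (phi k)) _ (multiplier_sum x hC).
by exists y.
Qed.

End hilbert.

(** The hypotheses stand under the existential, so that choice gives an operation defined for all
    arguments and carrying no proofs. *)
Lemma multiplier_ex (R : realType) (H : completeNormedModType R)
    (ip : {dot H for (idfun : R -> R)}) (phi : nat -> H) (m : nat -> R) (x : H) :
  exists y, norm_of_dot ip -> hilbert_basis ip phi ->
    (exists C, forall k, `|m k| <= C) ->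
    forall k, ip y (phi k) = m k * ip x (phi k).
Proof.
have [[Hh [Hb [C hC]]]|h] := pselect (norm_of_dot ip /\ hilbert_basis ip phi /\
    exists C, forall k, `|m k| <= C).
  by have [y hy] := bounded_multiplier Hh Hb x hC; exists y.
by exists 0 => Hh Hb hC; exfalso; apply: h.
Qed.

(* Characterized by its coordinates; a junk value when [m] is unbounded. *)
Definition multiplier (R : realType) (H : completeNormedModType R)
    (ip : {dot H for (idfun : R -> R)}) (phi : nat -> H) (m : nat -> R) (x : H) : H :=
  sval (cid (multiplier_ex ip phi m x)).

Section multiplier_theory.
Context (R : realType) (H : completeNormedModType R)
  (ip : {dot H for (idfun : R -> R)}) (phi : nat -> H).
Hypotheses (H_hilbert : norm_of_dot ip) (phi_basis : hilbert_basis ip phi).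
Implicit Types (x y : H) (m : nat -> R).
Local Notation multiplier := (multiplier ip phi).

Lemma ip_multiplier m (C : R) x k : (forall k, `|m k| <= C) ->
  ip (multiplier m x) (phi k) = m k * ip x (phi k).
Proof.
by move=> hC; apply: (svalP (cid (multiplier_ex ip phi m x))) => //; exists C.
Qed.

Lemma norm_multiplier m (C : R) x : (forall k, `|m k| <= C) ->
  `|multiplier m x| <= C * `|x|.
Proof.
move=> hC; apply: (norm_le_coord H_hilbert phi_basis); first exact: le_trans (hC 0%N).
by move=> k; rewrite (ip_multiplier _ _ hC) normrM ler_wpM2r.
Qed.

(** Dominated convergence on coordinates: the bound 1 controls a tail of [x] uniformly in [t], and
    the remaining head is a finite sum. *)
Lemma cvg_multiplier0 (T : Type) (F : set_system T) {FF : ProperFilter F}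
    (m : T -> nat -> R) x :
  (\forall t \near F, forall k, `|m t k| <= 1) ->
  (forall k, m t k @[t --> F] --> 0) ->
  multiplier (m t) x @[t --> F] --> 0.
Proof.
move=> m1 m0; apply/cvgrPdist_lt => e e0.
have e2 : 0 < e / 2 by rewrite divr_gt0.
have [n _ hn] := (cvgrPdist_lt _ _).1 (@cvg_tailproj _ _ _ _ H_hilbert phi_basis x) _ e2.
have {}hn : `|tailproj ip phi n x| < e / 2 by rewrite -normrN -sub0r hn /=.
have cs : \sum_(k < n) (m t k * ip x (phi k)) *: phi k @[t --> F] --> (0 : H).
  rewrite [X in _ --> X](_ : 0 = \sum_(k < n) (0 * ip x (phi k)) *: phi k); last first.
    by rewrite big1// => k _; rewrite mul0r scale0r.
  elim: n {hn} => [|n IH].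
    by under eq_cvg do rewrite big_ord0; rewrite big_ord0; exact: cvg_cst.
  under eq_cvg do rewrite big_ord_recr/=; rewrite big_ord_recr/=.
  apply: cvgD; first exact: IH.
  apply: cvgZr_tmp; apply: cvgM; [exact: m0|exact: cvg_cst].
have hs := (cvgrPdist_lt _ _).1 cs _ e2.
near=> t.
have mt : forall k, `|m t k| <= 1 by near: t.
have ht : `|\sum_(k < n) (m t k * ip x (phi k)) *: phi k| < e / 2.
  rewrite -normrN -[X in `|X|]sub0r; near: t; exact: hs.
have -> : multiplier (m t) x = multiplier (m t) (tailproj ip phi n x) +
    \sum_(k < n) (m t k * ip x (phi k)) *: phi k.
  apply: (coord_inj phi_basis) => k; rewrite ipDl !(ip_multiplier _ _ mt) (ip_tailproj phi_basis).
  rewrite -/(synth phi (fun k => m t k * ip x (phi k)) n) (ip_synth phi_basis).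
  by case: (ltnP k n) => _; rewrite ?mul1r ?mul0r ?mulr0 ?addr0 ?add0r.
rewrite sub0r normrN; apply: le_lt_trans (ler_normD _ _) _.
have := norm_multiplier (tailproj ip phi n x) mt; lra.
Unshelve. all: by end_near. Qed.

End multiplier_theory.

Section diagonal_semigroup.
Context (R : realType) (H : completeNormedModType R)
  (ip : {dot H for (idfun : R -> R)}) (phi : nat -> H) (mu : nat -> R).
Hypotheses (H_hilbert : norm_of_dot ip) (phi_basis : hilbert_basis ip phi)
  (mu_ge1 : forall k, 1 <= mu k).
Implicit Types (x y : H) (t : R).

Let mu_gt0 k : 0 < mu k. Proof. by apply: lt_le_trans (mu_ge1 k). Qed.

Definition heat t : H -> H := multiplier ip phi (fun k => expR (- (mu k * t))).

Lemma heat_weight t k : 0 <= t -> `|expR (- (mu k * t))| <= 1.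
Proof.
move=> t0; rewrite ger0_norm ?expR_ge0// expR_le1 oppr_le0 mulr_ge0//.
exact: ltW.
Qed.

Lemma ip_heat t x k : 0 <= t ->
  ip (heat t x) (phi k) = expR (- (mu k * t)) * ip x (phi k).
Proof.
move=> t0; apply: (@ip_multiplier _ _ _ _ H_hilbert phi_basis _ 1) => l.
exact: heat_weight.
Qed.

Lemma norm_heat t x : 0 <= t -> `|heat t x| <= `|x|.
Proof.
move=> t0; rewrite -[leRHS]mul1r.
apply: (norm_multiplier H_hilbert phi_basis) => l; exact: heat_weight.
Qed.

Lemma heat_linear t : 0 <= t -> linear (heat t).
Proof.
move=> t0 a x y; apply: (coord_inj phi_basis) => k.
by rewrite ip_heat// !ipDl !ipZl !ip_heat//; ring.
Qed.

Lemma heatB t x y : 0 <= t -> heat t (x - y) = heat t x - heat t y.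
Proof.
move=> t0; apply: (coord_inj phi_basis) => k.
by rewrite ip_heat// !ipBl !ip_heat//; ring.
Qed.

Lemma heatD t x y : 0 <= t -> heat t (x + y) = heat t x + heat t y.
Proof.
move=> t0; apply: (coord_inj phi_basis) => k.
by rewrite ip_heat// !ipDl !ip_heat//; ring.
Qed.

Lemma heat0 x : heat 0 x = x.
Proof.
by apply: (coord_inj phi_basis) => k; rewrite ip_heat// mulr0 oppr0 expR0 mul1r.
Qed.

Lemma heat_add s t x : 0 <= s -> 0 <= t -> heat (s + t) x = heat s (heat t x).
Proof.
move=> s0 t0; apply: (coord_inj phi_basis) => k.
by rewrite !ip_heat ?addr_ge0// mulrA -expRD; congr (expR _ * _); ring.
Qed.

Lemma heat_phi t k : 0 <= t -> heat t (phi k) = expR (- mu k * t) *: phi k.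
Proof.
move=> t0; apply: (coord_inj phi_basis) => l.
rewrite ip_heat// ipZl phi_basis.1 mulNr.
by case: eqVneq => [->//|_]; rewrite !mulr0.
Qed.

(* [lam d exp (- lam s) <= d / s] for every [lam > 0]. *)
Lemma heat_smoothing d s x : 0 <= d -> 0 < s ->
  `|heat (s + d) x - heat s x| <= d / s * `|x|.
Proof.
move=> d0 s0; apply: (norm_le_coord H_hilbert phi_basis).
  by rewrite divr_ge0// ltW.
move=> k; rewrite ipBl !ip_heat ?addr_ge0 ?(ltW s0)// -mulrBl normrM ler_wpM2r//.
rewrite distrC mulrDr opprD expRD -[X in X - _]mulr1 -mulrBr normrM.
rewrite (ger0_norm (expR_ge0 _)) ger0_norm; last first.
  by rewrite subr_ge0 expR_le1 oppr_le0 mulr_ge0// ltW.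
have h1 : 1 - expR (- (mu k * d)) <= mu k * d.
  by have := expR_ge1Dx (- (mu k * d)); lra.
apply: (le_trans (ler_wpM2l (expR_ge0 _) h1)).
rewrite ler_pdivlMr//.
have -> : expR (- (mu k * s)) * (mu k * d) * s = d * (mu k * s * expR (- (mu k * s))).
  by ring.
rewrite ler_piMr// expRN ler_pdivrMr ?expR_gt0// mul1r.
by apply: le_trans (expR_ge1Dx _); rewrite lerDr.
Qed.

Lemma cvg_heat x : heat t x @[t --> 0^'+] --> x.
Proof.
have m1 : \forall t \near (0 : R)^'+, forall k, `|expR (- (mu k * t)) - 1| <= 1.
  near=> t => k; have t0 : 0 < t by near: t; exact: nbhs_right_gt.
  rewrite distrC ger0_norm; last by rewrite subr_ge0 expR_le1 oppr_le0 mulr_ge0// ltW.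
  by rewrite gerBl expR_ge0.
have m0 k : expR (- (mu k * t)) - 1 @[t --> (0 : R)^'+] --> (0 : R).
  have -> : (fun t : R => expR (- (mu k * t)) - 1) =
      (fun t => (- t) * ((1 - expR (- (mu k * t))) / t)).
    apply/funext => t; have [->|t0] := eqVneq t 0.
      by rewrite mulr0 oppr0 expR0 subrr mul0r.
    by field.
  rewrite [X in _ --> X](_ : 0 = - 0 * mu k); last by rewrite oppr0 mul0r.
  apply: cvgM; last exact: (cvg_one_sub_expR (mu_gt0 k)).
  by apply: cvgN; apply: cvg_at_right_filter; exact: cvg_id.
have h : multiplier ip phi (fun k => expR (- (mu k * t)) - 1) x @[t --> 0^'+] --> (0 : H).
  exact: cvg_multiplier0.
rewrite -[X in _ --> X](add0r x).
apply: cvg_trans (cvgD h (cvg_cst x)).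
apply: near_eq_cvg; near=> t.
have t0 : 0 <= t by near: t; exact: nbhs_right_ge.
have mt : forall k, `|expR (- (mu k * t)) - 1| <= 1 by near: t.
apply: (coord_inj phi_basis) => k.
rewrite ipDl (ip_multiplier H_hilbert phi_basis _ _ mt) ip_heat//; ring.
Unshelve. all: by end_near. Qed.

Lemma heat_C0_semigroup : C0_semigroup heat.
Proof.
split.
- move=> t t0; split; first exact: heat_linear.
  by exists 1 => x; rewrite mul1r norm_heat.
- exact: heat0.
- by move=> *; exact: heat_add.
- exact: cvg_heat.
Qed.

(** On the domain, with [y = A x], the difference quotient is [- y] plus a multiplier of [y] whose
    symbol [m h] is bounded by 1 and tends to 0. Conversely, a limit of the quotients has
    coordinates [- mu_k x_k], and Bessel's inequality puts [x] in the domain. *)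
Lemma heat_exp_opp_semigroup :
  exp_opp_semigroup (diagonal_operator ip phi mu) heat.
Proof.
have sumP x : dom (diagonal_operator ip phi mu) x -> exists C : R,
    forall n, \sum_(k < n) (mu k * ip x (phi k)) ^+ 2 <= C.
  move=> /= hx; pose u k := `|mu k * ip x (phi k)| ^+ 2.
  have := nnseries_is_cvg (u := u) (fun k => sqr_ge0 _) hx.
  move=> cu; exists (limn (series u)) => n.
  have -> : \sum_(k < n) (mu k * ip x (phi k)) ^+ 2 = series u n.
    rewrite /series/= big_mkord; apply: eq_bigr => k _.
    by rewrite /u real_normK ?num_real.
  apply: nondecreasing_cvgn_le => // p q pq.
  rewrite /series/= (big_cat_nat (n := p) (p := q))//= lerDl sumr_ge0// => i _.
  exact: sqr_ge0.
have domP x : dom (diagonal_operator ip phi mu) x ->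
    h^-1 *: (heat h x - x) @[h --> 0^'+] --> - op (diagonal_operator ip phi mu) x.
  move=> /sumP[C hC].
  have [y [cy hy]] := @riesz_fischer R H ip phi H_hilbert phi_basis
    (fun k => mu k * ip x (phi k)) C hC.
  have -> : op (diagonal_operator ip phi mu) x = y.
    by rewrite /= series_synth (cvg_lim _ cy).
  pose m h k := 1 - (1 - expR (- (mu k * h))) / (mu k * h).
  have m1 : \forall h \near (0 : R)^'+, forall k, `|m h k| <= 1.
    near=> h => k; have h0 : 0 < h by near: h; exact: nbhs_right_gt.
    have mh : 0 < mu k * h by rewrite mulr_gt0.
    have e1 := expR_ge1Dx (- (mu k * h)).
    have e2 : expR (- (mu k * h)) <= 1 by rewrite expR_le1 oppr_le0 ltW.
    have f1 : (1 - expR (- (mu k * h))) / (mu k * h) <= 1.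
      by rewrite ler_pdivrMr// mul1r; lra.
    have f2 : 0 <= (1 - expR (- (mu k * h))) / (mu k * h).
      by rewrite divr_ge0 ?subr_ge0// ltW.
    by rewrite /m ger0_norm; lra.
  have m0 k : m h k @[h --> (0 : R)^'+] --> (0 : R).
    have -> : (fun h => m h k) = (fun h => 1 - (mu k)^-1 * ((1 - expR (- (mu k * h))) / h)).
      by apply/funext => h; rewrite /m invfM; ring.
    rewrite [X in _ --> X](_ : 0 = 1 - (mu k)^-1 * mu k); last first.
      by rewrite mulVf ?subrr// gt_eqF.
    apply: cvgB; first exact: cvg_cst.
    by apply: cvgM; [exact: cvg_cst|exact: (cvg_one_sub_expR (mu_gt0 k))].
  have hc : multiplier ip phi (m h) y @[h --> 0^'+] --> (0 : H).
    exact: cvg_multiplier0.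
  rewrite -[X in _ --> X](add0r (- y)).
  apply: cvg_trans (cvgD hc (cvg_cst (- y))).
  apply: near_eq_cvg; near=> h.
  have h0 : 0 < h by near: h; exact: nbhs_right_gt.
  have mh : forall k, `|m h k| <= 1 by near: h.
  apply: (coord_inj phi_basis) => k.
  rewrite ipBl (ip_multiplier H_hilbert phi_basis _ _ mh) hy ipZl ipBl ip_heat ?ltW//.
  by rewrite /m; field; rewrite !gt_eqF.
split; first exact: heat_C0_semigroup.
- apply/seteqP; split => x /=.
    move=> /cvg_ex[y hy].
    have yk k : ip y (phi k) = - (mu k * ip x (phi k)).
      have h1 : ip (h^-1 *: (heat h x - x)) (phi k) @[h --> 0^'+] --> ip y (phi k).
        exact: cvg_ipl.
      have h2 : - ((1 - expR (- (mu k * h))) / h * ip x (phi k)) @[h --> 0^'+] -->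
          - (mu k * ip x (phi k)).
        apply: cvgN; apply: cvgM; last exact: cvg_cst.
        exact: (cvg_one_sub_expR (mu_gt0 k)).
      apply: (cvg_unique _ h1) => //.
      apply: cvg_trans h2; apply: near_eq_cvg; near=> h.
      have h0 : 0 < h by near: h; exact: nbhs_right_gt.
      by rewrite ipZl ipBl ip_heat ?ltW//; field; rewrite gt_eqF.
    apply: (@le_lt_trans _ _ (`|y| ^+ 2)%:E); last exact: ltry.
    apply: lime_le.
      by apply: is_cvg_nneseries => k _ _; rewrite lee_fin sqr_ge0.
    apply: nearW => n; rewrite sumEFin lee_fin big_mkord.
    apply: le_trans (bessel H_hilbert phi_basis y n).
    apply: ler_sum => k _; rewrite yk sqrrN real_normK ?num_real//.
  by move=> /domP h; apply/cvg_ex; eexists; exact: h.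
- by move=> x /domP h; apply: cvg_lim.
Unshelve. all: by end_near. Qed.

End diagonal_semigroup.

(** * Bochner integrals of uniform limits of simple functions *)

Section simple_approximation.
Context (R : realType) (H : completeNormedModType R).
Implicit Types (D : set R) (f g : R -> H).

Definition is_simple g := exists n (E : 'I_n -> set R) (c : 'I_n -> H),
  (forall i, measurable (E i)) /\ g = simple_function E c.

(** A substitute for Bochner measurability: the class contains what the controls and trajectories
    produce, is stable under sums, uniform limits and strongly regular operator families, and
    consists of bounded functions, integrable when [D] is measurable of finite measure. *)
Definition usimple D f := forall e : R, 0 < e -> exists2 g, is_simple g &
  forall s, D s -> `|f s - g s| <= e.

Lemma is_simple0 : is_simple (fun=> 0).
Proof.
exists 0%N, (fun=> set0), (fun=> 0); split; first by case.
by apply/funext => s; rewrite /simple_function big_ord0.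
Qed.

Lemma is_simpleD f g : is_simple f -> is_simple g ->
  is_simple (fun s => f s + g s).
Proof.
move=> [n [E [c [mE ->]]]] [p [F [d [mF ->]]]].
exists (n + p)%N,
  (fun i => match fintype.split i with inl j => E j | inr j => F j end),
  (fun i => match fintype.split i with inl j => c j | inr j => d j end); split.
  by move=> i; case: fintype.split.
apply/funext => s; rewrite /simple_function big_split_ord/=; congr (_ + _).
  by apply: eq_bigr => i _; rewrite (unsplitK (inl i : 'I_n + 'I_p)).
by apply: eq_bigr => i _; rewrite (unsplitK (inr i : 'I_n + 'I_p)).
Qed.

Lemma is_simple_sum (n : nat) (f : 'I_n -> R -> H) :
  (forall i, is_simple (f i)) -> is_simple (fun s => \sum_(i < n) f i s).
Proof.
elim: n f => [|n IH] f hf.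
  by under eq_fun do rewrite big_ord0; exact: is_simple0.
under eq_fun do rewrite big_ord_recr/=.
by apply: is_simpleD => //; apply: IH => i.
Qed.

Lemma is_simple_restrict (A : set R) f : measurable A -> is_simple f ->
  is_simple (fun s => \1_A s *: f s).
Proof.
move=> mA [n [E [c [mE ->]]]].
exists n, (fun i => A `&` E i), c; split; first by move=> i; exact: measurableI.
apply/funext => s; rewrite /simple_function scaler_sumr; apply: eq_bigr => i _.
by rewrite scalerA indicI.
Qed.

Lemma usimple_simple D g : is_simple g -> usimple D g.
Proof. by move=> sg e e0; exists g => // s _; rewrite subrr normr0 ltW. Qed.

Lemma usimple_sub D D' f : D `<=` D' -> usimple D' f -> usimple D f.
Proof. by move=> DD' uf e /uf[g sg hg]; exists g => // s /DD'; exact: hg. Qed.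

Lemma usimple_ext D f g : (forall s, D s -> f s = g s) -> usimple D f -> usimple D g.
Proof.
by move=> fg uf e /uf[h sh hh]; exists h => // s Ds; rewrite -fg// hh.
Qed.

Lemma usimpleD D f g : usimple D f -> usimple D g -> usimple D (fun s => f s + g s).
Proof.
move=> uf ug e e0; have e2 : 0 < e / 2 by rewrite divr_gt0.
have [f' sf hf] := uf _ e2; have [g' sg hg] := ug _ e2.
exists (fun s => f' s + g' s); first exact: is_simpleD.
move=> s Ds; rewrite opprD addrACA; apply: le_trans (ler_normD _ _) _.
by have := hf s Ds; have := hg s Ds; lra.
Qed.

Lemma simple_bounded g : is_simple g -> exists2 C : R, 0 <= C & forall s, `|g s| <= C.
Proof.
move=> [n [E [c [mE ->]]]]; exists (\sum_(i < n) `|c i|); first exact: sumr_ge0.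
move=> s; apply: le_trans (ler_norm_sum _ _ _) _; apply: ler_sum => i _.
rewrite normrZ indicE; case: (_ \in _); rewrite ?normr1 ?normr0 ?mul1r ?mul0r//.
Qed.

Lemma usimple_bounded D f : usimple D f ->
  exists2 C : R, 0 <= C & forall s, D s -> `|f s| <= C.
Proof.
move=> /(_ 1 ltr01)[g /simple_bounded[C C0 hC] hg].
exists (1 + C); first by rewrite addr_ge0.
move=> s Ds; rewrite -(subrK (g s) (f s)); apply: le_trans (ler_normD _ _) _.
by apply: lerD; [exact: hg|exact: hC].
Qed.

(** Regularity of [F] on each fixed vector suffices: on a simple [g], [F s (g s)] is a finite sum of
    such functions cut by indicators, and the uniform bound [K] controls the error. It serves both
    for [S (t - s)] and for [v s *: B]. *)
Lemma usimple_family D f (F : R -> H -> H) (K : R) : 0 <= K ->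
  (forall s, D s -> linear (F s)) -> (forall s x, D s -> `|F s x| <= K * `|x|) ->
  (forall c, usimple D (fun s => F s c)) -> usimple D f ->
  usimple D (fun s => F s (f s)).
Proof.
move=> K0 linF bF uF uf e e0.
have K1 : 0 < 2 * (K + 1) by rewrite mulr_gt0// ltr_wpDl.
have [g [n [E [c [mE gE]]]] hg] := uf (e / (2 * (K + 1))) (divr_gt0 e0 K1).
have n1 : 0 < 2 * n.+1%:R :> R by rewrite mulr_gt0// ltr0n.
have /choice[h hh] : forall i : 'I_n, exists h : R -> H, is_simple h /\
    forall s, D s -> `|F s (c i) - h s| <= e / (2 * n.+1%:R).
  by move=> i; have [h sh hh] := uF (c i) _ (divr_gt0 e0 n1); exists h.
exists (fun s => \sum_(i < n) \1_(E i) s *: h i s).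
  apply: is_simple_sum => i; apply: is_simple_restrict => //.
  by have [] := hh i.
move=> s Ds.
have [H1 H2] : (F s (f s) - F s (g s) = F s (f s - g s)) /\
    (F s (g s) = \sum_(i < n) \1_(E i) s *: F s (c i)).
  have lD x y : F s (x + y) = F s x + F s y.
    by have := linF s Ds 1 x y; rewrite !scale1r.
  have l0 : F s 0 = 0 by have /esym/eqP := lD 0 0; rewrite addr0 -subr_eq0 addrK => /eqP.
  have lZ a x : F s (a *: x) = a *: F s x.
    by have := linF s Ds a x 0; rewrite !addr0 l0 addr0.
  split; first by rewrite -[- g s]scaleN1r lD lZ scaleN1r.
  rewrite gE /simple_function.
  by elim/big_rec2: _ => // i y1 y2 _ <-; rewrite lD lZ.
rewrite -(subrK (F s (g s)) (F s (f s))) H1 -addrA.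
apply: le_trans (ler_normD _ _) _.
have a1 : `|F s (f s - g s)| <= e / 2.
  apply: (le_trans (bF _ _ Ds)).
  apply: (@le_trans _ _ (K * (e / (2 * (K + 1))))); first by rewrite ler_wpM2l// hg.
  have -> : K * (e / (2 * (K + 1))) = e / 2 * (K / (K + 1)).
    by field; rewrite gt_eqF// ltr_wpDl.
  rewrite ler_piMr ?divr_ge0 ?(ltW e0)// ler_pdivrMr ?mul1r ?ltr_wpDl//.
  by rewrite lerDl.
have a2 : `|F s (g s) - \sum_(i < n) \1_(E i) s *: h i s| <= e / 2.
  rewrite H2 -sumrB; apply: le_trans (ler_norm_sum _ _ _) _.
  apply: (@le_trans _ _ (\sum_(i < n) e / (2 * n.+1%:R))).
    apply: ler_sum => i _; rewrite -scalerBr normrZ.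
    apply: (@le_trans _ _ (1 * `|F s (c i) - h i s|)).
      rewrite ler_wpM2r// indicE; case: (_ \in _); rewrite ?normr1 ?normr0//.
    by rewrite mul1r; have [_] := hh i; exact.
  rewrite sumr_const card_ord -[_ *+ n]mulr_natl.
  have -> : n%:R * (e / (2 * n.+1%:R)) = e / 2 * (n%:R / n.+1%:R).
    have : n.+1%:R != 0 :> R by rewrite pnatr_eq0.
    by set N := n.+1%:R => N0; field.
  by rewrite ler_piMr ?divr_ge0 ?(ltW e0)// ler_pdivrMr ?ltr0n// mul1r ler_nat.
lra.
Qed.

(** A modulus on all of [[0, T]] at once: it gives step approximations directly and passes to
    uniform limits, with no appeal to compactness. *)
Definition ucont (T : R) f := forall e : R, 0 < e -> exists2 d : R, 0 < d &
  forall s t, 0 <= s <= T -> 0 <= t <= T -> `|s - t| < d -> `|f s - f t| <= e.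

Lemma ucont_usimple (T : R) f : ucont T f -> usimple `]0, T[ f.
Proof.
move=> uf e e0; have [d d0 hd] := uf e e0.
have [T0|T0] := leP T 0.
  exists (fun=> 0); first exact: is_simple0.
  by move=> s /=; rewrite in_itv/= => /andP[s0 sT]; lra.
pose n := (Num.truncn (T / d)).+1.
have n0 : 0 < n%:R :> R by rewrite ltr0n.
have Tn : T / n%:R < d.
  have /andP[_ h] := truncn_itv (ltW (divr_gt0 T0 d0)).
  by rewrite ltr_pdivrMr// mulrC -ltr_pdivrMr.
pose E (i : 'I_n) : set R := `[i%:R * (T / n%:R), i.+1%:R * (T / n%:R)[%classic.
exists (fun s => \sum_(i < n) \1_(E i) s *: f (i%:R * (T / n%:R))).
  by exists n, E, (fun i : 'I_n => f (i%:R * (T / n%:R))); split => // i; exact: measurable_itv.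
move=> s; rewrite /= in_itv/= => /andP[s0 sT].
have Tn0 : 0 < T / n%:R by rewrite divr_gt0.
have /andP[k1 k2] := truncn_itv (ltW (divr_gt0 s0 Tn0)).
set k := Num.truncn _ in k1 k2.
rewrite ler_pdivlMr// in k1; rewrite ltr_pdivrMr// in k2.
have kn : (k < n)%N.
  rewrite -(ltr_nat R) -(ltr_pM2r Tn0); apply: (le_lt_trans k1).
  by rewrite mulrC divfK ?gt_eqF.
have Es (i : 'I_n) : \1_(E i) s = (i == Ordinal kn)%:R :> R.
  rewrite indicE; suff -> : (s \in E i) = (i == Ordinal kn) by [].
  apply/idP/idP; last first.
    by move=> /eqP ->; rewrite inE /E /= in_itv/= k1 k2.
  rewrite inE /E /= in_itv/= => /andP[i1 i2].
  rewrite -val_eqE/= eqn_leq.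
  have h1 : (i < k.+1)%N by rewrite -(ltr_nat R) -(ltr_pM2r Tn0) (le_lt_trans i1).
  have h2 : (k < i.+1)%N by rewrite -(ltr_nat R) -(ltr_pM2r Tn0) (le_lt_trans k1).
  by rewrite -ltnS h1 -ltnS h2.
rewrite (bigD1 (Ordinal kn))//= Es eqxx scale1r big1 ?addr0; last first.
  by move=> i /negbTE ik; rewrite Es ik scale0r.
have k0 : 0 <= k%:R * (T / n%:R) by rewrite mulr_ge0// ltW.
apply: hd; [by rewrite (ltW s0) (ltW sT)|by rewrite k0/=; lra|].
rewrite ger0_norm ?subr_ge0//; apply: le_lt_trans Tn.
by move: k2; rewrite -natr1 mulrDl mul1r; lra.
Qed.

End simple_approximation.

Section bochner.
Context (R : realType) (H : completeNormedModType R)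
  (ip : {dot H for (idfun : R -> R)}).
Hypothesis H_hilbert : norm_of_dot ip.
Local Notation leb := (@lebesgue_measure R).
Implicit Types (D : set R) (f g : R -> H).

Lemma is_simpleN g : is_simple g -> is_simple (fun s => - g s).
Proof.
move=> [n [E [c [mE ->]]]]; exists n, E, (fun i => - c i); split => //.
apply/funext => s; rewrite /simple_function -sumrN.
by apply: eq_bigr => i _; rewrite scalerN.
Qed.

Lemma measurable_indicR D (A : set R) : measurable A ->
  measurable_fun D (\1_A : R -> R).
Proof. by move=> mA; exact: measurable_indic. Qed.

(** The norm is not additive, hence the shift [w]: removing one indicator leaves two shorter sums,
    shifted by [w + c] on its set and by [w] off it. *)
Lemma measurable_norm_simple D w g : is_simple g ->
  measurable_fun D (fun s => `|w + g s|).
Proof.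
move=> [n [E [c [mE ->]]]]; rewrite /simple_function.
elim: n E c mE w => [|n IH] E c mE w.
  by under eq_fun do rewrite big_ord0; exact: measurable_cst.
pose h w' s := `|w' + \sum_(i < n) \1_(E (widen_ord (leqnSn n) i)) s *: c (widen_ord (leqnSn n) i)|.
have -> : (fun s => `|w + \sum_(i < n.+1) \1_(E i) s *: c i|) =
    (fun s => \1_(E ord_max) s * h (w + c ord_max) s +
      (1 - \1_(E ord_max) s) * h w s).
  apply/funext => s; rewrite big_ord_recr/= /h indicE.
  case: (_ \in _); rewrite ?mul1r ?mul0r ?subrr ?subr0 ?mul0r ?mul1r ?addr0 ?add0r.
    by rewrite scale1r addrA addrAC.
  by rewrite scale0r addr0.
apply: measurable_funD; apply: measurable_funM.
- exact: measurable_indicR.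
- exact: IH.
- by apply: measurable_funB; [exact: measurable_cst|exact: measurable_indicR].
- exact: IH.
Qed.

Lemma measurable_ip_simple D g y : is_simple g ->
  measurable_fun D (fun s => ip (g s) y).
Proof.
move=> [n [E [c [mE ->]]]].
under eq_fun do rewrite /simple_function ip_suml.
apply: measurable_sum => i; under eq_fun do rewrite ipZl.
by apply: measurable_funM; [exact: measurable_indicR|exact: measurable_cst].
Qed.

Lemma usimple_seq D f : usimple D f -> exists G : nat -> R -> H,
  (forall q, is_simple (G q)) /\
  forall q s, D s -> `|f s - G q s| <= q.+1%:R^-1.
Proof.
move=> uf.
have /choice[G hG] : forall q : nat, exists g, is_simple g /\
    forall s, D s -> `|f s - g s| <= q.+1%:R^-1.
  by move=> q; have [g sg hg] := uf q.+1%:R^-1 ltac:(by rewrite invr_gt0 ltr0n); exists g.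
by exists G; split => q; have [] := hG q.
Qed.

Lemma cvg_inv_seq (V : normedModType R) (u : nat -> V) (l : V) (C : R) :
  (forall q, `|l - u q| <= C * q.+1%:R^-1) -> u q @[q --> \oo] --> l.
Proof.
move=> h; apply/cvgrPdist_le => e e0.
have c : C * q.+1%:R^-1 @[q --> \oo] --> (0 : R).
  rewrite -[X in _ --> X](mulr0 C); apply: cvgM; first exact: cvg_cst.
  exact: cvg_harmonic.
have [N _ hN] := (cvgrPdist_le _ _).1 c _ e0; exists N => // q /hN.
rewrite /= sub0r normrN => hq; apply: (le_trans (h q)).
by apply: le_trans hq; exact: ler_norm.
Qed.

Lemma usimple_measurable_norm D f g : usimple D f -> is_simple g ->
  measurable_fun D (fun s => `|f s - g s|).
Proof.
move=> /usimple_seq[G [sG hG]] sg.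
apply: (@measurable_fun_cvg _ _ _ _ (fun q s => `|G q s - g s|)).
  move=> q; have := @measurable_norm_simple D 0 (fun s => G q s + - g s)
    (is_simpleD (sG q) (is_simpleN sg)).
  by under eq_fun do rewrite add0r.
move=> s Ds; apply: cvg_norm; apply: cvgB; last exact: cvg_cst.
by apply: (@cvg_inv_seq _ _ _ 1) => q; rewrite mul1r hG.
Qed.

Lemma usimple_measurable_ip D f y : usimple D f ->
  measurable_fun D (fun s => ip (f s) y).
Proof.
move=> /usimple_seq[G [sG hG]].
apply: (@measurable_fun_cvg _ _ _ _ (fun q s => ip (G q s) y)).
  by move=> q; exact: measurable_ip_simple.
move=> s Ds; apply: cvg_ipl => //.
by apply: (@cvg_inv_seq _ _ _ 1) => q; rewrite mul1r hG.
Qed.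

Lemma usimple_integrable_ip D f y : measurable D -> (leb D < +oo)%E ->
  usimple D f -> leb.-integrable D (EFin \o (fun s => ip (f s) y)).
Proof.
move=> mD fD uf; apply: measurable_bounded_integrable => //.
  exact: usimple_measurable_ip.
have [C C0 hC] := usimple_bounded uf.
exists (C * `|y|); split; first exact: num_real.
move=> M hM s Ds; apply: le_trans (ltW hM).
by apply: (le_trans (cauchy_schwarz H_hilbert _ _)); rewrite ler_wpM2r// hC.
Qed.

Lemma Rintegral_bound D (h : R -> R) (C : R) : measurable D -> (leb D < +oo)%E ->
  measurable_fun D h -> (forall s, D s -> `|h s| <= C) ->
  `|\int[leb]_(s in D) h s| <= C * fine (leb D).
Proof.
move=> mD fD mh hC.
have ih : leb.-integrable D (EFin \o h).
  apply: measurable_bounded_integrable => //.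
  exists C; split; first exact: num_real.
  by move=> M hM s Ds; apply: le_trans (ltW hM); exact: hC.
apply: (le_trans (@le_normr_Rintegral _ _ _ leb D h mD ih)).
rewrite -Rintegral_cst//; apply: le_Rintegral => //.
- by have /integrable_norm := ih.
- apply: measurable_bounded_integrable => //.
  exists `|C|; split; first exact: num_real.
  by move=> M hM s Ds; exact: ltW.
Qed.

Lemma usimple_Rintegral_bound D f (C : R) y : measurable D -> (leb D < +oo)%E ->
  usimple D f -> (forall s, D s -> `|f s| <= C) ->
  `|\int[leb]_(s in D) ip (f s) y| <= C * fine (leb D) * `|y|.
Proof.
move=> mD fD uf hC; rewrite mulrAC; apply: Rintegral_bound => //.
  exact: usimple_measurable_ip.
move=> s Ds; apply: (le_trans (cauchy_schwarz H_hilbert _ _)).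
by rewrite ler_wpM2r// hC.
Qed.

Lemma Rintegral_simple D n (E : 'I_n -> set R) (c : 'I_n -> H) y :
  measurable D -> (leb D < +oo)%E -> (forall i, measurable (E i)) ->
  \int[leb]_(s in D) ip (simple_function E c s) y =
  ip (\sum_(i < n) fine (leb (D `&` E i)) *: c i) y.
Proof.
move=> mD fD mE; rewrite ip_suml.
have -> : \int[leb]_(s in D) ip (simple_function E c s) y =
    \int[leb]_(s in D) \sum_(i < n) \1_(E i) s * ip (c i) y.
  by apply: eq_Rintegral => s _; rewrite ip_suml; apply: eq_bigr => i _; rewrite ipZl.
have iI (A : set R) : measurable A -> leb.-integrable D (EFin \o (\1_A : R -> R)).
  move=> mA; apply: measurable_bounded_integrable => //.
  exists 1; split; first exact: num_real.
  move=> M hM s Ds; apply: le_trans (ltW hM).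
  by rewrite indicE; case: (_ \in _); rewrite ?normr1 ?normr0.
have iS (m : nat) (F : 'I_m -> set R) (d : 'I_m -> R) : (forall i, measurable (F i)) ->
    leb.-integrable D (EFin \o (fun s => \sum_(i < m) \1_(F i) s * d i)).
  move=> mF; apply: measurable_bounded_integrable => //.
    apply: measurable_sum => i; apply: measurable_funM; last exact: measurable_cst.
    exact: measurable_indicR.
  exists (\sum_(i < m) `|d i|); split; first exact: num_real.
  move=> M hM s Ds; apply: le_trans (ltW hM).
  apply: le_trans (ler_norm_sum _ _ _) _; apply: ler_sum => i _.
  by rewrite indicE normrM; case: (_ \in _); rewrite ?normr1 ?normr0 ?mul1r ?mul0r.
have main (m : nat) (F : 'I_m -> set R) (d : 'I_m -> R) : (forall i, measurable (F i)) ->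
    \int[leb]_(s in D) (\sum_(i < m) \1_(F i) s * d i) =
    \sum_(i < m) fine (leb (D `&` F i)) * d i.
  elim: m F d => [|m IH] F d mF.
    under eq_Rintegral do rewrite big_ord0.
    by rewrite Rintegral_cst// mul0r big_ord0.
  under eq_Rintegral do rewrite big_ord_recr/=.
  rewrite RintegralD//; last 2 first.
  - by apply: iS.
  - have := iS 1%N (fun=> F ord_max) (fun=> d ord_max) (fun=> mF _).
    by congr (integrable _ _ _); apply/funext => s /=; rewrite big_ord1.
  rewrite IH// big_ord_recr/=; congr (_ + _).
  rewrite RintegralZr//; last exact: iI.
  by rewrite /Rintegral (@integral_indic _ _ _ leb D mD _ (mF ord_max)) classical_sets.setIC.
rewrite main//; by apply: eq_bigr => i _; rewrite ipZl.
Qed.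

(** The integrals [J q] of the approximants form a Cauchy sequence: pairing [y = J p - J q] with
    itself reduces [|y| ^ 2] to a scalar integral at most a constant times [|y|]. Later estimates
    use only the weak identity and repeat this pairing. *)
Theorem usimple_bochner D f : measurable D -> (leb D < +oo)%E -> usimple D f ->
  exists I : H, is_bochner_integral leb D f I /\
    forall y, ip I y = \int[leb]_(s in D) ip (f s) y.
Proof.
move=> mD fD uf; have [G [sG hG]] := usimple_seq uf.
pose P (q : nat) (x : {n : nat & (('I_n -> set R) * ('I_n -> H))%type}) :=
  (forall i, measurable ((projT2 x).1 i)) /\
  G q = simple_function (projT2 x).1 (projT2 x).2.
have /choice[X hX] : forall q, exists x, P q x.
  move=> q; have [n [E [c [mE gE]]]] := sG q.
  by exists (existT _ n (E, c)).
pose n q := projT1 (X q); pose E q := (projT2 (X q)).1; pose c q := (projT2 (X q)).2.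
have mE q i : measurable (E q i) by have [h _] := hX q; exact: h.
have GE q : G q = simple_function (E q) (c q) by have [_ h] := hX q.
pose J q : H := \sum_(i < n q) fine (leb (D `&` E q i)) *: c q i.
have JE q y : ip (J q) y = \int[leb]_(s in D) ip (G q s) y.
  by rewrite GE Rintegral_simple.
set L := fine (leb D); have L0 : 0 <= L by exact: fine_ge0.
have uG q : usimple D (G q) by exact: usimple_simple.
have iG q y := usimple_integrable_ip y mD fD (uG q).
have if_ y := usimple_integrable_ip y mD fD uf.
have JB p q : `|J p - J q| <= (p.+1%:R^-1 + q.+1%:R^-1) * L.
  set y := J p - J q.
  have : ip y y <= (p.+1%:R^-1 + q.+1%:R^-1) * L * `|y|.
    rewrite {1}/y ipBl !JE -RintegralB//.
    have -> : \int[leb]_(s in D) (ip (G p s) y - ip (G q s) y) =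
        \int[leb]_(s in D) ip (G p s + - G q s) y.
      by apply: eq_Rintegral => s _; rewrite ipBl.
    apply: (le_trans (ler_norm _)).
    apply: usimple_Rintegral_bound => //.
      by apply: usimple_simple; apply: is_simpleD => //; exact: is_simpleN.
    move=> s Ds; rewrite -(subrK (f s) (G p s)) -addrA.
    apply: le_trans (ler_normD _ _) _; apply: lerD; last exact: hG.
    by rewrite distrC hG.
  rewrite (ip_norm H_hilbert) => h.
  have [->|y0] := eqVneq y 0.
    by rewrite normr0 mulr_ge0// addr_ge0// invr_ge0.
  by rewrite -(ler_pM2r (x := `|y|)) ?normr_gt0// -expr2.
have cJ : cvgn J.
  apply/cauchy_cvgP/cauchyP => e e0.
  have c0 : 2 * (L + 1) * q.+1%:R^-1 @[q --> \oo] --> (0 : R).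
    rewrite -[X in _ --> X](mulr0 (2 * (L + 1))); apply: cvgM; first exact: cvg_cst.
    exact: cvg_harmonic.
  have [N _ hN] := (cvgrPdist_lt _ _).1 c0 _ e0.
  exists (J N); exists N => // q /= Nq.
  rewrite -ball_normE/=; apply: le_lt_trans (JB N q) _.
  have := hN N (leqnn N); rewrite /= sub0r normrN => /(le_lt_trans (ler_norm _)).
  have : q.+1%:R^-1 <= N.+1%:R^-1 :> R by rewrite lef_pV2 ?posrE ?ltr0n// ler_nat.
  have : 0 < N.+1%:R^-1 :> R by rewrite invr_gt0 ltr0n.
  move: (N.+1%:R^-1) (q.+1%:R^-1) => u w a1 a2 a3.
  have := ler_wpM2r L0 a2; lra.
exists (limn J); split; last first.
  move=> y; have h1 : ip (J q) y @[q --> \oo] --> ip (limn J) y by exact: cvg_ipl.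
  apply: (cvg_unique _ h1) => //.
  apply: (@cvg_inv_seq _ _ _ (L * `|y|)) => q.
  rewrite JE -RintegralB//.
  have -> : \int[leb]_(s in D) (ip (f s) y - ip (G q s) y) =
      \int[leb]_(s in D) ip (f s + - G q s) y.
    by apply: eq_Rintegral => s _; rewrite ipBl.
  rewrite mulrC mulrA; apply: usimple_Rintegral_bound => //; last exact: hG.
  by apply: usimpleD => //; apply: usimple_simple; exact: is_simpleN.
exists n, E, c; split.
- move=> p i; split; first exact: mE.
  apply: le_lt_trans fD; apply: le_measure; rewrite ?inE//.
  exact: (@measurableI _ (measurableTypeR R) D (E p i) mD (mE p i)).
- apply: aeW => s Ds; apply: (@cvg_inv_seq _ _ _ 1) => q.
  by rewrite mul1r -GE hG.
- apply: (@squeeze_cvge _ _ _ _ (fun=> 0%E) _ (fun q => (q.+1%:R^-1 * L)%:E)).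
  + apply: nearW => q; apply/andP; split; first by apply: integral_ge0.
    rewrite EFinM fineK; last by rewrite ge0_fin_numE.
    rewrite -integral_cst//; apply: ge0_le_integral => //.
    * apply/measurable_EFinP; rewrite -GE; exact: usimple_measurable_norm.
    * by move=> s Ds; rewrite lee_fin -GE hG.
  + exact: cvg_cst.
  + apply/fine_cvgP; split; first exact: nearW.
    rewrite -[X in _ --> X](mul0r L); apply: cvgM; last exact: cvg_cst.
    exact: cvg_harmonic.
- exact: cJ.
Qed.

End bochner.

(** * Mild solutions *)

Lemma ip_synth_expansion (R : realType) (H : completeNormedModType R)
    (ip : {dot H for (idfun : R -> R)}) (phi : nat -> H) (x y : H) :
  norm_of_dot ip -> hilbert_basis ip phi ->
  \sum_(k < n) ip x (phi k) * ip y (phi k) @[n --> \oo] --> ip x y.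
Proof.
move=> Hh Hb.
have -> : (fun n : nat => \sum_(k < n) ip x (phi k) * ip y (phi k)) =
    (fun n => ip (synth phi (fun k => ip x (phi k)) n) y).
  apply/funext => n; rewrite ip_suml; apply: eq_bigr => k _.
  by rewrite ipZl (ipC ip y).
by apply: cvg_ipl => //; exact: expansion.
Qed.

Lemma subr_split (V : zmodType) (a p b c : V) :
  a - p = a - b - (p - c) + (b - c).
Proof.
rewrite opprB -!addrA; congr (_ + _).
by rewrite (addrCA c) (addrCA (- b)) (addrCA c) subrr addr0 addNr addr0.
Qed.

Section duhamel.
Context (R : realType) (H : completeNormedModType R)
  (ip : {dot H for (idfun : R -> R)}) (phi : nat -> H) (mu : nat -> R).
Hypotheses (H_hilbert : norm_of_dot ip) (phi_basis : hilbert_basis ip phi)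
  (mu_ge1 : forall k, 1 <= mu k).
Local Notation leb := (@lebesgue_measure R).
Local Notation S := (heat ip phi mu).
Implicit Types (x y : H) (f g : R -> H) (t : R).

(** Self-adjointness lets the propagator pass from a Bochner integral, known only through pairings,
    to the test vector. *)
Lemma ip_heatC t x y : 0 <= t -> ip (S t x) y = ip x (S t y).
Proof.
move=> t0.
have h1 := @ip_synth_expansion _ _ ip phi (S t x) y H_hilbert phi_basis.
have h2 := @ip_synth_expansion _ _ ip phi x (S t y) H_hilbert phi_basis.
apply: (cvg_unique _ h1) => //; apply: cvg_trans h2.
apply: near_eq_cvg; apply: nearW => n; apply: eq_bigr => k _.
by rewrite !ip_heat//; ring.
Qed.

Lemma heat_near0 x (e : R) : 0 < e -> exists2 d : R, 0 < d &
  forall t, 0 <= t < d -> `|S t x - x| <= e.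
Proof.
move=> e0.
have /cvgrPdist_le/(_ e e0)[d /= d0 hd] := @cvg_heat _ _ _ _ _ H_hilbert phi_basis mu_ge1 x.
exists d => // t /andP[t0 td].
move: t0; rewrite le_eqVlt => /predU1P[<-|t0].
  by rewrite (heat0 H_hilbert phi_basis mu_ge1) subrr normr0 ltW.
by rewrite distrC; apply: hd => //=; rewrite sub0r normrN gtr0_norm.
Qed.

Lemma ucont_heat (T : R) x : ucont T (fun t => S t x).
Proof.
move=> e e0; have [d d0 hd] := heat_near0 x e0; exists d => // s t.
wlog st : s t / s <= t.
  move=> W hs ht; case: (leP s t) => st; first exact: W.
  by rewrite distrC => h; rewrite distrC; apply: W => //; exact: ltW.
move=> /andP[s0 _] /andP[t0 _]; rewrite distrC ger0_norm ?subr_ge0// => std.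
have -> : S t x = S s (S (t - s) x).
  by rewrite -heat_add ?subr_ge0// addrC subrK.
rewrite -heatB//.
apply: le_trans (norm_heat H_hilbert phi_basis mu_ge1 _ s0) _.
by rewrite distrC hd// subr_ge0 st.
Qed.

Lemma ucont_heat_rev (T : R) x : ucont T (fun s => S (T - s) x).
Proof.
move=> e e0; have [d d0 hd] := ucont_heat T x e0; exists d => // s t hs ht st.
apply: hd; [lra|lra|].
by rewrite (_ : T - s - (T - t) = t - s) 1?distrC//; ring.
Qed.

Lemma leb_oo t : 0 <= t -> leb `]0, t[%classic = t%:E.
Proof.
move=> t0; rewrite lebesgue_measure_itv/= lte_fin.
case: ltP => h; first by rewrite -EFinB subr0.
by rewrite (_ : t = 0)//; lra.
Qed.

Lemma leb_co s t : s <= t -> leb `[s, t[%classic = (t - s)%:E.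
Proof.
move=> st; rewrite lebesgue_measure_itv/= lte_fin.
case: ltP => h; first by rewrite -EFinB.
by rewrite (_ : t = s) ?subrr//; lra.
Qed.

Lemma usimple_heat T t g : 0 <= t <= T -> usimple `]0, T[%classic g ->
  usimple `]0, t[%classic (fun s => S (t - s) (g s)).
Proof.
move=> /andP[t0 tT] ug.
have sub : `]0, t[%classic `<=` (`]0, T[%classic : set R).
  by apply: subset_itvl; rewrite bnd_simp.
apply: (@usimple_family _ _ _ _ (fun s => S (t - s)) 1) => //.
- by move=> s; rewrite /= in_itv/= => /andP[s0 st]; apply: heat_linear => //; lra.
- move=> s x; rewrite /= in_itv/= => /andP[s0 st]; rewrite mul1r.
  by apply: norm_heat => //; lra.
- by move=> c; apply: ucont_usimple; exact: ucont_heat_rev.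
- exact: usimple_sub sub ug.
Qed.

Lemma duhamel_ex g t : exists I,
  0 <= t -> usimple `]0, t[%classic (fun s => S (t - s) (g s)) ->
  is_bochner_integral leb `]0, t[%classic (fun s => S (t - s) (g s)) I /\
  forall y, ip I y = \int[leb]_(s in `]0, t[%classic) ip (S (t - s) (g s)) y.
Proof.
have [[t0 ug]|h] := pselect (0 <= t /\
    usimple `]0, t[%classic (fun s => S (t - s) (g s))).
  have [|I hI] := @usimple_bochner _ _ _ H_hilbert _ _ (measurable_itv _) _ ug.
    by rewrite leb_oo// ltry.
  by exists I.
by exists 0 => t0 ug; exfalso; apply: h.
Qed.

Definition duhamel g t : H := sval (cid (duhamel_ex g t)).

Lemma duhamel_spec T t g : 0 <= t <= T -> usimple `]0, T[%classic g ->
  is_bochner_integral leb `]0, t[%classic (fun s => S (t - s) (g s)) (duhamel g t) /\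
  forall y, ip (duhamel g t) y = \int[leb]_(s in `]0, t[%classic) ip (S (t - s) (g s)) y.
Proof.
move=> ht ug; have /andP[t0 _] := ht.
by apply: (svalP (cid (duhamel_ex g t))) => //; exact: usimple_heat ug.
Qed.

Lemma duhamel_ip T t g y : 0 <= t <= T -> usimple `]0, T[%classic g ->
  ip (duhamel g t) y = \int[leb]_(s in `]0, t[%classic) ip (S (t - s) (g s)) y.
Proof. by move=> ht ug; have [_] := duhamel_spec ht ug; exact. Qed.

Lemma duhamel_diff T t f g (C : R) : 0 <= t <= T -> usimple `]0, T[%classic f ->
  usimple `]0, T[%classic g ->
  (forall s, 0 < s < t -> `|f s - g s| <= C) ->
  `|duhamel f t - duhamel g t| <= C * t.
Proof.
move=> ht uf ug hC; have /andP[t0 tT] := ht.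
have mD : measurable (`]0, t[%classic : set R) by exact: measurable_itv.
have fD : (leb `]0%R, t[%classic < +oo)%E by rewrite leb_oo// ltry.
set y := _ - _.
have h : ip y y <= C * t * `|y|.
  rewrite {1}/y ipBl (duhamel_ip y ht uf) (duhamel_ip y ht ug).
  rewrite -(@RintegralB _ _ _ leb)//; last 2 first.
  - exact: usimple_integrable_ip (usimple_heat ht uf).
  - exact: usimple_integrable_ip (usimple_heat ht ug).
  have -> : \int[leb]_(s in `]0, t[%classic) (ip (S (t - s) (f s)) y - ip (S (t - s) (g s)) y) =
      \int[leb]_(s in `]0, t[%classic) ip (S (t - s) (f s) - S (t - s) (g s)) y.
    by apply: eq_Rintegral => s _; rewrite ipBl.
  apply: (le_trans (ler_norm _)).
  have lt : t = fine (leb `]0, t[%classic) by rewrite leb_oo.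
  rewrite {4}lt; apply: usimple_Rintegral_bound => //.
    apply: (@usimple_ext _ _ _ (fun s => S (t - s) (f s + - g s))).
      move=> s; rewrite /= in_itv/= => /andP[s0 st]; rewrite heatB//; lra.
    apply: (usimple_heat ht); apply: usimpleD => //.
    by move=> e /ug[g' sg hg]; exists (fun s => - g' s);
      [exact: is_simpleN|move=> s Ds; rewrite -opprD normrN; exact: hg].
  move=> s; rewrite /= in_itv/= => hs; have /andP[s0 st] := hs.
  rewrite -heatB//; last lra.
  apply: (le_trans (norm_heat _ _ _ _ _)) => //; first by lra.
  exact: hC.
rewrite (ip_norm H_hilbert) in h.
have [y0|y0] := eqVneq y 0.
  rewrite y0 normr0; case: (ltgtP 0 t) t0 => // [tp _|<- _]; last by rewrite mulr0.
  have := hC (t / 2) ltac:(apply/andP; split; lra).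
  by move=> /(le_trans (normr_ge0 _)) C0; rewrite mulr_ge0// ltW.
by rewrite -(ler_pM2r (x := `|y|)) ?normr_gt0// -expr2.
Qed.

(** Semigroup property under the integral: what was accumulated before [t0] is transported by the
    flow and cancels. The domain is an intersection because [t0] may be [0], an endpoint that the
    integral over []0, t[] leaves out. *)
Lemma duhamel_restart T t0 t g y : 0 <= t0 -> t0 <= t -> t <= T ->
  usimple `]0, T[%classic g ->
  ip (duhamel g t - S (t - t0) (duhamel g t0)) y =
  \int[leb]_(s in `[t0, t[%classic `&` `]0, t[%classic) ip (S (t - s) (g s)) y.
Proof.
move=> t00 t0t tT ug.
have ht : 0 <= t <= T by rewrite (le_trans t00 t0t).
have ht0 : 0 <= t0 <= T by rewrite t00 (le_trans t0t).
rewrite ipBl ip_heatC ?subr_ge0//.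
rewrite (duhamel_ip y ht ug) (duhamel_ip (S (t - t0) y) ht0 ug).
have U : (`]0, t[%classic : set R) = `]0, t0[%classic `|` (`[t0, t[%classic `&` `]0, t[%classic).
  apply/seteqP; split => s /=; rewrite !in_itv/=.
    move=> /andP[s0 st]; rewrite s0 st andbT/=.
    by case: (ltP s t0) => h; [left|right].
  move=> [/andP[s0 st]|[_ //]]; rewrite s0/=; lra.
have iD : leb.-integrable `]0, t[%classic (EFin \o (fun s => ip (S (t - s) (g s)) y)).
  apply: (@usimple_integrable_ip _ _ _ H_hilbert) => //.
    by rewrite leb_oo ?ltry//; case/andP: ht.
  exact: usimple_heat ug.
rewrite [in X in X - _]U (@Rintegral_setU _ _ _ leb)//.
- have -> : \int[leb]_(s in `]0%R, t0[%classic) ip (S (t0 - s) (g s)) (S (t - t0) y) =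
      \int[leb]_(s in `]0%R, t0[%classic) ip (S (t - s) (g s)) y.
    apply: eq_Rintegral => s; rewrite inE/= in_itv/= => /andP[s0 st].
    rewrite -ip_heatC ?subr_ge0// -heat_add ?subr_ge0//; last exact: ltW.
    by congr (ip (S _ _) _); ring.
  by rewrite addrAC subrr add0r.
- by apply: measurableI; exact: measurable_itv.
- by rewrite -U.
- apply/disj_setPS => s [/=]; rewrite !in_itv/= => /andP[_ st] [/andP[ts _] _]; lra.
Qed.

Lemma leb_coo t0 t : 0 <= t0 -> t0 <= t ->
  leb (`[t0, t[%classic `&` `]0, t[%classic) = (t - t0)%:E.
Proof.
rewrite le_eqVlt => /predU1P[<-|h0] h1.
  rewrite subr0 setIidr ?leb_oo//.
  by apply: subset_itvr; rewrite bnd_simp.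
rewrite setIidl ?leb_co//.
by apply: subset_itvr; rewrite bnd_simp.
Qed.

Lemma duhamel_restart_bound T t0 t g (C : R) : 0 <= t0 -> t0 <= t -> t <= T ->
  usimple `]0, T[%classic g -> (forall s, t0 <= s < t -> `|g s| <= C) ->
  `|duhamel g t - S (t - t0) (duhamel g t0)| <= C * (t - t0).
Proof.
move=> t00 t0t tT ug hC.
have ht : 0 <= t <= T by rewrite (le_trans t00 t0t).
set y := _ - _.
have h : ip y y <= C * (t - t0) * `|y|.
  rewrite {1}/y (@duhamel_restart T)//.
  apply: (le_trans (ler_norm _)).
  have lt : t - t0 = fine (leb (`[t0, t[%classic `&` `]0, t[%classic)) by rewrite leb_coo.
  rewrite [in leRHS]lt; apply: usimple_Rintegral_bound => //.
  - by apply: measurableI; exact: measurable_itv.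
  - by rewrite leb_coo// ltry.
  - by apply: usimple_sub (usimple_heat ht ug); exact: subIsetr.
  - move=> s [/=]; rewrite !in_itv/= => hs /andP[s0 st].
    apply: (le_trans (norm_heat _ _ _ _ _)) => //; first by lra.
    exact: hC.
rewrite (ip_norm H_hilbert) in h.
have [y0|y0] := eqVneq y 0.
  rewrite y0 normr0; case: (ltgtP t0 t) t0t => // [tp _|-> _]; last by rewrite subrr mulr0.
  have := hC t0 ltac:(by rewrite lexx).
  by move=> /(le_trans (normr_ge0 _)) C0; rewrite mulr_ge0// subr_ge0 ltW.
by rewrite -(ler_pM2r (x := `|y|)) ?normr_gt0// -expr2.
Qed.

Lemma duhamel0 T g : 0 <= T -> usimple `]0, T[%classic g -> duhamel g 0 = 0.
Proof.
move=> T0 ug; apply: (coord_inj phi_basis) => k.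
rewrite (@duhamel_ip T) ?lexx// ip0l.
by rewrite (_ : `]0, 0[%classic = set0) ?Rintegral_set0// set_itvoo0.
Qed.

Lemma duhamel_bound T t g (C : R) : 0 <= t <= T -> usimple `]0, T[%classic g ->
  (forall s, 0 <= s < t -> `|g s| <= C) -> `|duhamel g t| <= C * t.
Proof.
move=> /andP[t0 tT] ug hC.
have := duhamel_restart_bound (lexx 0) t0 tT ug hC.
by rewrite (duhamel0 (le_trans t0 tT) ug) subr0 -[X in _ - X](_ : 0 = _) ?subr0//;
  apply: (coord_inj phi_basis) => k; rewrite ip_heat// ip0l mulr0.
Qed.

(** The modulus comes from parabolic smoothing. The value at [s] is split into the contribution of
    the last [eta] units of time, of size [G * eta], and [S eta] of an earlier value, which the flow
    over a time [de] moves by at most [de / eta] times its norm. If [s <= eta] the value itself is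
    small. *)
Lemma ucont_duhamel T g (C : R) : 0 <= T -> usimple `]0, T[%classic g ->
  (forall s, 0 <= s < T -> `|g s| <= C) -> ucont T (duhamel g).
Proof.
move=> T0 ug hC0 e e0.
pose G := `|C| + 1; have G0 : 0 < G by rewrite ltr_wpDl.
have hC s : 0 <= s < T -> `|g s| <= G.
  by move=> /hC0 h; apply: (le_trans h); apply: (le_trans (ler_norm C)); rewrite lerDl.
pose eta := e / (4 * G); have eta0 : 0 < eta by rewrite divr_gt0 ?mulr_gt0.
have K0 : 0 < G * (1 + T / eta).
  by rewrite mulr_gt0// ltr_pwDl// divr_ge0// ltW.
pose d := e / 2 / (G * (1 + T / eta)).
have d0 : 0 < d by rewrite divr_gt0// divr_gt0.
exists d => // s t.
wlog st : s t / s <= t.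
  move=> W hs ht; case: (leP s t) => st; first exact: W.
  by rewrite distrC => h; rewrite distrC; apply: W => //; exact: ltW.
move=> /andP[s0 sT] /andP[t0 tT]; rewrite distrC ger0_norm ?subr_ge0// => std.
set de := t - s in std; have de0 : 0 <= de by rewrite subr_ge0.
have a1 : `|duhamel g t - S de (duhamel g s)| <= G * de.
  apply: (duhamel_restart_bound s0 st tT ug) => r /andP[r1 r2].
  by apply: hC; apply/andP; split; lra.
have a2 : `|S de (duhamel g s) - duhamel g s| <= 2 * (G * eta) + G * T * (de / eta).
  case: (leP s eta) => seta.
    have b1 : `|duhamel g s| <= G * s.
      apply: (@duhamel_bound T) => //; first by rewrite s0.
      by move=> r /andP[r1 r2]; apply: hC; apply/andP; split; lra.
    have b2 := norm_heat H_hilbert phi_basis mu_ge1 (duhamel g s) de0.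
    apply: (le_trans (ler_normB _ _)).
    have : G * s <= G * eta by rewrite ler_pM2l.
    have : 0 <= G * T * (de / eta) by rewrite !mulr_ge0 ?invr_ge0 ?(ltW G0) ?(ltW eta0).
    lra.
  pose s' := s - eta; have s'0 : 0 <= s' by rewrite subr_ge0 ltW.
  have s's : s' <= s by rewrite gerBl ltW.
  have b1 : `|duhamel g s - S eta (duhamel g s')| <= G * eta.
    have -> : eta = s - s' by rewrite /s'; ring.
    apply: (duhamel_restart_bound s'0 s's sT ug) => r /andP[r1 r2].
    by apply: hC; apply/andP; split; lra.
  have b2 : `|duhamel g s'| <= G * T.
    apply: (@le_trans _ _ (G * s')).
      apply: (@duhamel_bound T) => //; first by rewrite s'0 (le_trans s's).
      by move=> r /andP[r1 r2]; apply: hC; apply/andP; split; lra.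
    by rewrite ler_pM2l// (le_trans s's).
  set p := duhamel g s in b1 *; set q := duhamel g s' in b1 b2.
  have -> : S de p - p = S de (p - S eta q) - (p - S eta q) +
      (S (eta + de) q - S eta q).
    rewrite heatB// [eta + de]addrC.
    rewrite (@heat_add _ _ _ _ _ H_hilbert phi_basis mu_ge1 de eta)// ?ltW//.
    exact: subr_split.
  apply: le_trans (ler_normD _ _) _; apply: lerD.
    apply: le_trans (ler_normB _ _) _.
    have := norm_heat H_hilbert phi_basis mu_ge1 (p - S eta q) de0; lra.
  apply: (le_trans (heat_smoothing H_hilbert phi_basis mu_ge1 q de0 eta0)).
  by rewrite mulrC ler_wpM2r// divr_ge0 ?(ltW eta0).
rewrite distrC -(subrK (S de (duhamel g s)) (duhamel g t)) -addrA.
apply: le_trans (ler_normD _ _) _.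
apply: (le_trans (lerD a1 a2)).
have e1 : G * eta = e / 4 by rewrite /eta; field; rewrite gt_eqF.
have e2 : de * (G * (1 + T / eta)) <= e / 2 by rewrite -ler_pdivlMr// ltW.
have -> : G * T * (de / eta) = de * (G * (T / eta)) by ring.
rewrite mulrDr mulr1 mulrDr in e2; lra.
Qed.

End duhamel.

Lemma half_pow_le_inv (R : realType) (n : nat) : (1 / 2 : R) ^+ n <= n.+1%:R^-1.
Proof.
rewrite div1r exprVn lef_pV2 ?posrE ?exprn_gt0 ?ltr0n//.
by rewrite -natrX ler_nat ltn_expl.
Qed.

(** Stands in for Gronwall's inequality: a bound whose excess is halved at each pass holds without
    excess. *)
Lemma le_half_pow (R : realType) (x y C : R) :
  (forall n, x <= y + C * (1 / 2) ^+ n) -> x <= y.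
Proof.
move=> h; have c : y + C * (1 / 2) ^+ n @[n --> \oo] --> y + C * 0.
  apply: cvgD; first exact: cvg_cst.
  apply: cvgM; first exact: cvg_cst.
  by apply: cvg_expr; rewrite ger0_norm; lra.
rewrite mulr0 addr0 in c.
rewrite -(cvg_lim _ c)//; apply: limr_ge; first by apply/cvg_ex; exists y.
exact: nearW.
Qed.

Lemma geometric_limit (R : realType) (H : completeNormedModType R) (u : nat -> H) (C : R) :
  (forall n, `|u n.+1 - u n| <= C * (1 / 2) ^+ n) ->
  exists l, forall n, `|l - u n| <= 2 * C * (1 / 2) ^+ n.
Proof.
move=> h.
have C0 : 0 <= C by have := h 0%N; rewrite expr0 mulr1; exact: le_trans.
have p0 n : 0 <= (1 / 2 : R) ^+ n by rewrite exprn_ge0// divr_ge0.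
have hd n m : `|u (n + m)%N - u n| <= 2 * C * (1 / 2) ^+ n.
  suff hm : `|u (n + m)%N - u n| <= 2 * C * (1 / 2) ^+ n - 2 * C * (1 / 2) ^+ (n + m).
    by apply: (le_trans hm); rewrite gerBl !mulr_ge0.
  elim: m => [|m IH]; first by rewrite addn0 !subrr normr0.
  rewrite addnS -(subrK (u (n + m)%N) (u _.+1)) -addrA.
  apply: le_trans (ler_normD _ _) _; apply: (le_trans (lerD (h _) IH)).
  by rewrite exprS; lra.
have cu : cvgn u.
  apply/cauchy_cvgP/cauchyP => e e0.
  have [N hN] : exists N, 2 * C * (1 / 2) ^+ N < e.
    have c0 : 2 * C * q.+1%:R^-1 @[q --> \oo] --> (0 : R).
      rewrite -[X in _ --> X](mulr0 (2 * C)); apply: cvgM; first exact: cvg_cst.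
      exact: cvg_harmonic.
    have [N _ hN] := (cvgrPdist_lt _ _).1 c0 _ e0.
    exists N; have := hN N (leqnn N); rewrite /= sub0r normrN.
    move=> /(le_lt_trans (ler_norm _)); apply: le_lt_trans.
    by rewrite ler_wpM2l ?mulr_ge0// half_pow_le_inv.
  exists (u N); exists N => // q /= Nq.
  rewrite -ball_normE/= distrC; apply: le_lt_trans hN.
  by rewrite -(subnKC Nq) hd.
exists (limn u) => n.
have c : `|u m - u n| @[m --> \oo] --> `|limn u - u n|.
  by apply: cvg_norm; apply: cvgB => //; exact: cvg_cst.
rewrite -(cvg_lim _ c)//; apply: limr_le; first by apply/cvg_ex; exists `|limn u - u n|.
by exists n => // m /= nm; rewrite -(subnKC nm) hd.
Qed.

Lemma ucontB (R : realType) (H : completeNormedModType R) (T : R) (f g : R -> H) :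
  ucont T f -> ucont T g -> ucont T (fun s => f s - g s).
Proof.
move=> uf ug e e0; have e2 : 0 < e / 2 by rewrite divr_gt0.
have [d1 d10 h1] := uf _ e2; have [d2 d20 h2] := ug _ e2.
exists (Num.min d1 d2); first by rewrite lt_min d10.
move=> s t hs ht; rewrite lt_min => /andP[st1 st2].
rewrite opprD addrACA -opprD; apply: le_trans (ler_normB _ _) _.
by have := h1 s t hs ht st1; have := h2 s t hs ht st2; lra.
Qed.

Lemma ucont_bounded (R : realType) (H : completeNormedModType R) (T : R) (f : R -> H) :
  ucont T f -> exists2 C : R, 0 <= C & forall s, 0 <= s <= T -> `|f s| <= C.
Proof.
move=> uf; have [C C0 hC] := usimple_bounded (ucont_usimple uf).
exists (C + `|f 0| + `|f T|); first by rewrite !addr_ge0.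
move=> s /andP[]; rewrite le_eqVlt => /predU1P[<- _|s0].
  by rewrite -addrA addrCA lerDl addr_ge0.
rewrite le_eqVlt => /predU1P[->|sT]; first by rewrite lerDr addr_ge0.
by rewrite -addrA ler_wpDr ?addr_ge0// hC//= in_itv/= s0.
Qed.

Lemma ucont_continuous (R : realType) (H : completeNormedModType R) (T : R) (f : R -> H) :
  ucont T f -> {within `[0, T], continuous f}.
Proof.
move=> uf; apply/subspace_continuousP => t; rewrite /= in_itv/= => ht.
apply/cvgrPdist_le => e e0; have [d d0 hd] := uf e e0.
suff : nbhs t [set s | s \in `[0, T] -> `|f t - f s| <= e] by [].
apply: (@filterS _ _ _ (ball t d)); last exact: nbhsx_ballx.
by move=> s bs hs; apply: hd => //; move: hs; rewrite in_itv.
Qed.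

Section bilinear.
Context (R : realType) (H : completeNormedModType R)
  (ip : {dot H for (idfun : R -> R)}) (phi : nat -> H) (mu : nat -> R)
  (B : {linear H -> H}) (M T : R).
Hypotheses (H_hilbert : norm_of_dot ip) (phi_basis : hilbert_basis ip phi)
  (mu_ge1 : forall k, 1 <= mu k) (M0 : 0 <= M) (BM : forall x, `|B x| <= M * `|x|)
  (T0 : 0 <= T).
Local Notation leb := (@lebesgue_measure R).
Local Notation S := (heat ip phi mu).
Local Notation D := (duhamel phi mu H_hilbert).

(** Regularity is asked of the vector-valued functions [v s *: c], the form in which
    [usimple_family] takes it; the bound holds at every real, so nothing has to be tracked outside
    []0, T[]. *)
Definition admissible (V : R) (v : R -> R) :=
  (forall s, `|v s| <= V) /\ forall c : H, usimple `]0, T[%classic (fun s => v s *: c).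

Definition mild (v : R -> R) (x : H) (psi : R -> H) :=
  ucont T psi /\ forall t, 0 <= t <= T ->
    psi t = S t x - D (fun s => v s *: B (psi s)) t.

Lemma drive_usimple V v psi : admissible V v -> ucont T psi ->
  usimple `]0, T[%classic (fun s => v s *: B (psi s)).
Proof.
move=> [vV uv] upsi; have V0 := le_trans (normr_ge0 _) (vV 0).
apply: (@usimple_family _ _ _ _ (fun s x => v s *: B x) (V * M)) => //.
- by rewrite mulr_ge0.
- by move=> s _ a x y; rewrite linearP scalerDr !scalerA mulrC.
- move=> s x _; rewrite normrZ -mulrA; apply: ler_pM => //; exact: vV.
- exact: ucont_usimple.
Qed.

(** The smallness assumption makes the Duhamel map a contraction of ratio [1/2] on the whole of
    [[0, T]], so no gluing of local solutions is required. All controls of the iteration obey the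
    same [V]. *)
Lemma picard V v x : admissible V v -> V * M * T <= 1 / 2 ->
  exists psi, mild v x psi.
Proof.
move=> av small; have [vV uv] := av; have V0 := le_trans (normr_ge0 _) (vV 0).
pose P psi t := S t x - D (fun s => v s *: B (psi s)) t.
have uP psi : ucont T psi -> ucont T (P psi).
  move=> upsi; apply: ucontB; first exact: ucont_heat.
  have [C C0 hC] := ucont_bounded upsi.
  apply: (@ucont_duhamel _ _ _ _ _ H_hilbert phi_basis mu_ge1 T _ (V * (M * C))) => //.
    exact: drive_usimple av upsi.
  move=> s /andP[s0 sT]; rewrite normrZ; apply: ler_pM => //.
  by apply: (le_trans (BM _)); rewrite ler_wpM2l// hC// s0 ltW.
have dP f g C : ucont T f -> ucont T g ->
    (forall s, 0 <= s <= T -> `|f s - g s| <= C) ->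
    forall t, 0 <= t <= T -> `|P f t - P g t| <= C / 2.
  move=> uf ug hC t ht; have /andP[t0 tT] := ht.
  have C0 : 0 <= C by apply: le_trans (hC 0 _) => //; rewrite lexx.
  rewrite /P opprB addrC addrA subrK.
  apply: (@le_trans _ _ (V * (M * C) * t)).
    rewrite distrC; apply: (@duhamel_diff _ _ _ _ _ H_hilbert phi_basis mu_ge1 T) => //.
    - exact: drive_usimple av uf.
    - exact: drive_usimple av ug.
    - move=> s /andP[s0 st]; rewrite -scalerBr normrZ -raddfB; apply: ler_pM => //.
      by apply: (le_trans (BM _)); rewrite ler_wpM2l// hC//; apply/andP; split; lra.
  have -> : V * (M * C) * t = V * M * t * C by ring.
  apply: (@le_trans _ _ (V * M * T * C)); last by have := ler_wpM2r C0 small; lra.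
  by rewrite ler_wpM2r// ler_wpM2l// mulr_ge0.
pose u := fix u n := if n is n'.+1 then P (u n') else (fun t => S t x).
have uu n : ucont T (u n).
  by elim: n => [|n IH]; [exact: ucont_heat|exact: uP].
have [C0 C00 hC0] := ucont_bounded (ucontB (uu 1%N) (uu 0%N)).
have ud n : forall t, 0 <= t <= T -> `|u n.+1 t - u n t| <= C0 * (1 / 2) ^+ n.
  elim: n => [|n IH] t ht; first by rewrite expr0 mulr1; exact: hC0.
  by have := dP _ _ _ (uu n.+1) (uu n) IH t ht; rewrite exprS; lra.
have /choice[psi hpsi] : forall t, exists l, 0 <= t <= T ->
    forall n, `|l - u n t| <= 2 * C0 * (1 / 2) ^+ n.
  move=> t; have [ht|ht] := boolP (0 <= t <= T); last by exists 0.
  by have [l hl] := geometric_limit (fun n => ud n t ht); exists l.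
have upsi : ucont T psi.
  move=> e e0.
  have [N hN] : exists N, 2 * C0 * (1 / 2) ^+ N <= e / 3.
    apply: contrapT => /forallNP hN.
    have : e / 3 <= 0.
      apply: (@le_half_pow _ _ _ (2 * C0)) => n; rewrite add0r.
      by have /negP := hN n; rewrite -ltNge => /ltW.
    lra.
  have [d d0 hd] := uu N (e / 3) ltac:(lra).
  exists d => // s t hs ht st.
  have a1 := hpsi s hs N; have a2 := hd s t hs ht st; have a3 := hpsi t ht N.
  have b1 := ler_distD (u N s) (psi s) (psi t).
  have b2 := ler_distD (u N t) (u N s) (psi t).
  rewrite [`|u N t - psi t|]distrC in b2; lra.
exists psi; split => // t ht; apply/eqP; rewrite -subr_eq0 -normr_le0.
apply: (@le_half_pow _ _ _ (3 * C0)) => n; rewrite add0r -/(P psi t).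
rewrite -(subrK (u n.+1 t) (psi t)) -addrA.
apply: le_trans (ler_normD _ _) _.
have a1 := hpsi t ht n.+1.
have hu s : 0 <= s <= T -> `|u n s - psi s| <= 2 * C0 * (1 / 2) ^+ n.
  by move=> hs; rewrite distrC hpsi.
have a2 := dP _ _ _ (uu n) upsi hu t ht.
have p0 : 0 <= C0 * (1 / 2 : R) ^+ n by rewrite mulr_ge0// exprn_ge0// divr_ge0.
apply: (le_trans (lerD a1 a2)); rewrite exprS; lra.
Qed.

(** Uniqueness together with causality: the controls agree before [t1] only. This identifies the
    trajectories of successive controls up to the time where they start to differ. *)
Lemma mild_unique V v w x psi chi t1 : admissible V v -> V * M * T <= 1 / 2 ->
  admissible V w -> mild v x psi -> mild w x chi -> 0 <= t1 <= T ->
  (forall s, 0 <= s < t1 -> v s = w s) ->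
  forall t, 0 <= t <= t1 -> psi t = chi t.
Proof.
move=> av small aw [upsi hpsi] [uchi hchi] /andP[t10 t1T] vw.
have [vV uv] := av; have V0 := le_trans (normr_ge0 _) (vV 0).
have [C C0 hC] := ucont_bounded (ucontB upsi uchi).
have main n : forall t, 0 <= t <= t1 -> `|psi t - chi t| <= C * (1 / 2) ^+ n.
  elim: n => [|n IH] t /andP[t0 tt1].
    by rewrite expr0 mulr1 hC// t0 (le_trans tt1).
  have ht : 0 <= t <= T by rewrite t0 (le_trans tt1).
  rewrite hpsi// hchi// opprB addrC addrA subrK distrC.
  have p0 : 0 <= C * (1 / 2 : R) ^+ n by rewrite mulr_ge0// exprn_ge0// divr_ge0.
  apply: (@le_trans _ _ (V * (M * (C * (1 / 2) ^+ n)) * t)).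
    apply: (@duhamel_diff _ _ _ _ _ H_hilbert phi_basis mu_ge1 T) => //.
    - exact: drive_usimple av upsi.
    - exact: drive_usimple aw uchi.
    - move=> s /andP[s0 st]; rewrite -vw; last by apply/andP; split; lra.
      rewrite -scalerBr normrZ -raddfB; apply: ler_pM => //.
      by apply: (le_trans (BM _)); rewrite ler_wpM2l// IH//; apply/andP; split; lra.
  have -> : V * (M * (C * (1 / 2) ^+ n)) * t = V * M * t * (C * (1 / 2) ^+ n) by ring.
  apply: (@le_trans _ _ (V * M * T * (C * (1 / 2) ^+ n))).
    by rewrite ler_wpM2r// ler_wpM2l ?mulr_ge0// (le_trans tt1).
  by have := ler_wpM2r p0 small; rewrite exprS; lra.
move=> t ht; apply/eqP; rewrite -subr_eq0 -normr_le0.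
by apply: (@le_half_pow _ _ _ C) => n; rewrite add0r main.
Qed.

Lemma mild_mild_solution V v x psi : admissible V v -> mild v x psi ->
  mild_solution (diagonal_operator ip phi mu) B T v x psi.
Proof.
move=> av [upsi hpsi]; exists S; first exact: heat_exp_opp_semigroup.
split; first exact: ucont_continuous.
move=> t ht; exists (D (fun s => v s *: B (psi s)) t); last exact: hpsi.
have [] := duhamel_spec H_hilbert phi_basis mu_ge1 ht (drive_usimple av upsi).
by [].
Qed.

End bilinear.

(** * One step of the iteration *)

Lemma subr_shift (V : zmodType) (a p c d : V) : a - d - p = a - c - p - (d - c).
Proof.
by rewrite opprB -!addrA; congr (_ + _); rewrite (addrCA (- p)) addKr addrC.
Qed.

Section step.
Context (R : realType) (H : completeNormedModType R)
  (ip : {dot H for (idfun : R -> R)}) (phi : nat -> H) (mu : nat -> R)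
  (B : {linear H -> H}) (M T : R).
Hypotheses (H_hilbert : norm_of_dot ip) (phi_basis : hilbert_basis ip phi)
  (mu_ge1 : forall k, 1 <= mu k) (M0 : 0 <= M) (BM : forall x, `|B x| <= M * `|x|)
  (T0 : 0 <= T).
Local Notation leb := (@lebesgue_measure R).
Local Notation S := (heat ip phi mu).
Local Notation D := (duhamel phi mu H_hilbert).
Local Notation tail := (tailproj ip phi).

Lemma duhamelD f g t : 0 <= t <= T -> usimple `]0, T[%classic f ->
  usimple `]0, T[%classic g -> D (fun s => f s + g s) t = D f t + D g t.
Proof.
move=> ht uf ug; have /andP[t0 _] := ht.
apply: (coord_inj phi_basis) => k; rewrite ipDl.
rewrite (duhamel_ip H_hilbert phi_basis mu_ge1 _ ht uf).
rewrite (duhamel_ip H_hilbert phi_basis mu_ge1 _ ht ug).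
rewrite (duhamel_ip H_hilbert phi_basis mu_ge1 _ ht (usimpleD uf ug)).
have fD : (leb `]0%R, t[%classic < +oo)%E by rewrite leb_oo// ltry.
rewrite -(@RintegralD _ _ _ leb)//; last 2 first.
- exact: usimple_integrable_ip (usimple_heat H_hilbert phi_basis mu_ge1 ht uf).
- exact: usimple_integrable_ip (usimple_heat H_hilbert phi_basis mu_ge1 ht ug).
apply: eq_Rintegral => s; rewrite inE/= in_itv/= => /andP[s0 st].
by rewrite heatD ?ipDl// subr_ge0 ltW.
Qed.

(* [z] is the deviation from the eigensolution.  Its quadratic part is driven by
   [v B z]; the linear part vanishes on the first [N] modes by the moment
   condition, so only its tail remains. *)
Lemma step_estimate V v x psi (j N : nat) (t0 t1 V1 e : R) :
  let z t := psi t - S t (phi j) in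
  admissible H T V v -> mild phi mu B T H_hilbert v x psi ->
  0 <= t0 -> t0 <= t1 -> t1 <= T ->
  (forall s, t0 <= s < t1 -> `|v s| <= V1) -> (t1 - t0) * V1 * M <= 1 / 2 ->
  0 <= V1 -> `|z t0| <= e ->
  (forall k, (k < N)%N ->
    \int[leb]_(s in `[t0, t1[%classic `&` `]0, t1[%classic)
      (expR (- (mu k * (t1 - s))) * (v s * (expR (- (mu j * s)) * ip (B (phi j)) (phi k)))) =
    expR (- (mu k * (t1 - t0))) * ip (z t0) (phi k)) ->
  `|z t1| <= `|tail N (z t0)| + (t1 - t0) * V1 * `|tail N (B (phi j))| +
    (t1 - t0) * V1 * M * (2 * (e + (t1 - t0) * V1 * M)).
Proof.
move=> z av [upsi hpsi] t00 t01 t1T vV1 small V10 ze moment.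
pose Phi t := S t (phi j).
have BZ a y : B (a *: y) = a *: B y by exact: linearZ.
have uPhi : ucont T Phi by exact: ucont_heat.
have uz : ucont T z by exact: ucontB.
have nPhi t : 0 <= t -> `|Phi t| <= 1.
  by move=> ht; apply: le_trans (norm_heat H_hilbert phi_basis mu_ge1 _ ht) _; rewrite (ip_phi_phi H_hilbert phi_basis).
pose g s := v s *: B (psi s); pose gL s := v s *: B (Phi s); pose gN s := v s *: B (z s).
have ug : usimple `]0, T[%classic g := drive_usimple M0 BM av upsi.
have uL : usimple `]0, T[%classic gL := drive_usimple M0 BM av uPhi.
have uN : usimple `]0, T[%classic gN := drive_usimple M0 BM av uz.
pose W g t := D g t - S (t - t0) (D g t0).
have zE t : t0 <= t <= t1 -> z t = S (t - t0) (z t0) - W g t.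
  move=> /andP[ht0 ht1]; have tt0 : 0 <= t - t0 by rewrite subr_ge0.
  have tE : t = (t - t0) + t0 by rewrite subrK.
  rewrite /z /W heatB// hpsi; last by apply/andP; split; lra.
  rewrite (hpsi t0); last by apply/andP; split; lra.
  rewrite heatB// -!heat_add// -tE /g.
  exact: subr_shift.
set q := (t1 - t0) * V1 * M in small *.
have q0 : 0 <= q by rewrite /q !mulr_ge0// subr_ge0.
have e0 : 0 <= e by exact: le_trans (normr_ge0 _) ze.
have [C C0 hC] := ucont_bounded uz.
(* Since [|psi| <= |z| + 1] and [q <= 1/2], a bound [Z] on [z] improves to [e + q (Z + 1)], whose
   excess over [2 (e + q)] is at most half that of [Z]. *)
have zb t : t0 <= t <= t1 -> `|z t| <= 2 * (e + q).
  suff main n : forall t, t0 <= t <= t1 -> `|z t| <= 2 * (e + q) + C * (1 / 2) ^+ n.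
    by move=> ht; apply: (@le_half_pow _ _ _ C) => n; exact: main.
  elim: n => [|n IH] t' /andP[ht0 ht1].
    have h := hC t' ltac:(apply/andP; split; lra).
    by rewrite expr0 mulr1; lra.
  have p0 : 0 <= C * (1 / 2 : R) ^+ n by rewrite mulr_ge0// exprn_ge0// divr_ge0.
  rewrite zE ?ht0//; apply: le_trans (ler_normB _ _) _.
  have a1 : `|S (t' - t0) (z t0)| <= e.
    by apply: le_trans ze; apply: norm_heat => //; rewrite subr_ge0.
  pose Z := 2 * (e + q) + C * (1 / 2) ^+ n.
  have Z0 : 0 <= Z by rewrite /Z; lra.
  have a2 : `|W g t'| <= V1 * (M * (Z + 1)) * (t' - t0).
    apply: (duhamel_restart_bound H_hilbert phi_basis mu_ge1 t00 ht0 _ ug); first by lra.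
    move=> s /andP[s0 st]; rewrite /g normrZ; apply: ler_pM => //.
      by apply: vV1; apply/andP; split; lra.
    apply: (le_trans (BM _)); rewrite ler_wpM2l//.
    have -> : psi s = z s + Phi s by rewrite /z subrK.
    apply: le_trans (ler_normD _ _) _; apply: lerD.
      by apply: IH; apply/andP; split; lra.
    by apply: nPhi; lra.
  have a3 : V1 * (M * (Z + 1)) * (t' - t0) <= q * (Z + 1).
    have -> : q * (Z + 1) = V1 * (M * (Z + 1)) * (t1 - t0) by rewrite /q; ring.
    by apply: (ler_wpM2l (mulr_ge0 V10 (mulr_ge0 M0 (addr_ge0 Z0 ler01)))); rewrite lerB.
  have a4 := ler_wpM2r Z0 small.
  by rewrite exprS; move: a1 a2 a3 a4; rewrite /Z; lra.
have WE : W g t1 = W gL t1 + W gN t1.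
  have gE : g = fun s => gL s + gN s.
    by apply/funext => s; rewrite /g /gL /gN -scalerDr -raddfD addrC /z subrK.
  rewrite /W gE !duhamelD//; [|by apply/andP; split; lra|by apply/andP; split; lra].
  by rewrite heatD ?subr_ge0// opprD addrACA.
have WN : `|W gN t1| <= q * (2 * (e + q)).
  have -> : q * (2 * (e + q)) = V1 * (M * (2 * (e + q))) * (t1 - t0) by rewrite /q; ring.
  apply: (duhamel_restart_bound H_hilbert phi_basis mu_ge1 t00 t01 t1T uN).
  move=> s /andP[s0 st]; rewrite normrZ; apply: ler_pM => //.
    by apply: vV1; rewrite s0.
  by apply: (le_trans (BM _)); rewrite ler_wpM2l// zb// s0 ltW.
have tau0 : 0 <= t1 - t0 by rewrite subr_ge0.
have mD : measurable (`[t0, t1[%classic `&` `]0, t1[%classic : set R).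
  by apply: measurableI; exact: measurable_itv.
have ipW k : ip (W gL t1) (phi k) = \int[leb]_(s in `[t0, t1[%classic `&` `]0, t1[%classic)
      (expR (- (mu k * (t1 - s))) * (v s * (expR (- (mu j * s)) * ip (B (phi j)) (phi k)))).
  rewrite /W (duhamel_restart H_hilbert phi_basis mu_ge1 _ t00 t01 t1T uL).
  apply: eq_Rintegral => s; rewrite inE/= !in_itv/= => -[_ /andP[s0 st]].
  rewrite ip_heat ?subr_ge0 ?(ltW st)// /gL ipZl /Phi heat_phi ?(ltW s0)//.
  by rewrite BZ ipZl mulNr.
(* Bounded coordinate by coordinate against [B (phi j)]: a bound on the norm alone would not pass to
   the tails. *)
have WLb k : `|ip (W gL t1) (phi k)| <= (t1 - t0) * V1 * `|ip (B (phi j)) (phi k)|.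
  rewrite /W (duhamel_restart H_hilbert phi_basis mu_ge1 _ t00 t01 t1T uL).
  have -> : (t1 - t0) * V1 * `|ip (B (phi j)) (phi k)| = V1 * `|ip (B (phi j)) (phi k)| *
      fine (leb (`[t0, t1[%classic `&` `]0, t1[%classic)).
    by rewrite leb_coo//=; ring.
  apply: Rintegral_bound => //.
  - by rewrite leb_coo// ltry.
  - apply: (usimple_measurable_ip H_hilbert).
    apply: usimple_sub (usimple_heat H_hilbert phi_basis mu_ge1 _ uL); first exact: subIsetr.
    by rewrite t1T (le_trans t00).
  - move=> s [/=]; rewrite !in_itv/= => hs /andP[s0 st].
    rewrite ip_heat ?subr_ge0 ?(ltW st)// /gL ipZl /Phi heat_phi ?(ltW s0)//.
    rewrite BZ ipZl !normrM !(ger0_norm (expR_ge0 _)).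
    have b0 := normr_ge0 (ip (B (phi j)) (phi k)).
    have x1 : expR (- (mu k * (t1 - s))) <= 1.
      rewrite expR_le1 oppr_le0 mulr_ge0 ?subr_ge0 ?(ltW st)//.
      by rewrite (le_trans _ (mu_ge1 k)).
    have x2 : expR (- mu j * s) <= 1.
      rewrite expR_le1 mulNr oppr_le0 mulr_ge0 ?(ltW s0)//.
      by rewrite (le_trans _ (mu_ge1 j)).
    rewrite -[leRHS]mul1r; apply: ler_pM => //; rewrite ?expR_ge0//.
    apply: ler_pM => //; first exact: vV1.
    by rewrite ler_piMl// expR_ge0.
(* The moment condition says that the two vectors share their first [N] coordinates, so their
   difference is that of their tails. *)
have LE : S (t1 - t0) (z t0) - W gL t1 =
    tail N (S (t1 - t0) (z t0)) - tail N (W gL t1).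
  apply: (coord_inj phi_basis) => k; rewrite ipBl [in RHS]ipBl !(ip_tailproj phi_basis).
  rewrite ip_heat//; case: (leqP N k) => kN; first by rewrite !mul1r.
  by rewrite !mul0r subrr ipW moment// subrr.
have T1 : `|tail N (S (t1 - t0) (z t0))| <= `|tail N (z t0)|.
  rewrite -[leRHS]mul1r; apply: (norm_le_coord H_hilbert phi_basis) => // k.
  rewrite !(ip_tailproj phi_basis) ip_heat//.
  case: (leqP N k) => _; rewrite ?mul0r ?normr0 ?mulr0// !mul1r normrM.
  by apply: ler_piMl => //; exact: heat_weight.
have T2 : `|tail N (W gL t1)| <= (t1 - t0) * V1 * `|tail N (B (phi j))|.
  apply: (norm_le_coord H_hilbert phi_basis) => [|k]; first by rewrite mulr_ge0.
  by rewrite !(ip_tailproj phi_basis) !normrM mulrCA ler_wpM2l.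
rewrite zE ?lexx ?t01// WE opprD addrA LE.
apply: le_trans (ler_normB _ _) _; apply: lerD => //.
by apply: le_trans (ler_normB _ _) _; exact: lerD.
Qed.

End step.

(** * Controls supported on cells, and their exponential moments *)

Lemma is_derive_expR_affine (R : realType) (m d x : R) : m != 0 ->
  is_derive x 1 (fun s => m^-1 * expR (m * s - d)) (expR (m * x - d)).
Proof.
move=> m0.
have h1 : is_derive x 1 (fun s : R => m * s - d) m.
  have h := is_deriveB (is_deriveZ m (is_derive_id x 1)) (is_derive_cst d x 1).
  by rewrite subr0 [m *: 1]mulr1 in h.
have h2 : is_derive x 1 (fun s => expR (m * s - d)) (expR (m * x - d) * m).
  exact: (@is_derive1_comp R expR (fun s => m * s - d) x _ _ (is_derive_expR _) h1).
have h := is_deriveZ m^-1 h2.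
by rewrite [_ *: _]mulrC mulfK in h.
Qed.

Lemma Rintegral_expR (R : realType) (m d a b : R) : m != 0 -> a < b ->
  \int[@lebesgue_measure R]_(s in `[a, b]) expR (m * s - d) =
  m^-1 * (expR (m * b - d) - expR (m * a - d)).
Proof.
move=> m0 ab; pose F s := m^-1 * expR (m * s - d).
have dF x := is_derive_expR_affine d x m0.
have cF (x : R) : {for x, continuous F}.
  by apply: differentiable_continuous; apply/derivable1_diffP; have [] := dF x.
rewrite /Rintegral (@continuous_FTC2 _ _ F)//.
- by rewrite /F -EFinB/= mulrBr.
- apply: continuous_subspaceT => x.
  apply: (@continuous_comp _ _ _ (fun s => m * s - d) expR); last exact: continuous_expR.
  apply: continuousB; last exact: cst_continuous.
  by apply: continuousM; [exact: cst_continuous|exact: cvg_id].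
- split.
  + by move=> x _; have [] := dF x.
  + by apply: cvg_at_right_filter; exact: cF.
  + by apply: cvg_at_left_filter; exact: cF.
- by move=> x _; rewrite derive1E; have := dF x => h; rewrite (@derive_val _ _ _ _ _ _ _ h).
Qed.

Section pulses.
Context (R : realType).
Local Notation leb := (@lebesgue_measure R).

Lemma bounded_integrable (D : set R) (f : R -> R) (C : R) : measurable D ->
  (leb D < +oo)%E -> measurable_fun D f -> (forall s, D s -> `|f s| <= C) ->
  leb.-integrable D (EFin \o f).
Proof.
move=> mD fD mf hC; apply: measurable_bounded_integrable => //.
exists C; split; first exact: num_real.
by move=> M hM s Ds; apply: le_trans (ltW hM); exact: hC.
Qed.

Lemma Rintegral_sum (D : set R) (n : nat) (f : 'I_n -> R -> R) (C : R) :
  measurable D -> (leb D < +oo)%E -> (forall i, measurable_fun D (f i)) ->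
  (forall i s, D s -> `|f i s| <= C) ->
  \int[leb]_(s in D) (\sum_(i < n) f i s) = \sum_(i < n) \int[leb]_(s in D) f i s.
Proof.
move=> mD fD; elim: n f => [|n IH] f mf hC.
  under eq_Rintegral do rewrite big_ord0.
  by rewrite Rintegral_cst// mul0r big_ord0.
under eq_Rintegral do rewrite big_ord_recr/=.
rewrite (@RintegralD _ _ _ leb)//; last 2 first.
- apply: (@bounded_integrable _ _ (n%:R * C)) => //.
    by apply: measurable_sum => i; exact: mf.
  move=> s Ds; apply: le_trans (ler_norm_sum _ _ _) _.
  rewrite mulr_natl -[n in leRHS]card_ord -sumr_const; apply: ler_sum => i _.
  exact: hC.
- by apply: (@bounded_integrable _ _ C) => //; exact: hC.
by rewrite big_ord_recr/= (IH _ (fun i => mf _) (fun i => hC _)).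
Qed.

(* The cells are numbered backwards from [t1], so that the moments of the i-th
   one carry the factor [exp (- mk h) ^ i]. *)
Definition cell (t1 h : R) (i : nat) : set R :=
  `[t1 - i.+1%:R * h, t1 - i%:R * h[%classic.

(** For [m = mu j] the exponential cancels the decay of the eigensolution, so that the moments
    involve the rates [mu k] alone, without the shift by [mu j]. *)
Definition pulse (m t1 h : R) (L : nat) (c : nat -> R) (s : R) : R :=
  \sum_(i < L) \1_(cell t1 h i) s * (c i * expR (m * s)).

Lemma measurable_cell t1 h i : measurable (cell t1 h i).
Proof. exact: measurable_itv. Qed.

Lemma cell_sub t0 t1 h (L i : nat) : 0 < h -> h * L%:R <= t1 - t0 -> (i < L)%N ->
  cell t1 h i `<=` `[t0, t1[%classic.
Proof.
move=> h0 hL iL s; rewrite /cell /= !in_itv/= => /andP[s1 s2].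
have iL' : i.+1%:R * h <= h * L%:R by rewrite mulrC ler_pM2l// ler_nat.
have i0 : 0 <= i%:R * h by rewrite mulr_ge0// ltW.
by apply/andP; split; lra.
Qed.

Lemma pulse_support m t0 t1 h L c s : 0 < h -> h * L%:R <= t1 - t0 ->
  ~~ (t0 <= s < t1) -> pulse m t1 h L c s = 0.
Proof.
move=> h0 hL hs; rewrite /pulse big1// => i _; rewrite indicE.
case: (boolP (s \in _)) => [|_]; last by rewrite mul0r.
rewrite inE => /(cell_sub h0 hL (ltn_ord i)); rewrite /= in_itv/= => h'.
by rewrite h' in hs.
Qed.

Lemma cell_inj t1 h i k s : 0 < h -> cell t1 h i s -> cell t1 h k s -> i = k.
Proof.
move=> h0; rewrite /cell /= !in_itv/= => /andP[i1 i2] /andP[k1 k2].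
have a1 : i%:R * h < k.+1%:R * h by lra.
have a2 : k%:R * h < i.+1%:R * h by lra.
rewrite ltr_pM2r// ltr_nat ltnS in a1; rewrite ltr_pM2r// ltr_nat ltnS in a2.
by apply/eqP; rewrite eqn_leq a1.
Qed.

Lemma pulse_bound m t0 t1 T h L c (A : R) s : 0 <= m -> 0 < h ->
  h * L%:R <= t1 - t0 -> t1 <= T -> 0 <= A -> (forall i, `|c i| <= A) ->
  `|pulse m t1 h L c s| <= expR (m * T) * A.
Proof.
move=> m0 h0 hL t1T A0 cA.
have RHS0 : 0 <= expR (m * T) * A by rewrite mulr_ge0// expR_ge0.
have [[i hi]|hn] := pselect (exists i : 'I_L, cell t1 h i s); last first.
  rewrite /pulse big1 ?normr0// => i _; rewrite indicE memNset ?mul0r// => hi.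
  by apply: hn; exists i.
rewrite /pulse (bigD1 i)//= big1 ?addr0; last first.
  move=> k ki; rewrite indicE memNset ?mul0r// => hk.
  by move/eqP: ki; apply; apply/val_inj; exact: cell_inj h0 hk hi.
rewrite indicE mem_set// mul1r normrM (ger0_norm (expR_ge0 _)) mulrC.
apply: ler_pM => //.
rewrite ler_expR ler_wpM2l//.
have := cell_sub h0 hL (ltn_ord i) hi; rewrite /= in_itv/= => /andP[_ st].
by rewrite (le_trans (ltW st)).
Qed.

Lemma ucont_expR (H : completeNormedModType R) (m T : R) (x : H) : 0 <= m ->
  ucont T (fun s => expR (m * s) *: x).
Proof.
move=> m0 e e0; pose K := expR (m * T) * m * `|x|.
have K0 : 0 <= K by rewrite /K !mulr_ge0// expR_ge0.
exists (e / (K + 1)); first by rewrite divr_gt0// ltr_wpDl.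
move=> s t; wlog st : s t / s <= t.
  move=> W hs ht; case: (leP s t) => st; first exact: W.
  by rewrite distrC => h; rewrite distrC; apply: W => //; exact: ltW.
move=> /andP[s0 sT] /andP[t0 tT]; rewrite distrC ger0_norm ?subr_ge0// => std.
rewrite distrC -scalerBl normrZ ger0_norm; last first.
  by rewrite subr_ge0 ler_expR ler_wpM2l.
have a1 : expR (m * t) - expR (m * s) <= expR (m * T) * (m * (t - s)).
  have -> : expR (m * s) = expR (m * t) * expR (- (m * (t - s))).
    by rewrite -expRD; congr expR; ring.
  rewrite -[X in X - _]mulr1 -mulrBr.
  have b1 : 1 - expR (- (m * (t - s))) <= m * (t - s).
    by have := expR_ge1Dx (- (m * (t - s))); lra.
  have b2 : expR (m * t) <= expR (m * T) by rewrite ler_expR ler_wpM2l.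
  apply: (le_trans (ler_wpM2l (expR_ge0 _) b1)).
  by rewrite ler_wpM2r// mulr_ge0// subr_ge0.
apply: (@le_trans _ _ (K * (t - s))).
  have -> : K * (t - s) = expR (m * T) * (m * (t - s)) * `|x| by rewrite /K; ring.
  by rewrite ler_wpM2r.
have ts0 : 0 <= t - s by rewrite subr_ge0.
have K1 : 0 < K + 1 by lra.
by move: std; rewrite ltr_pdivlMr//; nra.
Qed.

Lemma usimple_restrict (H : completeNormedModType R) (D A : set R) (f : R -> H) :
  measurable A -> usimple D f -> usimple D (fun s => \1_A s *: f s).
Proof.
move=> mA uf e /uf[g sg hg]; exists (fun s => \1_A s *: g s).
  exact: is_simple_restrict.
move=> s Ds; rewrite -scalerBr normrZ indicE; case: (_ \in _).
  by rewrite normr1 mul1r hg.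
by rewrite normr0 mul0r (le_trans (normr_ge0 _) (hg s Ds)).
Qed.

Lemma pulse_usimple (H : completeNormedModType R) m T t1 h L c (x : H) : 0 <= m ->
  usimple `]0, T[%classic (fun s => pulse m t1 h L c s *: x).
Proof.
move=> m0.
apply: (@usimple_ext _ _ _ (fun s => \sum_(i < L) \1_(cell t1 h i) s *: (expR (m * s) *: (c i *: x)))).
  move=> s _; rewrite /pulse scaler_suml; apply: eq_bigr => i _.
  by rewrite !scalerA; congr (_ *: _); ring.
elim: L => [|L IH].
  apply: (@usimple_ext _ _ _ (fun=> 0)); first by move=> s _; rewrite big_ord0.
  by apply: usimple_simple; exact: is_simple0.
apply: (@usimple_ext _ _ _ (fun s => \sum_(i < L) \1_(cell t1 h i) s *: (expR (m * s) *: (c i *: x)) +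
   \1_(cell t1 h L) s *: (expR (m * s) *: (c L *: x)))).
  by move=> s _; rewrite big_ord_recr.
apply: usimpleD => //; apply: usimple_restrict; first exact: measurable_cell.
by apply: ucont_usimple; exact: ucont_expR.
Qed.

Lemma Rintegral_cell (mk t0 t1 h : R) (L i : nat) : 0 < mk -> 0 <= t0 -> 0 < h ->
  h * L%:R <= t1 - t0 -> (i < L)%N ->
  \int[leb]_(s in `[t0, t1[%classic `&` `]0, t1[%classic)
    (\1_(cell t1 h i) s * expR (- (mk * (t1 - s)))) =
  expR (- (mk * h)) ^+ i * ((1 - expR (- (mk * h))) / mk).
Proof.
move=> mk0 t00 h0 hL iL; set D := _ `&` _.
set f := fun s : R => expR (mk * s - mk * t1).
pose p := t1 - i.+1%:R * h; pose q := t1 - i%:R * h.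
have pq : p < q by rewrite /p /q -natr1 mulrDl mul1r; lra.
have p0 : t0 <= p.
  have : i.+1%:R * h <= h * L%:R by rewrite mulrC ler_pM2l// ler_nat.
  by rewrite /p; lra.
have qt : q <= t1 by rewrite /q gerBl mulr_ge0// ltW.
have -> : \int[leb]_(s in D) (\1_(cell t1 h i) s * expR (- (mk * (t1 - s)))) =
    \int[leb]_(s in D `&` cell t1 h i) f s.
  rewrite [RHS](@Rintegral_mkcondr _ _ _ leb D (cell t1 h i)); apply: eq_Rintegral => s _.
  rewrite /patch indicE /f; case: (_ \in _); rewrite ?mul0r// mul1r.
  by congr expR; ring.
have mf A : measurable_fun A f.
  apply: measurableT_comp; first exact: measurable_expR.
  by apply: measurable_funB; [apply: measurable_funM|]; exact: measurable_cst || exact: measurable_id.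
have fI (b1 b2 : bool) : leb.-integrable [set` Interval (BSide b1 p) (BSide b2 q)] (EFin \o f).
  apply: (@bounded_integrable _ _ (expR (mk * q))) => //.
  - by rewrite lebesgue_measure_itv/=; case: ifP => _; rewrite ?ltry// -EFinB ltry.
  - move=> s; rewrite /= => hs; rewrite /f ger0_norm ?expR_ge0// ler_expR.
    have : s <= q by case: b2 hs; rewrite itv_boundlr => /andP[_]; rewrite bnd_simp// => /ltW.
    move=> sq; have := ler_wpM2l (ltW mk0) sq.
    have : 0 <= mk * t1 by rewrite mulr_ge0 ?ltW//; lra.
    lra.
have main : \int[leb]_(s in `[p, q]) f s =
    expR (- (mk * h)) ^+ i * ((1 - expR (- (mk * h))) / mk).
  rewrite Rintegral_expR ?gt_eqF// -!expRM_natl.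
  have -> : mk * q - mk * t1 = i%:R * - (mk * h) by rewrite /q; ring.
  have -> : mk * p - mk * t1 = i%:R * - (mk * h) + - (mk * h).
    by rewrite /p -natr1; ring.
  by rewrite expRD; field; rewrite gt_eqF.
rewrite -main.
(* A cell that starts at [0] loses its left endpoint in the domain of integration; otherwise it lies
   entirely inside. *)
have [pz|pz] := eqVneq p 0.
  have -> : D `&` cell t1 h i = `]p, q[%classic.
    apply/seteqP; split => s; rewrite /D /cell /= !in_itv/= -/p -/q.
      by move=> [[_ /andP[s0 _]] /andP[_ sq]]; rewrite pz s0.
    move=> /andP[sp sq]; split; last by rewrite (ltW sp).
    by split; apply/andP; split; lra.
  rewrite Rintegral_itv_obnd_cbnd; last exact: (fI false true).
  by rewrite Rintegral_itv_bndo_bndc//; exact: (fI true true).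
have -> : D `&` cell t1 h i = `[p, q[%classic.
  apply/seteqP; split => s; rewrite /D /cell /= !in_itv/= -/p -/q.
    by move=> [_].
  move=> /andP[sp sq]; split; last by rewrite sp.
  have pp : 0 < p by rewrite lt_neqAle eq_sym pz; lra.
  by split; apply/andP; split; lra.
by rewrite Rintegral_itv_bndo_bndc//; exact: (fI true true).
Qed.

Lemma pulse_moment (mk m b t0 t1 h : R) (L : nat) (c : nat -> R) :
  0 < mk -> 0 <= t0 -> t0 <= t1 -> 0 < h -> h * L%:R <= t1 - t0 ->
  \int[leb]_(s in `[t0, t1[%classic `&` `]0, t1[%classic)
     (expR (- (mk * (t1 - s))) * (pulse m t1 h L c s * (expR (- (m * s)) * b))) =
  (\sum_(i < L) c i * expR (- (mk * h)) ^+ i) * ((1 - expR (- (mk * h))) / mk) * b.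
Proof.
move=> mk0 t00 t01 h0 hL; set D := _ `&` _.
have mD : measurable D by apply: measurableI; exact: measurable_itv.
have fD : (leb D < +oo)%E by rewrite leb_coo// ltry.
pose f (i : 'I_L) s := c i * b * (\1_(cell t1 h i) s * expR (- (mk * (t1 - s)))).
have -> : \int[leb]_(s in D)
     (expR (- (mk * (t1 - s))) * (pulse m t1 h L c s * (expR (- (m * s)) * b))) =
    \int[leb]_(s in D) \sum_(i < L) f i s.
  apply: eq_Rintegral => s _; rewrite /pulse mulr_suml mulr_sumr.
  apply: eq_bigr => i _; rewrite /f -[RHS]mulr1 -(expRxMexpNx_1 (m * s)); ring.
have mg (i : 'I_L) : measurable_fun D (fun s => \1_(cell t1 h i) s * expR (- (mk * (t1 - s)))).
  apply: measurable_funM; first exact: measurable_indic (measurable_cell _ _ _).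
  apply: measurableT_comp; first exact: measurable_expR.
  apply: measurable_funN; apply: measurable_funM; first exact: measurable_cst.
  by apply: measurable_funB; [exact: measurable_cst|exact: measurable_id].
have gb (i : 'I_L) s : D s -> `|\1_(cell t1 h i) s * expR (- (mk * (t1 - s)))| <= 1.
  rewrite /D /= !in_itv/= => -[_ /andP[_ st]].
  rewrite normrM (ger0_norm (expR_ge0 _)) -[leRHS]mul1r; apply: ler_pM; rewrite ?expR_ge0//.
    by rewrite indicE; case: (_ \in _); rewrite ?normr1 ?normr0.
  by rewrite expR_le1 oppr_le0 mulr_ge0 ?subr_ge0 ?ltW.
rewrite (@Rintegral_sum _ _ _ (\sum_(i < L) `|c i * b|))//; last 2 first.
- move=> i; apply: measurable_funM; first exact: measurable_cst.
  exact: mg.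
- move=> i s Ds; rewrite /f normrM.
  apply: (@le_trans _ _ (`|c i * b| * 1)); first by rewrite ler_wpM2l// gb.
  by rewrite mulr1 (bigD1 i)//= lerDl sumr_ge0.
rewrite !mulr_suml; apply: eq_bigr => i _.
rewrite /f (@RintegralZl _ _ _ leb)//; last first.
  by apply: (@bounded_integrable _ _ 1) => //; exact: gb.
by rewrite (@Rintegral_cell _ _ _ _ L)//; ring.
Qed.

End pulses.

(** * The iteration *)

Lemma bernoulli_ge (R : realType) (w : R) (n : nat) : -1 <= w ->
  1 + n%:R * w <= (1 + w) ^+ n.
Proof.
move=> w1; elim: n => [|n IH]; first by rewrite mul0r addr0 expr0.
have h0 : 0 <= 1 + w by lra.
have := ler_wpM2l h0 IH; rewrite -exprS; apply: le_trans.
have : 0 <= n%:R * w ^+ 2 by rewrite mulr_ge0// sqr_ge0.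
rewrite -natr1; lra.
Qed.

Lemma expR_small (R : realType) (c e : R) : 0 < c -> 0 < e ->
  exists n, expR (- (c * (3 / 2) ^+ n)) <= e.
Proof.
move=> c0 e0; exists (Num.bound (2 / (c * e))); set n := Num.bound _.
have hn : 2 / (c * e) < n%:R.
  by apply: archi_boundP; rewrite divr_ge0// ltW// mulr_gt0.
have b := @bernoulli_ge R (1 / 2) n ltac:(lra).
have -> : 3 / 2 = 1 + 1 / 2 :> R by field.
rewrite expRN -[e]invrK lef_pV2 ?posrE ?expR_gt0 ?invr_gt0//.
apply: le_trans (le_expR _).
rewrite ltr_pdivrMr ?mulr_gt0// in hn.
rewrite -[e^-1]mul1r ler_pdivrMr//.
have := ler_wpM2l (ltW (mulr_gt0 c0 e0)) b; nra.
Qed.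

(* The intervals shrink geometrically, with ratio [beta] so close to 1 that the
   cost [exp (K0 / length ^ G)] of the n-th step is at most
   [exp (K1 (3 / 2) ^ n)]; squaring [exp (- D (3 / 2) ^ n)] beats it. *)
Lemma schedule (R : realType) (T M A K0 : R) (G : nat) :
  0 < T -> 0 <= M -> 1 <= A -> 0 < K0 ->
  exists (tn eps kn : nat -> R) (V : R),
  [/\ [/\ tn 0%N = 0, forall n, tn n < tn n.+1, forall n, tn n < T &
         forall e, 0 < e -> exists n, T - e < tn n],
      [/\ forall n, tn n.+1 - tn n <= 1,
         forall n, expR (K0 / (tn n.+1 - tn n) ^+ G) <= kn n,
         forall n, 1 <= kn n & forall n, 0 < eps n],
      [/\ V * M * T <= 1 / 2, forall n, A * (kn n * eps n) <= V,
         forall n, kn n.+1 * eps n.+1 <= kn n * eps n &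
         forall e, 0 < e -> exists n, kn n * eps n <= e] &
      (forall n, 4 * (T * M * A * (1 + T * M * A)) * (kn n * eps n) ^+ 2 <= eps n.+1)
      /\ forall e, 0 < e -> exists n, forall m, (n <= m)%N -> eps m <= e].
Proof.
move=> T0 M0 A1 K00.
(* Gives [T * w <= 1], hence steps of length at most 1, and [G * w <= 1/3], hence [be ^+ G >= 2/3]
   by Bernoulli: the exponent of the cost grows at most by [3/2] per step. *)
pose w := (3 * G%:R + T + 1)^-1.
have G0 : 0 <= G%:R :> R by [].
have w0 : 0 < w by rewrite invr_gt0; lra.
have wE : w * (3 * G%:R + T + 1) = 1 by rewrite mulVf// gt_eqF//; lra.
have w1 : w < 1 by rewrite invf_lt1; lra.
have wT : T * w <= 1 by nra.
have wG : G%:R * w <= 1 / 3 by nra.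
pose be := 1 - w; have be0 : 0 < be by rewrite /be; lra.
have be1 : be < 1 by rewrite /be; lra.
have beG : 2 / 3 <= be ^+ G.
  have := @bernoulli_ge R (- w) G ltac:(lra); rewrite /be; lra.
pose tn n := T * (1 - be ^+ n).
have dtn n : tn n.+1 - tn n = T * w * be ^+ n.
  by rewrite /tn exprS /be; ring.
have Tw0 : 0 < T * w by rewrite mulr_gt0.
have p0 n : 0 < be ^+ n by rewrite exprn_gt0.
pose K1 := K0 / (T * w) ^+ G.
have K10 : 0 < K1 by rewrite divr_gt0// exprn_gt0.
pose x n : R := (3 / 2) ^+ n.
have x0 n : 0 < x n by rewrite exprn_gt0// divr_gt0.
have x1 n : 1 <= x n by apply: exprn_ege1; lra.
have xS n : x n.+1 = 3 / 2 * x n by rewrite /x exprS.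
pose kn n := expR (K1 * x n).
pose Q := T * M * A.
have Q0 : 0 <= Q by rewrite /Q !mulr_ge0 ?(ltW T0)//; lra.
pose V := (2 * (M * T + 1))^-1.
have MT0 : 0 <= M * T by rewrite mulr_ge0// ltW.
have V0 : 0 < V by rewrite invr_gt0; lra.
have VE : V * (2 * (M * T + 1)) = 1 by rewrite mulVf// gt_eqF//; lra.
have AV0 : 0 < A / V by rewrite divr_gt0//; lra.
(* The first two terms give [2 (D - K1) >= (3/2) D + 4 Q (1 + Q)], which is the quadratic recursion
   including its constant; the last one keeps the controls below [V]. *)
pose D := 8 * (Q * (1 + Q)) + 4 * K1 + A / V.
have QQ : 0 <= Q * (1 + Q) by rewrite mulr_ge0//; lra.
have DK : K1 < D by rewrite /D; lra.
pose eps n := expR (- (D * x n)).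
have ke n : kn n * eps n = expR (- ((D - K1) * x n)).
  by rewrite /kn /eps -expRD; congr expR; ring.
exists tn, eps, kn, V; split; split.
- by rewrite /tn expr0 subrr mulr0.
- by move=> n; rewrite -subr_gt0 dtn mulr_gt0.
- by move=> n; rewrite /tn gtr_pMr// ltrBlDr ltrDl.
- move=> e e0.
  have cb : be ^+ n @[n --> \oo] --> (0 : R) by apply: cvg_expr; rewrite gtr0_norm.
  have eT : 0 < e / T by rewrite divr_gt0.
  have [n _ hn] := (cvgrPdist_lt _ _).1 cb _ eT; exists n.
  have := hn n (leqnn n); rewrite /= sub0r normrN (gtr0_norm (p0 n)) ltr_pdivlMr//.
  by rewrite /tn; lra.
- move=> n; rewrite dtn -[leRHS]mulr1; apply: ler_pM => //; rewrite ?(ltW Tw0) ?(ltW (p0 _))//.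
  by rewrite exprn_ile1// ltW.
- move=> n; rewrite ler_expR dtn exprMn invfM mulrA -/K1 ler_pM2l//.
  rewrite exprAC /x -exprVn lerXn2r ?nnegrE ?invr_ge0 ?divr_ge0 ?(ltW (p0 G))//.
  by rewrite -[3 / 2]invrK lef_pV2 ?posrE ?invr_gt0 ?divr_gt0 ?p0// invf_div.
- by move=> n; rewrite -[leLHS]expR0 ler_expR mulr_ge0// ltW.
- by move=> n; exact: expR_gt0.
- by have := mulr_ge0 (ltW V0) MT0; lra.
- move=> n; rewrite ke expRN ler_pdivrMr ?expR_gt0//.
  rewrite mulrC -ler_pdivrMr//; apply: le_trans (le_expR _).
  have : A / V * 1 <= (D - K1) * x n.
    by apply: ler_pM => //; rewrite ?(ltW AV0)// /D; lra.
  by rewrite mulr1.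
- move=> n; rewrite !ke ler_expR lerN2 xS.
  have : 0 <= (D - K1) * x n by rewrite mulr_ge0 ?(ltW (x0 n))//; lra.
  lra.
- move=> e e0; have [n hn] := @expR_small R (D - K1) e ltac:(lra) e0.
  by exists n; rewrite ke.
- move=> n; rewrite ke -expRM_natl.
  have h : 4 * (Q * (1 + Q)) <= expR (4 * (Q * (1 + Q)) * x n).
    apply: (le_trans (le_expR _)); rewrite ler_expR ler_peMr//; lra.
  apply: (le_trans (ler_wpM2r (expR_ge0 _) h)).
  rewrite -expRD ler_expR xS.
  have := mulr_ge0 QQ (ltW (x0 n)); have := mulr_ge0 (ltW K10) (ltW (x0 n)).
  have := mulr_ge0 (ltW AV0) (ltW (x0 n)); rewrite /D; lra.
- move=> e e0; have [n hn] := @expR_small R D e ltac:(lra) e0.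
  exists n => m nm; apply: le_trans hn; rewrite ler_expR lerN2 ler_pM2l; last by lra.
  by apply: ler_weXn2l => //; lra.
Qed.

Lemma usimple_closed (R : realType) (H : completeNormedModType R) (D : set R) (f : R -> H) :
  (forall e, 0 < e -> exists g, usimple D g /\ forall s, D s -> `|f s - g s| <= e) ->
  usimple D f.
Proof.
move=> h e e0; have e2 : 0 < e / 2 by rewrite divr_gt0.
have [g [ug hg]] := h _ e2; have [g' sg hg'] := ug _ e2.
exists g' => // s Ds; apply: le_trans (ler_distD (g s) _ _) _.
by have := hg s Ds; have := hg' s Ds; lra.
Qed.

Section local_control.
Context (R : realType) (H : completeNormedModType R)
  (ip : {dot H for (idfun : R -> R)}) (phi : nat -> H) (mu : nat -> R)
  (B : {linear H -> H}) (M T : R) (j : nat) (K0 : R) (G : nat).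
Hypotheses (H_hilbert : norm_of_dot ip) (phi_basis : hilbert_basis ip phi)
  (mu_ge1 : forall k, 1 <= mu k) (M0 : 0 <= M) (BM : forall x, `|B x| <= M * `|x|)
  (T0 : 0 < T) (K00 : 0 < K0)
  (moments : forall (t : R) (N : nat) (x : nat -> R) (e : R), 0 < t <= 1 -> 0 <= e ->
      (forall k, `|x k| <= e) ->
    exists (h : R) (L : nat) (c : nat -> R),
    [/\ 0 < h, h * L%:R <= t, forall i, `|c i| <= expR (K0 / t ^+ G) * e &
      forall k, (k < N)%N ->
      (\sum_(i < L) c i * expR (- (mu k * h)) ^+ i) *
        ((1 - expR (- (mu k * h))) / mu k) * ip (B (phi j)) (phi k) =
      expR (- (mu k * t)) * x k]).
Local Notation leb := (@lebesgue_measure R).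
Local Notation S := (heat ip phi mu).
Local Notation mild := (mild phi mu B T H_hilbert).
Local Notation tail := (tailproj ip phi).

Lemma small_tail x (e : R) : 0 < e ->
  exists n, forall m, (n <= m)%N -> `|tail m x| <= e.
Proof.
move=> e0.
have [n _ hn] := (cvgrPdist_le _ _).1 (@cvg_tailproj _ _ _ _ H_hilbert phi_basis x) _ e0.
by exists n => m /hn /=; rewrite sub0r normrN.
Qed.

(** The new control coincides with [v] before [t0], so by causality the state at [t0] is known
    before the moment problem is posed. [N] is then taken from the tails of that state and of
    [B (phi j)]: each contributes a quarter of [e'], and the quadratic term at most the other
    half. *)
Lemma next_control (V k e e' t0 t1 : R) (v : R -> R) (x : H) :
  let A := expR (mu j * T) in let Q := T * M * A in
  admissible H T V v -> V * M * T <= 1 / 2 -> 0 <= t0 -> t0 < t1 -> t1 <= T ->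
  t1 - t0 <= 1 -> (forall s, t0 <= s -> v s = 0) ->
  (forall psi, mild v x psi -> `|psi t0 - S t0 (phi j)| <= e) ->
  0 < e -> 0 < e' -> 1 <= k -> expR (K0 / (t1 - t0) ^+ G) <= k ->
  A * (k * e) <= V -> 4 * (Q * (1 + Q)) * (k * e) ^+ 2 <= e' ->
  exists w, [/\ admissible H T V w, forall s, s < t0 -> w s = v s,
    forall s, t1 <= s -> w s = 0, forall s, t0 <= s -> `|w s| <= A * (k * e) &
    forall psi, mild w x psi -> `|psi t1 - S t1 (phi j)| <= e'].
Proof.
move=> A Q av small t00 t01 t1T len v0 hv e0 e'0 k1 hk hV he'.
have mj0 : 0 <= mu j by apply: le_trans (mu_ge1 j).
have tau0 : 0 < t1 - t0 by rewrite subr_gt0.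
have T0' := ltW T0.
have [psi0 mpsi0] := picard H_hilbert phi_basis mu_ge1 M0 BM T0' x av small.
set z0 := psi0 t0 - S t0 (phi j).
have hz0 : `|z0| <= e by exact: hv.
have [vV uv] := av; have V0 := le_trans (normr_ge0 _) (vV 0).
have TV : 0 < 4 * (T * V + 1) by rewrite mulr_gt0// ltr_wpDl// mulr_ge0.
have [n1 hn1] := @small_tail z0 (e' / 4) ltac:(lra).
have [n2 hn2] := @small_tail (B (phi j)) (e' / (4 * (T * V + 1))) ltac:(by rewrite divr_gt0).
pose N := maxn n1 n2.
have xk l : `|ip z0 (phi l)| <= e.
  apply: (le_trans (cauchy_schwarz H_hilbert _ _)).
  by rewrite (ip_phi_phi H_hilbert phi_basis) mulr1.
have [|h [L [c [h0 hL cb hc]]]] := @moments (t1 - t0) N (fun l => ip z0 (phi l)) e _ (ltW e0) xk.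
  by rewrite tau0.
pose p := pulse (mu j) t1 h L c.
have p_out s : ~~ (t0 <= s < t1) -> p s = 0 by exact: pulse_support.
have pb s : `|p s| <= A * (k * e).
  apply: (@pulse_bound _ _ t0) => //; first by rewrite mulr_ge0 ?(ltW e0)//; lra.
  by move=> i; apply: (le_trans (cb i)); rewrite ler_wpM2r// ltW.
pose w s := v s + p s.
have wlt s : s < t0 -> w s = v s.
  by move=> st; rewrite /w p_out ?addr0// negb_and -ltNge st.
have wge s : t0 <= s -> w s = p s by move=> st; rewrite /w v0// add0r.
have wb s : t0 <= s -> `|w s| <= A * (k * e) by move=> /wge ->; exact: pb.
have aw : admissible H T V w.
  split.
    by move=> s; case: (ltP s t0) => st; [rewrite wlt|apply: le_trans (wb s st) hV].
  move=> y; apply: (@usimple_ext _ _ _ (fun s => v s *: y + p s *: y)).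
    by move=> s _; rewrite /w scalerDl.
  by apply: usimpleD => //; exact: pulse_usimple.
exists w; split => //.
  move=> s st; rewrite wge; last by apply: le_trans st; exact: ltW.
  by rewrite p_out// negb_and -(leNgt t1) st orbT.
move=> psi mpsi.
have e00 : psi t0 = psi0 t0.
  apply: (mild_unique phi_basis mu_ge1 M0 BM aw small av mpsi mpsi0 (t1 := t0)).
  - by apply/andP; split; lra.
  - by move=> s /andP[_ st]; exact: wlt.
  - by rewrite t00 lexx.
set V1 := A * (k * e) in pb wb hV.
have A0 : 0 < A by exact: expR_gt0.
have y0 : 0 < k * e by rewrite mulr_gt0//; lra.
have V10 : 0 <= V1 by rewrite /V1 mulr_ge0// ltW.
have tauT : t1 - t0 <= T by lra.
have q1 : (t1 - t0) * V1 * M <= T * V1 * M.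
  by rewrite ler_wpM2r// ler_wpM2r.
have q2 : T * V1 * M <= 1 / 2.
  apply: le_trans _ small; have -> : T * V1 * M = V1 * (M * T) by ring.
  by rewrite -[leRHS]mulrA ler_wpM2r// mulr_ge0.
have zt0 : `|psi t0 - S t0 (phi j)| <= e by rewrite e00.
have := step_estimate phi_basis mu_ge1 M0 BM (N := N) (j := j) aw mpsi t00 (ltW t01) t1T
  (fun s => (fun hs : t0 <= s < t1 => wb s (proj1 (andP hs)))) (le_trans q1 q2) V10 zt0.
move=> /(_ _)/le_trans; apply.
  move=> l lN; rewrite e00 -/z0 -hc//.
  rewrite -(@pulse_moment _ (mu l) (mu j) _ t0 t1 h L c)//; last 2 first.
  - by apply: lt_le_trans (mu_ge1 l).
  - exact: ltW.
  apply: eq_Rintegral => s; rewrite inE/= !in_itv/= => -[/andP[st _] _].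
  by rewrite wge.
rewrite e00 -/z0.
have r1 : `|tail N z0| <= e' / 4 by apply: hn1; rewrite leq_maxl.
have r2 : (t1 - t0) * V1 * `|tail N (B (phi j))| <= e' / 4.
  apply: (@le_trans _ _ (T * V * (e' / (4 * (T * V + 1))))).
    apply: ler_pM => //; first by rewrite mulr_ge0// ltW.
      by apply: ler_pM => //; exact: ltW.
    by apply: hn2; rewrite leq_maxr.
  have TV0 : 0 <= T * V by rewrite mulr_ge0.
  have -> : T * V * (e' / (4 * (T * V + 1))) = e' / 4 * (T * V / (T * V + 1)).
    by field; lra.
  rewrite ler_piMr//; first by lra.
  by rewrite ler_pdivrMr; lra.
set q := (t1 - t0) * V1 * M in q1 *.
have q0 : 0 <= q := mulr_ge0 (mulr_ge0 (ltW tau0) V10) M0.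
have qQ : q <= Q * (k * e).
  by apply: (le_trans q1); rewrite /Q /V1 le_eqVlt; apply/orP; left; apply/eqP; ring.
have Q0 : 0 <= Q := mulr_ge0 (mulr_ge0 T0' M0) (ltW A0).
(* With [k >= 1] the deviation is dominated by [k * e], so the whole quadratic term is measured in
   this single quantity. *)
have ey : e <= k * e by rewrite ler_peMl// ltW.
have r3 : q * (2 * (e + q)) <= 2 * (Q * (1 + Q)) * (k * e) ^+ 2.
  have -> : 2 * (Q * (1 + Q)) * (k * e) ^+ 2 =
      (Q * (k * e)) * (2 * (k * e + Q * (k * e))) by ring.
  apply: ler_pM => //; last by lra.
  by rewrite mulr_ge0// addr_ge0// ltW.
lra.
Qed.

Theorem local_control : exists2 r : R, 0 < r & forall x : H, `|x - phi j| < r ->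
  exists2 v : R -> R, square_integrable T v &
  exists2 psi : R -> H, mild_solution (diagonal_operator ip phi mu) B T v x psi &
    psi T = eigensolution mu phi j T.
Proof.
have T0' := ltW T0.
have mj0 : 0 <= mu j by apply: le_trans (mu_ge1 j).
pose A := expR (mu j * T).
have A1 : 1 <= A by rewrite -[leLHS]expR0 ler_expR mulr_ge0.
have A0 : 0 < A by exact: expR_gt0.
have [tn [eps [kn [V [[tn0 tnS tnT tnc] [len hk k1 eps0] [small hV anti vsmall] [quad epsc]]]]]] :=
  schedule G T0 M0 A1 K00.
exists (eps 0%N) => // x hx.
have V0 : 0 <= V.
  by apply: le_trans (hV 0%N); rewrite !mulr_ge0 ?(ltW A0) ?(ltW (eps0 _))// (le_trans ler01 (k1 _)).
have tn_ge0 n : 0 <= tn n.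
  by elim: n => [|n IH]; [rewrite tn0|exact: le_trans IH (ltW (tnS n))].
have tn_mono m n : (m <= n)%N -> tn m <= tn n.
  by elim: n => [|n IH]; [rewrite leqn0 => /eqP ->|rewrite leq_eqVlt => /predU1P[->//|/IH/le_trans]; apply; exact: ltW].
have yanti m n : (m <= n)%N -> kn n * eps n <= kn m * eps m.
  elim: n => [|n IH]; first by rewrite leqn0 => /eqP ->.
  by rewrite leq_eqVlt => /predU1P[->//|/IH]; apply: le_trans.
(* The deviation is bounded for every mild solution, so the recursion carries controls only and no
   trajectories. *)
pose inv n v := [/\ admissible H T V v, forall s, tn n <= s -> v s = 0 &
  forall psi, mild v x psi -> `|psi (tn n) - S (tn n) (phi j)| <= eps n].
pose next n v w := [/\ inv n.+1 w, forall s, s < tn n -> w s = v s &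
  forall s, tn n <= s -> `|w s| <= A * (kn n * eps n)].
have ex n v : exists w, inv n v -> next n v w.
  have [[av vz hv]|h] := pselect (inv n v); last by exists v.
  have [w [aw w1 w2 w3 w4]] := next_control av small (tn_ge0 n) (tnS n) (ltW (tnT _)) (len n)
    vz hv (eps0 n) (eps0 n.+1) (k1 n) (hk n) (hV n) (quad n).
  by exists w => _; split.
pose vs := fix vs n := if n is n'.+1 then sval (cid (ex n' (vs n'))) else (fun=> 0 : R).
have zero_adm : admissible H T V (fun=> 0).
  split; first by move=> s; rewrite normr0.
  move=> c; apply: (@usimple_ext _ _ _ (fun=> 0)); first by move=> s _; rewrite scale0r.
  by apply: usimple_simple; exact: is_simple0.
have inv0 : inv 0%N (fun=> 0).
  split => // psi [_ hpsi]; rewrite tn0 hpsi ?lexx//.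
  rewrite !(heat0 H_hilbert phi_basis mu_ge1) (@duhamel0 _ _ _ _ _ H_hilbert phi_basis mu_ge1 T)//; last first.
    apply: (@usimple_ext _ _ _ (fun=> 0)); first by move=> s _; rewrite scale0r.
    by apply: usimple_simple; exact: is_simple0.
  by rewrite subr0 ltW.
have invn n : inv n (vs n).
  elim: n => [|n IH]; first exact: inv0.
  by have [] := svalP (cid (ex n (vs n))) IH.
have nextn n : next n (vs n) (vs n.+1) by exact: (svalP (cid (ex n (vs n))) (invn n)).
have agree m n s : s < tn m -> (m <= n)%N -> vs n s = vs m s.
  move=> sm; elim: n => [|n IH]; first by rewrite leqn0 => /eqP ->.
  rewrite leq_eqVlt => /predU1P[<-//|mn]; rewrite -IH//.
  have [_ h _] := nextn n; apply: h; exact: lt_le_trans sm (tn_mono m n mn).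
have late m n s : tn m <= s -> `|vs n s| <= A * (kn m * eps m).
  have RH0 : 0 <= A * (kn m * eps m).
    by rewrite !mulr_ge0 ?(ltW A0) ?(ltW (eps0 _))// (le_trans ler01 (k1 _)).
  move=> ms; elim: n => [|n IH]; first by rewrite normr0.
  have [[_ vz _] h1 h2] := nextn n.
  case: (ltP s (tn n)) => sn; first by rewrite h1.
  case: (leqP m n) => mn; first by apply: (le_trans (h2 s sn)); rewrite ler_pM2l// yanti.
  by rewrite vz ?normr0// (le_trans (tn_mono _ _ mn)).
(* The controls [vs n] are stationary at each time before [T]; the value [0] is taken where no
   [tn n] exceeds [s]. *)
have /choice[v hv] : forall s, exists a, (forall n, s < tn n -> a = vs n s) /\
    ((forall n, tn n <= s) -> a = 0).
  move=> s; have [[n sn]|h] := pselect (exists n, s < tn n); last first.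
    by exists 0; split => // n sn; exfalso; apply: h; exists n.
  exists (vs n s); split; last by move=> /(_ n); rewrite leNgt sn.
  move=> m sm; case: (leqP m n) => mn; first exact: agree.
  by apply/esym/agree => //; exact: ltnW.
have vlate m s : tn m <= s -> `|v s| <= A * (kn m * eps m).
  move=> ms; have [h1 h2] := hv s.
  have [[n sn]|h] := pselect (exists n, s < tn n); first by rewrite (h1 n)// late.
  rewrite h2 ?normr0; last by move=> n; rewrite leNgt; apply/negP => sn; apply: h; exists n.
  by rewrite !mulr_ge0 ?(ltW A0) ?(ltW (eps0 _))// (le_trans ler01 (k1 _)).
have av : admissible H T V v.
  split.
    move=> s; case: (ltP s (tn 0%N)) => s0.
      by have [h1 _] := hv s; rewrite (h1 0%N)// normr0.
    by apply: le_trans (vlate _ _ s0) (hV 0%N).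
  (* [vs n] equals [v] before [tn n] and vanishes afterwards, where [v] is small: convergence is
     uniform because the controls tend to 0. *)
  move=> c; apply: usimple_closed => e e0.
  have c0 : 0 < A * (`|c| + 1) by rewrite mulr_gt0// ltr_wpDl.
  have [n hn] := vsmall (e / (A * (`|c| + 1))) (divr_gt0 e0 c0).
  exists (fun s => vs n s *: c); split; first by have [[_ h] _ _] := invn n; exact: h.
  move=> s _; rewrite -scalerBl normrZ.
  case: (ltP s (tn n)) => sn.
    by have [h1 _] := hv s; rewrite (h1 n)// subrr normr0 mul0r ltW.
  have [_ vz _] := invn n; rewrite vz// subr0.
  apply: (@le_trans _ _ (A * (kn n * eps n) * (`|c| + 1))).
    by apply: ler_pM => //; [exact: vlate|rewrite lerDl].
  by rewrite ler_pdivlMr// in hn; apply: le_trans hn; rewrite le_eqVlt; apply/orP; left; apply/eqP; ring.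
have [psi mpsi] := picard H_hilbert phi_basis mu_ge1 M0 BM T0' x av small.
exists v.
  (* Scalar measurability is recovered by pairing [v s *: phi 0] with the unit vector [phi 0]. *)
  have mv : measurable_fun `]0, T[%classic v.
    have [_ uv] := av.
    have h : measurable_fun `]0, T[%classic (fun s => ip (v s *: phi 0%N) (phi 0%N)).
      exact: (usimple_measurable_ip H_hilbert (phi 0%N) (uv (phi 0%N))).
    rewrite (_ : v = fun s => ip (v s *: phi 0%N) (phi 0%N))//.
    by apply/funext => s; rewrite ipZl phi_basis.1 eqxx mulr1.
  split => //.
  have mD : measurable (`]0, T[%classic : set R) by exact: measurable_itv.
  apply: (@le_lt_trans _ _ (\int[leb]_(s in `]0%R, T[%classic) (cst (V ^+ 2)%:E s))%E).
    apply: ge0_le_integral => //.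
    - by move=> s _; rewrite lee_fin sqr_ge0.
    - by apply/measurable_EFinP; exact: measurable_funX.
    - move=> s _; rewrite lee_fin -real_normK ?num_real// lerXn2r ?nnegrE//.
      by have [h _] := av; exact: h.
  rewrite (@integral_cst _ _ _ leb _ mD).
  have fD : (leb `]0%R, T[%classic < +oo)%E by rewrite leb_oo// ltry.
  by apply: lte_mul_pinfty; rewrite ?lee_fin ?sqr_ge0//; exact: fD.
exists psi; first exact: (mild_mild_solution phi_basis mu_ge1 M0 BM av mpsi).
have [upsi _] := mpsi.
have TT : 0 <= T <= T by rewrite T0' lexx.
have -> : eigensolution mu phi j T = S T (phi j).
  by rewrite (heat_phi H_hilbert phi_basis mu_ge1).
apply/eqP; rewrite -subr_eq0 -normr_le0; apply/ler_addgt0Pl => e e0; rewrite addr0.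
(* The trajectory of [v] agrees with that of [vs n] up to [tn n], where the deviation is at most
   [eps n]; uniform continuity up to [T] carries this smallness to the final time. *)
have uz : ucont T (fun s => psi s - S s (phi j)).
  by apply: ucontB => //; exact: ucont_heat.
have e2 : 0 < e / 2 by rewrite divr_gt0.
have [d d0 hd] := uz _ e2.
have [n1 hn1] := tnc d d0; have [n2 hn2] := epsc _ e2.
pose n := maxn n1 n2.
have tnd : T - d < tn n by apply: lt_le_trans hn1 _; apply: tn_mono; rewrite leq_maxl.
have a1 : `|(psi T - S T (phi j)) - (psi (tn n) - S (tn n) (phi j))| <= e / 2.
  apply: hd => //; first by rewrite tn_ge0/= ltW.
  by rewrite gtr0_norm ?subr_gt0//; lra.
have [avn _ hvn] := invn n.
have [psin mpsin] := picard H_hilbert phi_basis mu_ge1 M0 BM T0' x avn small.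
have pE : psi (tn n) = psin (tn n).
  apply: (mild_unique phi_basis mu_ge1 M0 BM av small avn mpsi mpsin (t1 := tn n)).
  - by rewrite tn_ge0/= ltW.
  - by move=> s /andP[_ sn]; have [h _] := hv s; exact: h.
  - by rewrite tn_ge0 lexx.
have a2 : `|psi (tn n) - S (tn n) (phi j)| <= e / 2.
  rewrite pE; apply: (le_trans (hvn _ mpsin)); apply: hn2; exact: leq_maxr.
rewrite -(subrK (psi (tn n) - S (tn n) (phi j)) (psi T - S T (phi j))).
apply: le_trans (ler_normD _ _) _.
by apply: (le_trans (lerD a1 a2)); rewrite -splitr.
Qed.

End local_control.

Theorem theorem1p8 (R : realType) (a b cW1 cW2 cw : R)
    (ha : 1 / 2 <= a < 5 / 8) (hb : 0 < b < 1 / 2)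
    (hcW1 : 0 < cW1) (hcW2 : 0 < cW2) (hcw : 0 < cw)
    (mu : nat -> R) (mu_incr : increasing_seq mu) (mu0_ge1 : 1 <= mu 0%N)
    (weyl : forall G : R, mu 0%N <= G ->
      ((cW1 * G `^ a - cW2 * G `^ b)%:E <= counting_function mu G)%E /\
      (counting_function mu G <= (cW1 * G `^ a + cW2 * G `^ b)%:E)%E)
    (gap : forall k : nat, expR (- cw * mu k `^ (1 / 2)) <= mu k.+1 - mu k)
    (H : completeNormedModType R) (ip : {dot H for (idfun : R -> R)})
    (H_hilbert : norm_of_dot ip) (H_separable : separable H)
    (phi : nat -> H) (phi_basis : hilbert_basis ip phi)
    (B : {linear H -> H}) (B_bounded : bounded_operator B)
    (B_spread : forall j : nat, exists C delta : R,
      [/\ 0 < C, 0 < delta < 1 & forall k : nat,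
        expR (- C * mu k `^ (1 - delta)) <= `|ip (B (phi j)) (phi k)|]) :
  small_time_locally_controllable_to_eigensolutions mu phi (diagonal_operator ip phi mu) B.
Proof.
move=> T j T0.
have /andP[ha0 ha1] := ha; have /andP[hb0 hb1] := hb.
have mu1 := weyl_ge1 mu_incr mu0_ge1.
have [S hS] := weyl_sum ha0 ha1 hb0 hb1 hcW1 hcW2 mu_incr mu0_ge1 weyl.
have [Cn Cn0 hn] := weyl_near ha0 ha1 hb0 hb1 hcW1 hcW2 mu_incr mu0_ge1 weyl.
have [C [kap [C0 hkap hprod]]] :=
  product_ge_expR hb0 hb1 hcw Cn0 mu_incr mu0_ge1 gap hS hn.
have [C2 [delta [C20 hdelta hsp]]] := B_spread j.
have [C' [g [C'0 weight]]] := moment_weight mu1 C0 hkap C20 hdelta hprod hsp.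
have [K0 [G [K00 moments]]] := discrete_moments mu1 mu_incr hS C'0 weight.
have [M BM] := B_bounded.
have BM' x : `|B x| <= `|M| * `|x|.
  by apply: (le_trans (BM x)); rewrite ler_wpM2r// ler_norm.
exact: (local_control H_hilbert phi_basis mu1 (normr_ge0 M) BM' T0 K00 moments).
Qed.
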